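(* Let $X$ be a finite type source, let $B$, $Y$ and $Y'$ be simply-connected finite type targets, and let $\varphi\colon B\to Y$ be a map. If $f\colon Y\to Y'$ is a rational homotopy equivalence, then the map $$f_*\colon\mathrm{Ph}(X,\varphi)\to\mathrm{Ph}(X,f\circ\varphi),\qquad [h]\mapsto[f\circ h],$$ is surjective.
   Context: All spaces have basepoints, and maps and homotopies are pointed. A finite type source is a connected CW-complex of finite type (finitely many cells in each dimension). A finite type target is a path-connected space $Y$ such that $\pi_n(Y)$ is finitely generated for each $n$. For a map $\varphi\colon B\to Y$, a map $h\colon X\to Y$ is a relative phantom map from $X$ to $\varphi$ if for each $n$ the restriction $h|_{X^n}$ to the $n$-skeleton lifts to $B$ through $\varphi$ up to homotopy, i.e. there is $h^n\colon X^n\to B$ with $\varphi\circ h^n\simeq h|_{X^n}$. $\mathrm{Ph}(X,\varphi)\subset[X,Y]$ denotes the set of pointed homotopy classes of relative phantom maps from $X$ to $\varphi$. A map between simply-connected spaces is a rational homotopy equivalence if it induces an isomorphism on $\pi_*(-)\otimes\mathbb{Q}$. *)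

(* Defs.v *)
From HB Require Import structures.
From mathcomp Require Import all_boot all_order all_algebra.
From mathcomp Require Import generic_quotient.
From mathcomp Require Import all_classical all_reals all_analysis.
From mathcomp Require Import lra.

Set Implicit Arguments.
Unset Strict Implicit.
Unset Printing Implicit Defensive.

Import Order.TTheory GRing.Theory Num.Theory.
Import numFieldNormedType.Exports.

Local Open Scope classical_set_scope.
Local Open Scope ring_scope.
Local Open Scope quotient_scope.

Section within.
Context {R : realType}.

Lemma within_continuousP (T U : topologicalType) (S : set T) (f : T -> U) :
  {within S, continuous f} <->
  forall x, S x -> forall V, nbhs (f x) V -> \forall y \near x, S y -> V (f y).
Proof. exact: subspace_continuousP. Qed.

Lemma within_comp (T U V : topologicalType) (S : set T) (S' : set U)
    (f : T -> U) (g : U -> V) :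
  {within S, continuous f} -> {within S', continuous g} ->
  (forall x, S x -> S' (f x)) -> {within S, continuous (g \o f)}.
Proof.
move=> /within_continuousP cf /within_continuousP cg fS.
apply/within_continuousP => x Sx W /cg - /(_ (fS _ Sx)) /(cf _ Sx).
by apply: filterS => y h Sy; apply: h => //; exact: fS.
Qed.

Lemma within_eq (T U : topologicalType) (S : set T) (f g : T -> U) :
  (forall x, S x -> f x = g x) ->
  {within S, continuous f} -> {within S, continuous g}.
Proof.
by move=> e; apply: subspace_eq_continuous => x; rewrite inE; exact: e.
Qed.

Lemma within_paste (T U : topologicalType) (S : set T) (m : T -> R) (c : R)
    (f g : T -> U) :
  continuous m ->
  {within S `&` [set z | m z <= c], continuous f} ->
  {within S `&` [set z | c <= m z], continuous g} ->
  (forall z, S z -> m z = c -> f z = g z) ->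
  {within S, continuous (fun z => if m z <= c then f z else g z)}.
Proof.
move=> cm /within_continuousP cf /within_continuousP cg fg.
apply/within_continuousP => x Sx W.
have L : nbhs (if m x <= c then f x else g x) W ->
    \forall y \near x, S y /\ m y <= c -> W (f y).
  case: ifPn => [mx|]; first exact: cf.
  rewrite -ltNge => mx _.
  have : \forall y \near x, c < m y by exact: cvgr_gt (cm x) _ mx.
  by apply: filterS => y my [_]; rewrite leNgt my.
have M : nbhs (if m x <= c then f x else g x) W ->
    \forall y \near x, S y /\ c <= m y -> W (g y).
  case: (ltgtP (m x) c) => [mx _|mx|mx].
  - have : \forall y \near x, m y < c by exact: cvgr_lt (cm x) _ mx.
    by apply: filterS => y my [_]; rewrite leNgt my.
  - by apply: cg; split => //; exact: ltW.
  - by rewrite fg //; apply: cg; split => //=; rewrite mx.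
move=> Wx; near=> y => Sy; case: ifPn => my.
  by apply: (near (L Wx) y).
by apply: (near (M Wx) y) => //; split => //; rewrite ltW // ltNge.
Unshelve. all: by end_near. Qed.

Lemma continuous_affine (T : topologicalType) (a b : R) (m : T -> R) :
  continuous m -> continuous (fun z => a * m z + b).
Proof.
move=> cm z; apply: cvgD; last exact: cvg_cst.
by apply: cvgM; [exact: cvg_cst|exact: cm].
Qed.

Lemma continuous_double (T : topologicalType) (m : T -> R) :
  continuous m -> continuous (fun z => 2 * m z).
Proof. by move=> cm z; apply: cvgM; [exact: cvg_cst|exact: cm]. Qed.

Lemma continuous_onem (T : topologicalType) (m : T -> R) :
  continuous m -> continuous (fun z => 1 - m z).
Proof. by move=> cm z; apply: cvgB; [exact: cvg_cst|exact: cm]. Qed.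

Lemma within_pair (T U V : topologicalType) (S : set T) (f : T -> U)
    (g : T -> V) :
  {within S, continuous f} -> {within S, continuous g} ->
  {within S, continuous (fun z => (f z, g z))}.
Proof. by move=> cf cg x; apply: cvg_pair; [exact: cf|exact: cg]. Qed.

Lemma within_row (T : topologicalType) (S : set T) n (f : T -> 'rV[R]_n) :
  (forall j, {within S, continuous (fun z => f z ord0 j)}) ->
  {within S, continuous f}.
Proof.
move=> cf x W [P Px PW].
have : \forall y \near (x : subspace S), forall j, P ord0 j (f y ord0 j).
  by apply: filter_forall => j; exact: (cf j x _ (Px ord0 j)).
apply: filterS => y h; apply: PW => i j; rewrite (ord1 i); exact: h.
Qed.

End within.

Section homotopy.
Context (R : realType).

(* [f] and [g] are homotopic on [A] relative to [C], where maps defined on a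
   subspace [A] are represented by functions on the ambient space whose values
   outside [A] are irrelevant. *)
Definition homotopic_rel (X Y : topologicalType) (A C : set X) (f g : X -> Y) :=
  exists H : R * X -> Y,
    [/\ {within `[0, 1] `*` A, continuous H},
        forall x, A x -> H (0, x) = f x,
        forall x, A x -> H (1, x) = g x &
        forall (t : R) x, 0 <= t <= 1 -> C x -> H (t, x) = f x].

Section equiv.
Context (X Y : topologicalType) (A C : set X).
Hypothesis CA : C `<=` A.
Implicit Types f g h : X -> Y.

Lemma homotopic_rel_refl f :
  {within A, continuous f} -> homotopic_rel A C f f.
Proof.
move=> cf; exists (f \o snd); split=> //.
apply: (within_comp _ cf) => [|z []//].
by apply: continuous_subspaceT => z; exact: cvg_snd.
Qed.

Lemma homotopic_rel_sym f g :
  homotopic_rel A C f g -> homotopic_rel A C g f.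
Proof.
move=> [H [cH H0 H1 HC]].
have I1 : 0 <= (1 : R) <= 1 by rewrite ler01 lexx.
exists (H \o (fun z => (1 - z.1, z.2))); split => [|x Ax|x Ax|t x It Cx] /=.
- apply: (within_comp _ cH) => [|[t x] [/= It Ax]].
    apply: within_pair; apply: continuous_subspaceT => z; last exact: cvg_snd.
    by apply: cvgB; [exact: cvg_cst|exact: cvg_fst].
  by split => //=; move: It; rewrite !in_itv /= => /andP[? ?]; lra.
- by rewrite subr0 H1.
- by rewrite subrr H0.
- rewrite HC //; last by move: It => /andP[? ?]; lra.
  by rewrite -(HC 1) // H1 //; exact: CA.
Qed.

Lemma homotopic_rel_trans f g h :
  homotopic_rel A C f g -> homotopic_rel A C g h -> homotopic_rel A C f h.
Proof.
move=> [H [cH H0 H1 HC]] [K [cK K0 K1 KC]].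
have I1 : 0 <= (1 : R) <= 1 by rewrite ler01 lexx.
exists (fun z => if z.1 <= 2^-1 then H (2 * z.1, z.2)
                 else K (2 * z.1 - 1, z.2)); split => [|x Ax|x Ax|t x It Cx] /=.
- apply: within_paste.
  + by move=> z; exact: cvg_fst.
  + apply: (within_comp _ cH) => [|[t x] [[/= It Ax] ht]].
      apply: within_pair; apply: continuous_subspaceT => z; last exact: cvg_snd.
      by apply: cvgM; [exact: cvg_cst|exact: cvg_fst].
    by split => //=; move: It; rewrite !in_itv /= => /andP[? ?]; lra.
  + apply: (within_comp _ cK) => [|[t x] [[/= It Ax] ht]].
      apply: within_pair; apply: continuous_subspaceT => z; last exact: cvg_snd.
      apply: cvgB; last exact: cvg_cst.
      by apply: cvgM; [exact: cvg_cst|exact: cvg_fst].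
    by split => //=; move: It; rewrite !in_itv /= => /andP[? ?]; lra.
  + move=> [t x] [/= It Ax] ->.
    by rewrite divff // subrr K0 // H1.
- by rewrite ifT ?mulr0 ?H0 //; lra.
- rewrite ifF; last by apply/negbTE; rewrite -ltNge; lra.
  by rewrite mulr1 -K1 //; congr (K (_, _)); lra.
- move: It => /andP[t0 t1]; case: ifPn => ht.
    by rewrite HC //; lra.
  rewrite KC //; last by move: ht; rewrite -ltNge => ht; lra.
  by rewrite -(HC 1) // H1 //; exact: CA.
Qed.

End equiv.

Lemma homotopic_rel_post (X Y Z : topologicalType) (A C : set X) (f g : X -> Y)
    (k : Y -> Z) :
  continuous k -> homotopic_rel A C f g -> homotopic_rel A C (k \o f) (k \o g).
Proof.
move=> ck [H [cH H0 H1 HC]]; exists (k \o H); split => /=.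
- apply: (within_comp cH (S' := setT)) => //.
  exact: continuous_subspaceT.
- by move=> x Ax; rewrite H0.
- by move=> x Ax; rewrite H1.
- by move=> t x It Cx; rewrite HC.
Qed.

End homotopy.

Definition path_connected (R : realType) (Y : topologicalType) :=
  forall x y : Y, exists p : R -> Y,
    [/\ {within `[0, 1], continuous p}, p 0 = x & p 1 = y].

Record pointed_map (X Y : ptopologicalType) := PointedMap {
  pmap_fun :> X -> Y;
  pmap_continuous : continuous pmap_fun;
  pmap_point : pmap_fun point = point }.

HB.instance Definition _ (X Y : ptopologicalType) := gen_eqMixin (pointed_map X Y).
HB.instance Definition _ (X Y : ptopologicalType) := gen_choiceMixin (pointed_map X Y).

Program Definition pointed_comp (X Y Z : ptopologicalType) (g : pointed_map Y Z)
    (f : pointed_map X Y) : pointed_map X Z := @PointedMap X Z (g \o f) _ _.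
Next Obligation.
by move=> X Y Z g f x; apply: continuous_comp; exact: pmap_continuous.
Qed.
Next Obligation. by move=> X Y Z g f /=; rewrite !pmap_point. Qed.

Section classes.
Context (R : realType) (X Y : ptopologicalType).

Definition phomotopic (f g : pointed_map X Y) : bool :=
  `[< homotopic_rel R setT [set point] f g >].

Lemma phomotopic_refl : reflexive phomotopic.
Proof.
move=> f; apply/asboolP/homotopic_rel_refl.
exact/continuous_subspaceT/pmap_continuous.
Qed.

Lemma phomotopic_sym : symmetric phomotopic.
Proof. by move=> f g; apply/asboolP/asboolP; exact: homotopic_rel_sym. Qed.

Lemma phomotopic_trans : transitive phomotopic.
Proof.
move=> g f h /asboolP fg /asboolP gh; apply/asboolP.
exact: homotopic_rel_trans fg gh.
Qed.

Canonical phomotopic_equiv :=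
  EquivRel phomotopic phomotopic_refl phomotopic_sym phomotopic_trans.

(* The set [X, Y] of pointed homotopy classes. *)
Definition hclass := {eq_quot phomotopic_equiv}.
HB.instance Definition _ := Choice.on hclass.
HB.instance Definition _ := Quotient.on hclass.

Lemma hclass_eqP (f g : pointed_map X Y) :
  \pi_hclass f = \pi_hclass g <-> homotopic_rel R setT [set point] f g.
Proof. by split=> [/eqmodP/asboolP|h]; last exact/eqmodP/asboolP. Qed.

End classes.

Definition hclass_post (R : realType) (X Y Z : ptopologicalType) (f : pointed_map Y Z)
    (a : hclass R X Y) : hclass R X Z :=
  \pi_(hclass R X Z) (pointed_comp f (repr a)).

Lemma hclass_post_pi (R : realType) (X Y Z : ptopologicalType) (f : pointed_map Y Z)
    (h : pointed_map X Y) :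
  hclass_post f (\pi_(hclass R X Y) h) = \pi_(hclass R X Z) (pointed_comp f h).
Proof.
apply/hclass_eqP/homotopic_rel_post; first exact: pmap_continuous.
by apply/hclass_eqP; rewrite reprK.
Qed.

Section loops.
Context (R : realType).

Definition cube n : set 'rV[R]_n := [set x | forall j, 0 <= x ord0 j <= 1].
Definition cube_boundary n : set 'rV[R]_n :=
  [set x | cube x /\ exists j, x ord0 j = 0 \/ x ord0 j = 1].

(* Maps (I^n, boundary of I^n) -> (Y, point). *)
Record nloop n (Y : ptopologicalType) := NLoop {
  nloop_fun :> 'rV[R]_n -> Y;
  nloop_continuous : {within @cube n, continuous nloop_fun};
  nloop_boundary : forall x, cube_boundary x -> nloop_fun x = point }.

Arguments nloop_continuous {n Y} u : rename.

HB.instance Definition _ n Y := gen_eqMixin (nloop n Y).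
HB.instance Definition _ n Y := gen_choiceMixin (nloop n Y).

Lemma cube_boundary_sub n : @cube_boundary n `<=` @cube n.
Proof. by move=> x []. Qed.

Section ops.
Context (n : nat) (Y : ptopologicalType).
Implicit Types (u v w : nloop n Y) (i j : 'I_n) (x : 'rV[R]_n).

Definition nloop_homotopic u v : bool :=
  `[< homotopic_rel R (@cube n) (@cube_boundary n) u v >].

Lemma nloop_homotopic_refl : reflexive nloop_homotopic.
Proof.
by move=> u; apply/asboolP/homotopic_rel_refl; exact: nloop_continuous.
Qed.

Lemma nloop_homotopic_sym : symmetric nloop_homotopic.
Proof.
move=> u v; apply/asboolP/asboolP; apply: homotopic_rel_sym;
  exact: cube_boundary_sub.
Qed.

Lemma nloop_homotopic_trans : transitive nloop_homotopic.
Proof.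
move=> v u w /asboolP uv /asboolP vw; apply/asboolP.
by apply: homotopic_rel_trans uv vw; exact: cube_boundary_sub.
Qed.

Canonical nloop_homotopic_equiv := EquivRel nloop_homotopic
  nloop_homotopic_refl nloop_homotopic_sym nloop_homotopic_trans.

Definition upd x i (s : R) : 'rV[R]_n :=
  \row_j (if j == i then s else x ord0 j).

Lemma updE x i s : upd x i s ord0 i = s.
Proof. by rewrite mxE eqxx. Qed.

Lemma upd_neq x i j s : j != i -> upd x i s ord0 j = x ord0 j.
Proof. by move=> ji; rewrite mxE (negbTE ji). Qed.

Lemma upd_upd x i s t : upd (upd x i s) i t = upd x i t.
Proof. by apply/rowP => j; rewrite !mxE; case: eqP. Qed.

Lemma upd_updC x i j s t : i != j ->
  upd (upd x i s) j t = upd (upd x j t) i s.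
Proof.
move=> ij; apply/rowP => k; rewrite !mxE.
by case: (eqVneq k j) => // ->; rewrite eq_sym (negbTE ij).
Qed.

Lemma cube_upd x i s : cube x -> 0 <= s <= 1 -> cube (upd x i s).
Proof. by move=> Ax Is j; rewrite mxE; case: eqP. Qed.

Lemma boundary_upd x i s : cube x -> s = 0 \/ s = 1 -> cube_boundary (upd x i s).
Proof.
move=> Ax Is; split; last by exists i; rewrite updE.
by apply: cube_upd => //; case: Is => ->; rewrite ?lexx ?ler01.
Qed.

Lemma coord_cont i : continuous (fun x => x ord0 i).
Proof. exact: coord_continuous. Qed.

Lemma snd_coord_cont i : continuous (fun z : R * 'rV[R]_n => z.2 ord0 i).
Proof.
move=> z; apply: (@continuous_comp _ _ _ snd (fun x => x ord0 i)).
  exact: cvg_snd.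
exact: coord_cont.
Qed.

Lemma within_upd (T : topologicalType) (S : set T) (a : T -> 'rV[R]_n) i
    (s : T -> R) : {within S, continuous a} -> {within S, continuous s} ->
  {within S, continuous (fun z => upd (a z) i (s z))}.
Proof.
move=> ca cs; apply: within_row => j.
case: (eqVneq j i) => [->|ji].
  by apply: (within_eq _ cs) => z _; rewrite updE.
apply: (@within_eq _ _ _ (fun z => a z ord0 j)).
  by move=> z _; rewrite upd_neq.
apply: (within_comp (g := fun x : 'rV[R]_n => x ord0 j) ca (S' := setT)) => //.
exact/continuous_subspaceT/coord_cont.
Qed.

Lemma within_comp_upd (T U : topologicalType) (S : set T) (S' : set 'rV[R]_n)
    (u : 'rV[R]_n -> U) (a : T -> 'rV[R]_n) i (s : T -> R) :
  {within S', continuous u} ->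
  continuous a -> continuous s ->
  (forall z, S z -> S' (upd (a z) i (s z))) ->
  {within S, continuous (fun z => u (upd (a z) i (s z)))}.
Proof.
move=> cu ca cs aS.
apply: (within_comp (f := fun z => upd (a z) i (s z)) _ cu) => //.
by apply: within_upd; exact: continuous_subspaceT.
Qed.

Lemma within_comp_pair_upd (T U : topologicalType) (S : set T)
    (S' : set (R * 'rV[R]_n)) (H : R * 'rV[R]_n -> U) (t : T -> R)
    (a : T -> 'rV[R]_n) i (s : T -> R) :
  {within S', continuous H} ->
  continuous t -> continuous a -> continuous s ->
  (forall z, S z -> S' (t z, upd (a z) i (s z))) ->
  {within S, continuous (fun z => H (t z, upd (a z) i (s z)))}.
Proof.
move=> cH ct ca cs aS.
apply: (within_comp (f := fun z => (t z, upd (a z) i (s z))) _ cH) => //.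
apply: within_pair; first exact: continuous_subspaceT.
by apply: within_upd; exact: continuous_subspaceT.
Qed.

Program Definition nloop_cst : nloop n Y := @NLoop n Y (fun=> point) _ _.
Next Obligation. by apply: continuous_subspaceT; exact: cst_continuous. Qed.
Next Obligation. by []. Qed.

Definition cat_fun i (u v : 'rV[R]_n -> Y) x : Y :=
  if x ord0 i <= 2^-1 then u (upd x i (2 * x ord0 i))
  else v (upd x i (2 * x ord0 i - 1)).

Definition rev_fun i (u : 'rV[R]_n -> Y) x : Y := u (upd x i (1 - x ord0 i)).

Lemma cat_boundary i u v x : cube_boundary x -> cat_fun i u v x = point.
Proof.
move=> [Ax [j hj]]; have := Ax i; rewrite /cat_fun => /andP[x0 x1].
have [ij|ij] := eqVneq j i; last first.
  case: ifPn => hx; apply: nloop_boundary; split.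
  - by apply: cube_upd => //; lra.
  - by exists j; rewrite upd_neq.
  - by apply: cube_upd => //; rewrite -ltNge in hx; lra.
  - by exists j; rewrite upd_neq.
rewrite ij in hj; case: hj => hj; rewrite hj.
  rewrite ifT; last by lra.
  by apply: nloop_boundary; apply: boundary_upd => //; left; lra.
rewrite ifF; last by apply/negbTE; rewrite -ltNge; lra.
by apply: nloop_boundary; apply: boundary_upd => //; right; lra.
Qed.

Lemma cat_continuous i u v : {within @cube n, continuous (cat_fun i u v)}.
Proof.
have ci : continuous (fun x => x ord0 i) by exact: coord_cont.
apply: within_paste => //.
- apply: (within_comp_upd (nloop_continuous u)) => [x||x [Ax /= hx]].
  + exact: cvg_id.
  + exact: continuous_double.
  + by apply: cube_upd => //; have /andP[? ?] := Ax i; lra.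
- apply: (within_comp_upd (nloop_continuous v)) => [x||x [Ax /= hx]].
  + exact: cvg_id.
  + exact: continuous_affine.
  + by apply: cube_upd => //; have /andP[? ?] := Ax i; lra.
- move=> x Ax hx; rewrite !nloop_boundary //; apply: boundary_upd => //.
    by left; lra.
  by right; lra.
Qed.

Definition nloop_cat i u v : nloop n Y :=
  @NLoop n Y (cat_fun i u v) (@cat_continuous i u v) (@cat_boundary i u v).

Lemma rev_boundary i u x : cube_boundary x -> rev_fun i u x = point.
Proof.
move=> [Ax [j hj]]; rewrite /rev_fun.
apply: nloop_boundary; split.
  by apply: cube_upd => //; have /andP[? ?] := Ax i; lra.
exists j; have [<-|ij] := eqVneq j i; last by rewrite upd_neq.
by rewrite updE; case: hj => ->; [right|left]; lra.
Qed.

Lemma rev_continuous i u : {within @cube n, continuous (rev_fun i u)}.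
Proof.
apply: (within_comp_upd (nloop_continuous u)) => [x||x Ax].
- exact: cvg_id.
- by apply: continuous_onem; exact: coord_cont.
- by apply: cube_upd => //; have /andP[? ?] := Ax i; lra.
Qed.

Definition nloop_rev i u : nloop n Y :=
  @NLoop n Y (rev_fun i u) (@rev_continuous i u) (@rev_boundary i u).

(* [u] precomposed in direction [i] with [s] and [t] are homotopic. *)
Lemma reparam_homotopic i u (s t : R -> R) (f g : 'rV[R]_n -> Y) :
  continuous s -> continuous t ->
  (forall a, 0 <= a <= 1 -> 0 <= s a <= 1) ->
  (forall a, 0 <= a <= 1 -> 0 <= t a <= 1) ->
  s 0 = t 0 -> s 1 = t 1 -> (s 0 = 0 \/ s 0 = 1) -> (s 1 = 0 \/ s 1 = 1) ->
  (forall x, cube x -> f x = u (upd x i (s (x ord0 i)))) ->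
  (forall x, cube x -> g x = u (upd x i (t (x ord0 i)))) ->
  homotopic_rel R (@cube n) (@cube_boundary n) f g.
Proof.
move=> cs ct Is It st0 st1 s0 s1 fE gE.
exists (fun z : R * 'rV[R]_n => u (upd z.2 i
  ((1 - z.1) * s (z.2 ord0 i) + z.1 * t (z.2 ord0 i)))); split => /=.
- apply: (within_comp_upd (nloop_continuous u)) => [z|z|[a x] [/= Ia Ax]].
  + exact: cvg_snd.
  + have cz := @snd_coord_cont i z.
    apply: cvgD; apply: cvgM.
    * by apply: cvgB; [exact: cvg_cst|exact: cvg_fst].
    * exact: (continuous_comp cz (cs _)).
    * exact: cvg_fst.
    * exact: (continuous_comp cz (ct _)).
  + apply: cube_upd => //; move: Ia; rewrite in_itv /= => /andP[a0 a1].
    have /andP[? ?] := Is _ (Ax i); have /andP[? ?] := It _ (Ax i).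
    by apply/andP; split; nra.
- by move=> x Ax; rewrite subr0 mul1r mul0r addr0 fE.
- by move=> x Ax; rewrite subrr mul0r mul1r add0r gE.
- move=> a x /andP[a0 a1] [Ax [j hj]].
  rewrite fE //.
  have /andP[? ?] := Is _ (Ax i); have /andP[? ?] := It _ (Ax i).
  have [ij|ij] := eqVneq j i; last first.
    have B c : 0 <= c <= 1 -> cube_boundary (upd x i c).
      by move=> Ic; split; [exact: cube_upd|exists j; rewrite upd_neq].
    rewrite !nloop_boundary //; apply: B; first exact: Is.
    by apply/andP; split; nra.
  by congr (u (upd x i _)); rewrite -ij; case: hj => ->;
    rewrite -?st0 -?st1 -mulrDl subrK mul1r.
Qed.

Lemma cat_homotopic i (u u' v v' : nloop n Y) :
  homotopic_rel R (@cube n) (@cube_boundary n) u u' ->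
  homotopic_rel R (@cube n) (@cube_boundary n) v v' ->
  homotopic_rel R (@cube n) (@cube_boundary n)
    (nloop_cat i u v) (nloop_cat i u' v').
Proof.
move=> [H [cH H0 H1 HC]] [K [cK K0 K1 KC]].
have ci := @snd_coord_cont i.
exists (fun z : R * 'rV[R]_n => if z.2 ord0 i <= 2^-1
  then H (z.1, upd z.2 i (2 * z.2 ord0 i))
  else K (z.1, upd z.2 i (2 * z.2 ord0 i - 1))); split => /=.
- apply: within_paste => //.
  + apply: (within_comp_pair_upd cH) => [z|z||[t x] [[/= It Ax] hx]].
    * exact: cvg_fst.
    * exact: cvg_snd.
    * exact: continuous_double.
    * by split => //=; apply: cube_upd => //; have /andP[? ?] := Ax i; lra.
  + apply: (within_comp_pair_upd cK) => [z|z||[t x] [[/= It Ax] hx]].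
    * exact: cvg_fst.
    * exact: cvg_snd.
    * exact: continuous_affine.
    * by split => //=; apply: cube_upd => //; have /andP[? ?] := Ax i; lra.
  + move=> [t x] [/= It Ax] hx.
    have b0 : cube_boundary (upd x i (2 * x ord0 i)).
      by apply: boundary_upd => //; right; lra.
    have b1 : cube_boundary (upd x i (2 * x ord0 i - 1)).
      by apply: boundary_upd => //; left; lra.
    by rewrite HC // KC // !nloop_boundary.
- move=> x Ax; have /andP[? ?] := Ax i; rewrite /cat_fun; case: ifPn => hx.
    by rewrite H0 //; apply: cube_upd => //; lra.
  by rewrite -ltNge in hx; rewrite K0 //; apply: cube_upd => //; lra.
- move=> x Ax; have /andP[? ?] := Ax i; rewrite /cat_fun; case: ifPn => hx.
    by rewrite H1 //; apply: cube_upd => //; lra.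
  by rewrite -ltNge in hx; rewrite K1 //; apply: cube_upd => //; lra.
- move=> t x It [Ax [j hj]]; have /andP[? ?] := Ax i; rewrite /cat_fun.
  have B s : 0 <= s <= 1 -> (j = i -> s = 0 \/ s = 1) ->
      cube_boundary (upd x i s).
    move=> Is hs; split; first exact: cube_upd.
    exists j; have [ji|ji] := eqVneq j i; last by rewrite upd_neq.
    by rewrite ji updE; exact: hs.
  case: ifPn => hx; last rewrite -ltNge in hx.
    rewrite HC //; apply: B; first lra.
    by move=> ji; rewrite ji in hj; case: hj => hj; [left|right]; lra.
  rewrite KC //; apply: B; first lra.
  by move=> ji; rewrite ji in hj; case: hj => hj; [left|right]; lra.
Qed.

Lemma rev_homotopic i (u u' : nloop n Y) :
  homotopic_rel R (@cube n) (@cube_boundary n) u u' ->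
  homotopic_rel R (@cube n) (@cube_boundary n)
    (nloop_rev i u) (nloop_rev i u').
Proof.
move=> [H [cH H0 H1 HC]].
have B x : cube x -> cube (upd x i (1 - x ord0 i)).
  by move=> Ax; apply: cube_upd => //; have /andP[? ?] := Ax i; lra.
exists (fun z : R * 'rV[R]_n => H (z.1, upd z.2 i (1 - z.2 ord0 i))); split => /=.
- apply: (within_comp_pair_upd cH) => [z|z||[t x] [/= It Ax]].
  + exact: cvg_fst.
  + exact: cvg_snd.
  + by apply: continuous_onem; exact: snd_coord_cont.
  + by split => //; exact: B.
- by move=> x Ax; rewrite H0 //; exact: B.
- by move=> x Ax; rewrite H1 //; exact: B.
- move=> t x It [Ax [j hj]]; rewrite HC //; split; first exact: B.
  exists j; have [<-|ij] := eqVneq j i; last by rewrite upd_neq.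
  by rewrite updE; case: hj => ->; [right|left]; lra.
Qed.

Lemma cat_interchange i j (a b c d : 'rV[R]_n -> Y) : i != j ->
  cat_fun i (cat_fun j a b) (cat_fun j c d) =
  cat_fun j (cat_fun i a c) (cat_fun i b d).
Proof.
move=> ij; apply/funext => x; rewrite /cat_fun.
have ji : j != i by rewrite eq_sym.
by rewrite !upd_neq //; do 2![case: ifPn => _]; rewrite upd_updC.
Qed.

End ops.

Definition homotopy_group n (Y : ptopologicalType) :=
  {eq_quot (nloop_homotopic_equiv n Y)}.
HB.instance Definition _ n Y := Choice.on (homotopy_group n Y).
HB.instance Definition _ n Y := Quotient.on (homotopy_group n Y).

Lemma homotopy_group_eqP n Y (u v : nloop n Y) :
  \pi_(homotopy_group n Y) u = \pi_(homotopy_group n Y) v <->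
  homotopic_rel R (@cube n) (@cube_boundary n) u v.
Proof. by split=> [/eqmodP/asboolP|h]; last exact/eqmodP/asboolP. Qed.

Section group_laws.
Context (n : nat) (Y : ptopologicalType).
Implicit Types (u v w : nloop n Y) (i : 'I_n).
Local Notation pi_ := (\pi_(homotopy_group n Y)).

Definition hg_one : homotopy_group n Y :=
  \pi_(homotopy_group n Y) (nloop_cst n Y).
Definition hg_mul i (a b : homotopy_group n Y) : homotopy_group n Y :=
  \pi_(homotopy_group n Y) (nloop_cat i (repr a) (repr b)).
Definition hg_inv i (a : homotopy_group n Y) : homotopy_group n Y :=
  \pi_(homotopy_group n Y) (nloop_rev i (repr a)).

Lemma repr_homotopic u :
  homotopic_rel R (@cube n) (@cube_boundary n) (repr (pi_ u)) u.
Proof. by apply/homotopy_group_eqP; rewrite reprK. Qed.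

Lemma hg_mul_pi i u v : hg_mul i (pi_ u) (pi_ v) = pi_ (nloop_cat i u v).
Proof. by apply/homotopy_group_eqP/cat_homotopic; exact: repr_homotopic. Qed.

Lemma hg_inv_pi i u : hg_inv i (pi_ u) = pi_ (nloop_rev i u).
Proof. by apply/homotopy_group_eqP/rev_homotopic; exact: repr_homotopic. Qed.

Lemma hg_ind (P : homotopy_group n Y -> Prop) :
  (forall u, P (pi_ u)) -> forall a, P a.
Proof. by move=> h a; rewrite -[a]reprK. Qed.

Lemma reparam_eq i u v w (s t : R -> R) :
  continuous s -> continuous t ->
  (forall a, 0 <= a <= 1 -> 0 <= s a <= 1) ->
  (forall a, 0 <= a <= 1 -> 0 <= t a <= 1) ->
  s 0 = t 0 -> s 1 = t 1 -> (s 0 = 0 \/ s 0 = 1) -> (s 1 = 0 \/ s 1 = 1) ->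
  (forall x, cube x -> v x = u (upd x i (s (x ord0 i)))) ->
  (forall x, cube x -> w x = u (upd x i (t (x ord0 i)))) ->
  pi_ v = pi_ w.
Proof.
move=> cs ct Is It st0 st1 s0 s1 vE wE.
by apply/homotopy_group_eqP; apply: (@reparam_homotopic _ _ i u s t).
Qed.

Lemma min_cont (s t : R -> R) : continuous s -> continuous t ->
  continuous (fun a => Num.min (s a) (t a)).
Proof. by move=> cs ct a; apply: continuous_min; [exact: cs|exact: ct]. Qed.

Lemma max_cont (s t : R -> R) : continuous s -> continuous t ->
  continuous (fun a => Num.max (s a) (t a)).
Proof. by move=> cs ct a; apply: continuous_max; [exact: cs|exact: ct]. Qed.

Lemma aff_cont (a b : R) : continuous (fun s : R => a * s + b).
Proof. by apply: continuous_affine => s; exact: cvg_id. Qed.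

Lemma id_cont : continuous (fun s : R => s).
Proof. by move=> s; exact: cvg_id. Qed.

Lemma upd_id (x : 'rV[R]_n) i : upd x i (x ord0 i) = x.
Proof. by apply/rowP => j; rewrite mxE; case: eqP => // ->. Qed.

Lemma hg_mulA i : associative (hg_mul i).
Proof.
elim/hg_ind => u; elim/hg_ind => v; elim/hg_ind => w; rewrite !hg_mul_pi.
pose s (a : R) := Num.min (2 * a + 0) (Num.min (1 * a + 4^-1) (2^-1 * a + 2^-1)).
have sE a : s a = if a <= 4^-1 then 2 * a else
                  if a <= 2^-1 then a + 4^-1 else 2^-1 * a + 2^-1.
  rewrite /s !minEle; case: (lerP (1 * a + _)) => ?;
  by do ![case: lerP => ?]; lra.
apply: (@reparam_eq i (nloop_cat i u (nloop_cat i v w)) _ _ id s) => //.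
- exact: id_cont.
- by apply: min_cont; [|apply: min_cont]; exact: aff_cont.
- by move=> a /andP[? ?]; rewrite sE; do ![case: (lerP a) => ?]; lra.
- by rewrite sE; do ![case: lerP => ?]; lra.
- by rewrite sE; do ![case: lerP => ?]; lra.
- by left.
- by right.
- by move=> x _; rewrite upd_id.
- move=> x Ax; rewrite /= /cat_fun sE !updE !upd_upd.
  move: (x ord0 i) (Ax i) => a /andP[? ?].
  have E (f : 'rV[R]_n -> Y) (c d : R) : c = d -> f (upd x i c) = f (upd x i d).
    by move=> ->.
  case: (lerP a 4^-1) => ?; case: (lerP a 2^-1) => ?;
  by do ?[case: lerP => ?]; try (by apply: E; lra); exfalso; lra.
Qed.

Lemma hg_mul1 i : right_id hg_one (hg_mul i).
Proof.
elim/hg_ind => u; rewrite hg_mul_pi.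
pose s (a : R) := Num.min (2 * a + 0) 1.
have sE a : s a = if a <= 2^-1 then 2 * a else 1.
  by rewrite /s ?minEle ?maxEle; do ![case: lerP => ?]; lra.
apply: (@reparam_eq i u _ _ s id) => //.
- by apply: min_cont; [exact: aff_cont|exact: cst_continuous].
- exact: id_cont.
- by move=> a /andP[? ?]; rewrite sE; case: (lerP a) => ?; lra.
- by rewrite sE; case: lerP => ?; lra.
- by rewrite sE; case: lerP => ?; lra.
- by left; rewrite sE; case: lerP => ?; lra.
- by right; rewrite sE; case: lerP => ?; lra.
- move=> x Ax; rewrite /= /cat_fun sE; case: ifPn => // _.
  by rewrite nloop_boundary //; apply: boundary_upd => //; right.
- by move=> x _; rewrite upd_id.
Qed.

Lemma hg_1mul i : left_id hg_one (hg_mul i).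
Proof.
elim/hg_ind => u; rewrite hg_mul_pi.
pose s (a : R) := Num.max (2 * a - 1) 0.
have sE a : s a = if a <= 2^-1 then 0 else 2 * a - 1.
  by rewrite /s ?minEle ?maxEle; do ![case: lerP => ?]; lra.
apply: (@reparam_eq i u _ _ s id) => //.
- by apply: max_cont; [exact: aff_cont|exact: cst_continuous].
- exact: id_cont.
- by move=> a /andP[? ?]; rewrite sE; case: (lerP a) => ?; lra.
- by rewrite sE; case: lerP => ?; lra.
- by rewrite sE; case: lerP => ?; lra.
- by left; rewrite sE; case: lerP => ?; lra.
- by right; rewrite sE; case: lerP => ?; lra.
- move=> x Ax; rewrite /= /cat_fun sE; case: ifPn => // _.
  by rewrite nloop_boundary //; apply: boundary_upd => //; left.
- by move=> x _; rewrite upd_id.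
Qed.

Lemma hg_mulV i : right_inverse hg_one (hg_inv i) (hg_mul i).
Proof.
elim/hg_ind => u; rewrite hg_inv_pi hg_mul_pi.
pose s (a : R) := Num.min (2 * a + 0) (- 2 * a + 2).
have sE a : s a = if a <= 2^-1 then 2 * a else 2 - 2 * a.
  by rewrite /s ?minEle ?maxEle; do ![case: lerP => ?]; lra.
apply: (@reparam_eq i u _ _ s (fun=> 0)) => //.
- by apply: min_cont; exact: aff_cont.
- exact: cst_continuous.
- by move=> a /andP[? ?]; rewrite sE; case: (lerP a) => ?; lra.
- by move=> a _; rewrite lexx ler01.
- by rewrite sE; case: lerP => ?; lra.
- by rewrite sE; case: lerP => ?; lra.
- by left; rewrite sE; case: lerP => ?; lra.
- by left; rewrite sE; case: lerP => ?; lra.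
- move=> x Ax; rewrite /= /cat_fun /rev_fun sE; case: ifPn => // _.
  by rewrite updE upd_upd; congr (u (upd x i _)); lra.
- by move=> x Ax; rewrite [RHS]nloop_boundary //; apply: boundary_upd => //; left.
Qed.

Lemma hg_mulN i : left_inverse hg_one (hg_inv i) (hg_mul i).
Proof.
elim/hg_ind => u; rewrite hg_inv_pi hg_mul_pi.
pose s (a : R) := Num.max (- 2 * a + 1) (2 * a - 1).
have sE a : s a = if a <= 2^-1 then 1 - 2 * a else 2 * a - 1.
  by rewrite /s ?minEle ?maxEle; do ![case: lerP => ?]; lra.
apply: (@reparam_eq i u _ _ s (fun=> 1)) => //.
- by apply: max_cont; exact: aff_cont.
- exact: cst_continuous.
- by move=> a /andP[? ?]; rewrite sE; case: (lerP a) => ?; lra.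
- by move=> a _; rewrite lexx ler01.
- by rewrite sE; case: lerP => ?; lra.
- by rewrite sE; case: lerP => ?; lra.
- by right; rewrite sE; case: lerP => ?; lra.
- by right; rewrite sE; case: lerP => ?; lra.
- move=> x Ax; rewrite /= /cat_fun /rev_fun sE; case: ifPn => // _.
  by rewrite updE upd_upd.
- by move=> x Ax; rewrite [RHS]nloop_boundary //; apply: boundary_upd => //; right.
Qed.

Lemma hg_interchange i j (a b c d : homotopy_group n Y) : i != j ->
  hg_mul i (hg_mul j a b) (hg_mul j c d) =
  hg_mul j (hg_mul i a c) (hg_mul i b d).
Proof.
move=> ij; elim/hg_ind: a => a; elim/hg_ind: b => b.
elim/hg_ind: c => c; elim/hg_ind: d => d; rewrite !hg_mul_pi.
apply/homotopy_group_eqP; rewrite /= cat_interchange //.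
apply: homotopic_rel_refl; exact: (nloop_continuous
  (nloop_cat j (nloop_cat i a c) (nloop_cat i b d))).
Qed.

(* The Eckmann-Hilton argument. *)
Lemma hg_mulC i j : i != j -> commutative (hg_mul i).
Proof.
move=> ij a b.
rewrite -{1}[a](hg_mul1 j) -{1}[b](hg_1mul j) hg_interchange // hg_mul1 hg_1mul.
rewrite -{1}[a](hg_1mul i) -{1}[b](hg_mul1 i) -hg_interchange //.
by rewrite hg_1mul hg_mul1.
Qed.

End group_laws.

End loops.

Arguments nloop_continuous {R n Y} u : rename.

(* For n >= 2 the group pi_n is also equipped with its additive structure. *)
HB.instance Definition _ (R : realType) n (Y : ptopologicalType) :=
  isGroup.Build (homotopy_group R n.+1 Y)
    (hg_mulA ord0) (@hg_1mul R n.+1 Y ord0) (@hg_mul1 R n.+1 Y ord0)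
    (@hg_mulN R n.+1 Y ord0) (@hg_mulV R n.+1 Y ord0).

HB.instance Definition _ (R : realType) n (Y : ptopologicalType) :=
  GRing.isZmodule.Build (homotopy_group R n.+2 Y)
    (@hg_mulA R n.+2 Y ord0) (@hg_mulC R n.+2 Y ord0 ord_max isT)
    (@hg_1mul R n.+2 Y ord0) (@hg_mulN R n.+2 Y ord0).

Section induced.
Context (R : realType) (n : nat) (Y Z : ptopologicalType) (f : pointed_map Y Z).

Program Definition nloop_post (u : nloop R n Y) : nloop R n Z :=
  @NLoop R n Z (f \o u) _ _.
Next Obligation.
move=> u; apply: (within_comp (nloop_continuous u) (S' := setT)) => //.
exact/continuous_subspaceT/pmap_continuous.
Qed.
Next Obligation. by move=> u x bx /=; rewrite nloop_boundary // pmap_point. Qed.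

Definition homotopy_group_map (a : homotopy_group R n Y) : homotopy_group R n Z :=
  \pi_(homotopy_group R n Z) (nloop_post (repr a)).

Lemma homotopy_group_map_pi (u : nloop R n Y) :
  homotopy_group_map (\pi_(homotopy_group R n Y) u) =
  \pi_(homotopy_group R n Z) (nloop_post u).
Proof.
apply/homotopy_group_eqP/homotopic_rel_post; first exact: pmap_continuous.
exact: repr_homotopic.
Qed.

Lemma homotopy_group_mapM i :
  {morph homotopy_group_map : a b / hg_mul i a b >-> hg_mul i a b}.
Proof.
elim/hg_ind => u; elim/hg_ind => v.
rewrite hg_mul_pi !homotopy_group_map_pi hg_mul_pi.
apply/homotopy_group_eqP.
have -> : nloop_post (nloop_cat i u v) =
          nloop_cat i (nloop_post u) (nloop_post v) :> (_ -> _).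
  by apply/funext => x /=; rewrite /cat_fun; case: ifP.
apply: homotopic_rel_refl; exact: (nloop_continuous
  (nloop_cat i (nloop_post u) (nloop_post v))).
Qed.

End induced.

Arguments homotopy_group_map R n {Y Z} f a.

Lemma homotopy_group_mapB (R : realType) n (Y Z : ptopologicalType)
    (f : pointed_map Y Z) : zmod_morphism (homotopy_group_map R n.+2 f).
Proof.
move=> a b; apply: (@addIr _ (homotopy_group_map R n.+2 f b)).
rewrite subrK -[LHS](homotopy_group_mapM f ord0).
by rewrite -[hg_mul _ _ _]/(a - b + b) subrK.
Qed.

HB.instance Definition _ (R : realType) n (Y Z : ptopologicalType)
    (f : pointed_map Y Z) :=
  GRing.isZmodMorphism.Build _ _ (homotopy_group_map R n.+2 f)
    (homotopy_group_mapB f).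

(* Formal sums of symbols [(a, b)], read as a (x) b, modulo the relations
   defining the tensor product over the integers. *)
Inductive tensor_rel (A B : zmodType) : seq (A * B) -> seq (A * B) -> Prop :=
| tensor_refl s : tensor_rel s s
| tensor_sym s t : tensor_rel s t -> tensor_rel t s
| tensor_trans s t u : tensor_rel s t -> tensor_rel t u -> tensor_rel s u
| tensor_cat s s' t t' :
    tensor_rel s s' -> tensor_rel t t' -> tensor_rel (s ++ t) (s' ++ t')
| tensor_catC s t : tensor_rel (s ++ t) (t ++ s)
| tensor_addl a a' b : tensor_rel [:: (a + a', b)] [:: (a, b); (a', b)]
| tensor_addr a b b' : tensor_rel [:: (a, b + b')] [:: (a, b); (a, b')]
| tensor_0l b : tensor_rel [:: (0, b)] [::]
| tensor_0r a : tensor_rel [:: (a, 0)] [::].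

Section tensor.
Context (A B : zmodType).
Implicit Types s t : seq (A * B).

Definition tensor_eq s t : bool := `[< tensor_rel s t >].

Lemma tensor_eq_refl : reflexive tensor_eq.
Proof. by move=> s; apply/asboolP; exact: tensor_refl. Qed.

Lemma tensor_eq_sym : symmetric tensor_eq.
Proof. by move=> s t; apply/asboolP/asboolP; exact: tensor_sym. Qed.

Lemma tensor_eq_trans : transitive tensor_eq.
Proof.
by move=> t s u /asboolP st /asboolP tu; apply/asboolP; exact: tensor_trans tu.
Qed.

Canonical tensor_equiv :=
  EquivRel tensor_eq tensor_eq_refl tensor_eq_sym tensor_eq_trans.

Definition tensor := {eq_quot tensor_equiv}.
HB.instance Definition _ := Choice.on tensor.
HB.instance Definition _ := Quotient.on tensor.

Lemma tensor_eqP s t : \pi_tensor s = \pi_tensor t <-> tensor_rel s t.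
Proof. by split=> [/eqmodP/asboolP|h]; last exact/eqmodP/asboolP. Qed.

Lemma tensor_repr s : tensor_rel (repr (\pi_tensor s)) s.
Proof. by apply/tensor_eqP; rewrite reprK. Qed.

Lemma tensor_ind (P : tensor -> Prop) :
  (forall s, P (\pi_tensor s)) -> forall x, P x.
Proof. by move=> h x; rewrite -[x]reprK. Qed.

Definition tensor_opp_seq s : seq (A * B) := [seq (- ab.1, ab.2) | ab <- s].

Lemma tensor_oppK s : tensor_rel (tensor_opp_seq s ++ s) [::].
Proof.
elim: s => [|[a b] s IH] /=; first exact: tensor_refl.
have ab0 : tensor_rel [:: (- a, b); (a, b)] [::].
  apply: (tensor_trans (tensor_sym (tensor_addl (- a) a b))).
  by rewrite addNr; exact: tensor_0l.
rewrite -cat1s -(cat1s (a, b)) catA.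
apply: (tensor_trans (t := [:: (- a, b)] ++
    ([:: (a, b)] ++ tensor_opp_seq s ++ s))).
  rewrite -catA; apply: tensor_cat; first exact: tensor_refl.
  rewrite !catA; apply: tensor_cat; last exact: tensor_refl.
  exact: tensor_catC.
by rewrite catA; exact: (tensor_cat ab0 IH).
Qed.

Lemma tensor_rel_opp s t :
  tensor_rel s t -> tensor_rel (tensor_opp_seq s) (tensor_opp_seq t).
Proof.
elim=> {s t}.
- by move=> s; exact: tensor_refl.
- by move=> s t _; exact: tensor_sym.
- by move=> s t u _ st _; exact: tensor_trans st.
- by move=> s s' t t' _ ss _ tt; rewrite /tensor_opp_seq !map_cat;
    exact: tensor_cat.
- by move=> s t; rewrite /tensor_opp_seq !map_cat; exact: tensor_catC.
- by move=> a a' b; rewrite /= opprD; exact: tensor_addl.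
- by move=> a b b'; exact: tensor_addr.
- by move=> b; rewrite /= oppr0; exact: tensor_0l.
- by move=> a; exact: tensor_0r.
Qed.

Definition tensor_zero : tensor := \pi_tensor [::].
Definition tensor_add (x y : tensor) : tensor := \pi_tensor (repr x ++ repr y).
Definition tensor_opp (x : tensor) : tensor :=
  \pi_tensor (tensor_opp_seq (repr x)).

Lemma tensor_add_pi s t :
  tensor_add (\pi_tensor s) (\pi_tensor t) = \pi_tensor (s ++ t).
Proof. by apply/tensor_eqP/tensor_cat; exact: tensor_repr. Qed.

Lemma tensor_opp_pi s :
  tensor_opp (\pi_tensor s) = \pi_tensor (tensor_opp_seq s).
Proof. by apply/tensor_eqP/tensor_rel_opp; exact: tensor_repr. Qed.

Lemma tensor_addA : associative tensor_add.
Proof.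
elim/tensor_ind => s; elim/tensor_ind => t; elim/tensor_ind => u.
by rewrite !tensor_add_pi catA.
Qed.

Lemma tensor_addC : commutative tensor_add.
Proof.
elim/tensor_ind => s; elim/tensor_ind => t; rewrite !tensor_add_pi.
exact/tensor_eqP/tensor_catC.
Qed.

Lemma tensor_add0 : left_id tensor_zero tensor_add.
Proof. by elim/tensor_ind => s; rewrite tensor_add_pi. Qed.

Lemma tensor_addN : left_inverse tensor_zero tensor_opp tensor_add.
Proof.
elim/tensor_ind => s; rewrite tensor_opp_pi tensor_add_pi.
exact/tensor_eqP/tensor_oppK.
Qed.

HB.instance Definition _ := GRing.isZmodule.Build tensor
  tensor_addA tensor_addC tensor_add0 tensor_addN.

End tensor.

Section tensor_map.
Context (A A' B : zmodType) (f : {additive A -> A'}).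

Definition tensor_map_seq (s : seq (A * B)) : seq (A' * B) :=
  [seq (f ab.1, ab.2) | ab <- s].

Lemma tensor_map_rel s t :
  tensor_rel s t -> tensor_rel (tensor_map_seq s) (tensor_map_seq t).
Proof.
elim=> {s t}.
- by move=> s; exact: tensor_refl.
- by move=> s t _; exact: tensor_sym.
- by move=> s t u _ st _; exact: tensor_trans st.
- by move=> s s' t t' _ ss _ tt; rewrite /tensor_map_seq !map_cat;
    exact: tensor_cat.
- by move=> s t; rewrite /tensor_map_seq !map_cat; exact: tensor_catC.
- by move=> a a' b; rewrite /= raddfD; exact: tensor_addl.
- by move=> a b b'; exact: tensor_addr.
- by move=> b; rewrite /= raddf0; exact: tensor_0l.
- by move=> a; exact: tensor_0r.
Qed.

Definition tensor_map (x : tensor A B) : tensor A' B :=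
  \pi_(tensor A' B) (tensor_map_seq (repr x)).

Lemma tensor_map_pi s :
  tensor_map (\pi_(tensor A B) s) = \pi_(tensor A' B) (tensor_map_seq s).
Proof. by apply/tensor_eqP/tensor_map_rel; exact: tensor_repr. Qed.

Lemma tensor_mapB : zmod_morphism tensor_map.
Proof.
elim/tensor_ind => s; elim/tensor_ind => t.
rewrite [X in tensor_map X](_ : _ = \pi_(tensor A B) (s ++ tensor_opp_seq t));
  last by rewrite -tensor_add_pi -tensor_opp_pi.
rewrite !tensor_map_pi.
rewrite [RHS](_ : _ = \pi_(tensor A' B)
    (tensor_map_seq s ++ tensor_opp_seq (tensor_map_seq t))); last first.
  by rewrite -tensor_add_pi -tensor_opp_pi.
congr (\pi_(_) _); rewrite /tensor_map_seq /tensor_opp_seq map_cat -!map_comp.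
by congr (_ ++ _); apply: eq_map => ab /=; rewrite raddfN.
Qed.

HB.instance Definition _ :=
  GRing.isZmodMorphism.Build (tensor A B) (tensor A' B) tensor_map tensor_mapB.

End tensor_map.

Arguments tensor_map {A A'} B f x.

Definition finitely_generated (G : groupType) :=
  exists s : seq G, forall H : set G,
    H 1%g -> (forall x y, H x -> H y -> H (x * y)%g) ->
    (forall x, H x -> H (x^-1)%g) -> (forall x, x \in s -> H x) -> H = setT.

Section targets.
Context (R : realType).

Definition finite_type_target (Y : ptopologicalType) :=
  path_connected R Y /\ forall n, finitely_generated (homotopy_group R n.+1 Y).

Definition simply_connected (Y : ptopologicalType) :=
  path_connected R Y /\ forall a : homotopy_group R 1 Y, a = 1%g.

(* Meant for simply-connected spaces: there pi_1 (x) Q = 0, and only the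
   groups pi_n with n >= 2 matter. *)
Definition rational_equivalence (Y Z : ptopologicalType) (f : pointed_map Y Z) :=
  forall n, bijective (tensor_map rat (homotopy_group_map R n.+2 f)).

End targets.

Section cw.
Context (R : realType).

Definition disc n : set 'rV[R]_n := [set x | \sum_j x ord0 j ^+ 2 <= 1].
Definition open_disc n : set 'rV[R]_n := [set x | \sum_j x ord0 j ^+ 2 < 1].
Definition sphere n : set 'rV[R]_n := [set x | \sum_j x ord0 j ^+ 2 = 1].

Arguments disc : clear implicits.
Arguments open_disc : clear implicits.
Arguments sphere : clear implicits.

(* CW structures in the sense of Whitehead, presented by characteristic maps,
   with the basepoint among the vertices. By compactness of discs, a
   characteristic map which is injective on the open disc restricts to a
   homeomorphism from the open disc onto its image. *)
Record cw_complex (X : ptopologicalType) := CWComplex {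
  cw_cell : nat -> Type;
  cw_char : forall n, cw_cell n -> 'rV[R]_n -> X;
  cw_open_cell (e : {n & cw_cell n}) : set X :=
    cw_char (projT2 e) @` open_disc (projT1 e);
  cw_hausdorff : hausdorff_space X;
  cw_continuous : forall n (i : cw_cell n),
    {within disc n, continuous (cw_char i)};
  cw_injective : forall n (i : cw_cell n), set_inj (open_disc n) (cw_char i);
  cw_partition : forall x, exists! e, cw_open_cell e x;
  cw_closure_finite : forall n (i : cw_cell n),
    exists F : set {m & cw_cell m},
      [/\ finite_set F, forall e, F e -> (projT1 e < n)%N &
          cw_char i @` sphere n `<=` \bigcup_(e in F) cw_open_cell e];
  cw_weak : forall A : set X,
    (forall n (i : cw_cell n), closed (A `&` cw_char i @` disc n)) -> closed A;
  cw_basepoint : exists i : cw_cell 0, cw_char i 0 = point }.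

Context (X : ptopologicalType) (K : cw_complex X).

Definition skeleton (n : nat) : set X :=
  \bigcup_(e in [set e | (projT1 e <= n)%N]) cw_open_cell (c := K) e.

Definition finite_type_source :=
  connected [set: X] /\ forall n, finite_set [set: cw_cell K n].

Context (B Y : ptopologicalType).

Definition relative_phantom (phi : pointed_map B Y) (h : pointed_map X Y) :=
  forall n, exists hn : X -> B,
    [/\ {within skeleton n, continuous hn}, hn point = point &
        homotopic_rel R (skeleton n) [set point] (phi \o hn) h].

Definition Ph (phi : pointed_map B Y) : set (hclass R X Y) :=
  [set \pi_(hclass R X Y) h | h in relative_phantom phi].

End cw.

(* Main.v *)
(* Let E be the space of pairs (y, gamma) with gamma a path in Y' from f y, and
   p : E -> Y' the fibration taking the end of gamma, with fiber F. A lift of h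
   through p is a map g to Y together with a homotopy from f g to h.

   As f is a rational equivalence between spaces with finitely generated
   homotopy groups, pi_n(f) has finite kernel and cokernel, so pi_n(F) is finite
   by exactness. By induction on cells, h has finitely many lifts on each
   skeleton up to vertical homotopy. Those lifts whose component in Y factors
   through phi up to homotopy form nonempty finite sets, compatible with
   restriction; an element of their inverse limit can be made strictly
   compatible by the homotopy extension property, and glues to the desired g.

   Finiteness of a set of classes is expressed throughout by saying that every
   sequence has two equivalent terms. *)

Require Import Defs.
From HB Require Import structures.
From mathcomp Require Import all_boot all_order all_algebra.
From mathcomp Require Import all_classical all_reals all_analysis.
From mathcomp Require Import lra.

Set Implicit Arguments.
Unset Strict Implicit.
Unset Printing Implicit Defensive.

Import Order.TTheory GRing.Theory Num.Theory.
Import numFieldNormedType.Exports.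

Local Open Scope classical_set_scope.
Local Open Scope ring_scope.
Local Open Scope quotient_scope.

(** * Continuity on subsets *)

Section topology.

(** Maps [g] chosen skeleton by skeleton need not fit together, and even a glued [g] could satisfy
    [f g ~ h] on each skeleton without satisfying it on [X]. This is why a lift keeps its homotopy:
    what is counted are maps into [path_space], and the path coordinate of the glued lift is the
    global homotopy.

    On a single cell the boundary values are arbitrary, so its lifts are not literally elements of a
    homotopy group of [F]. Contracting the cell along one given lift makes the problem constant, and
    a path in [E] then moves it over the basepoint. All of this is one box-lifting principle,
    [jar_lift], used once on a body to carry lifts along and once on the prism over it to carry
    homotopies between them.

    Cells are round and homotopy groups live on cubes. The two are compared up to homotopy by
    magnifying and clamping coordinates, without a homeomorphism. In low degrees [F] has only a set
    of components and a possibly non-commutative fundamental group, so finiteness there is obtained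
    by comparing terms of sequences instead of by extensions of abelian groups. *)

Lemma within_valP (T U : topologicalType) (S : set T) (A : set U)
    (f : T -> A) :
  {within S, continuous (fun z => val (f z))} -> {within S, continuous f}.
Proof.
move=> /within_continuousP cf; apply/within_continuousP => x Sx V.
move=> [W [[G oG GW] Wx WV]].
have : nbhs (val (f x)) G by apply: open_nbhs_nbhs; split => //; rewrite -GW in Wx.
move=> /(cf x Sx); apply: filterS => y h Sy; apply: WV; rewrite -GW.
exact: h.
Qed.

Lemma within_lift_set (T U : topologicalType) (S : set T) (A : set U)
    (a0 : A) (g : T -> U) :
  {within S, continuous g} -> (forall z, S z -> A (g z)) ->
  exists f : T -> A,
    {within S, continuous f} /\ forall z, S z -> val (f z) = g z.
Proof.
move=> cg gA; pose f z : A := insubd a0 (g z).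
have fE z : S z -> val (f z) = g z.
  by move=> Sz; rewrite val_insubd ifT // mem_set //; exact: gA.
exists f; split=> //; apply: within_valP.
by apply: (within_eq _ cg) => z Sz; rewrite fE.
Qed.

(** Currying is continuous by the tube lemma: a compact [K] sent into an open set by one slice is
    still sent there by all nearby slices over [S]. *)
Lemma within_uncurried_compact_open (V Z W : topologicalType) (S : set Z)
    (H : V -> Z -> W) :
  {within [set x | S x.2], continuous (fun x : V * Z => H x.1 x.2)} ->
  {within S, continuous ((fun z t => H t z) : Z -> {compact-open, V -> W})}.
Proof.
move=> /within_continuousP cH; apply/within_continuousP => z Sz N.
(* [compact_open_cvgP] speaks of a filter, so continuity at [z] within [S] is packaged as one. *)
pose F : set_system {compact-open, V -> W} :=
  [set N | \forall y \near z, S y -> N (H^~ y)].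
have FF : Filter F.
  split.
  - by rewrite /F /=; exact: nearW.
  - move=> P Q; rewrite /F /= => hP hQ; near=> y => Sy.
    by split; [exact: (near hP y)|exact: (near hQ y)].
  - by move=> P Q PQ; rewrite /F /=; apply: filterS => y + Sy => /(_ Sy) /PQ.
suff : F --> (H^~ z : {compact-open, V -> W}) by apply.
apply/compact_open_cvgP.
move=> K O cK oO fKO /=.
move/compact_near_coveringP/near_covering_withinP : cK.
move=> /(_ _ (nbhs z) (fun y v => S y -> O (H v y)) _) h.
have : \forall y \near z, K `<=` (fun v => S y -> O (H v y)).
  apply: h => v Kv.
  have Ov : nbhs (H v z) O.
    by apply: open_nbhs_nbhs; split=> //; apply: fKO; exists v.
  have [[P Q] [Pv Qz] PQO] := cH (v, z) Sz _ Ov.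
  by exists (P, Q) => // -[a b] /= [Pa Qb] _ Sb; exact: (PQO (a, b)).
by apply: filterS => y Ky Sy _ [x Kx <-]; exact: Ky.
Unshelve. all: by end_near. Qed.

Lemma continuous_fun_comp (T U V : topologicalType) (f : T -> U) (g : U -> V) :
  continuous f -> continuous g -> continuous (fun x => g (f x)).
Proof. by move=> cf cg x; apply: continuous_comp; [exact: cf|exact: cg]. Qed.

Lemma continuous_pair (T U V : topologicalType) (f : T -> U) (g : T -> V) :
  continuous f -> continuous g -> continuous (fun x => (f x, g x)).
Proof. by move=> cf cg x; apply: cvg_pair; [exact: cf|exact: cg]. Qed.

Lemma continuous_fst (U V : topologicalType) :
  continuous (fst : U * V -> U).
Proof. by move=> x; exact: cvg_fst. Qed.

Lemma continuous_snd (U V : topologicalType) :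
  continuous (snd : U * V -> V).
Proof. by move=> x; exact: cvg_snd. Qed.

Lemma closed_continuous_preimage (T U : topologicalType) (f : T -> U)
    (D : set U) : continuous f -> closed D -> closed [set x | D (f x)].
Proof. by move=> cf cD; apply: (@closed_comp _ _ f D) => // x _; exact: cf. Qed.

Lemma continuous_idfun (U : topologicalType) : continuous (fun x : U => x).
Proof. by move=> x; exact: cvg_id. Qed.

Lemma within_continuousT (T U : topologicalType) (f : T -> U) :
  {within setT, continuous f} -> continuous f.
Proof. by move=> cf; apply/continuous_subspace_setT. Qed.

Lemma within_sub (T U : topologicalType) (A B : set T) (f : T -> U) :
  A `<=` B -> {within B, continuous f} -> {within A, continuous f}.
Proof. by move=> AB; exact: continuous_subspaceW. Qed.

Lemma within_glue (T U : topologicalType) (A P Q : set T) (f g : T -> U) :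
  closed P -> closed Q -> A `<=` P `|` Q ->
  {within A `&` P, continuous f} -> {within A `&` Q, continuous g} ->
  (forall x, A x -> P x -> Q x -> f x = g x) ->
  {within A, continuous (fun x => if `[< P x >] then f x else g x)}.
Proof.
move=> cP cQ APQ /within_continuousP cf /within_continuousP cg fg.
apply/within_continuousP => x Ax V.
have nf : P x -> nbhs (f x) V -> \forall y \near x, A y /\ P y -> V (f y).
  by move=> Px; exact: cf.
have ng : Q x -> nbhs (g x) V -> \forall y \near x, A y /\ Q y -> V (g y).
  by move=> Qx; exact: cg.
have nP : ~ P x -> \forall y \near x, ~ P y.
  by move=> Px; apply: open_nbhs_nbhs; split => //; exact: closed_openC.
have nQ : ~ Q x -> \forall y \near x, ~ Q y.
  by move=> Qx; apply: open_nbhs_nbhs; split => //; exact: closed_openC.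
case: asboolP => Px Vx.
  have [Qx|Qx] := pselect (Q x); last first.
    near=> y => Ay; case: asboolP => Py; first exact: (near (nf Px Vx) y).
    by have [//|Qy] := APQ _ Ay; case: (near (nQ Qx) y).
  have Vgx : nbhs (g x) V by rewrite -fg.
  near=> y => Ay; case: asboolP => Py; first exact: (near (nf Px Vx) y).
  by have [//|Qy] := APQ _ Ay; exact: (near (ng Qx Vgx) y).
have [//|Qx] := APQ _ Ax.
near=> y => Ay; case: asboolP => Py; first by case: (near (nP Px) y).
by have [//|Qy] := APQ _ Ay; exact: (near (ng Qx Vx) y).
Unshelve. all: by end_near. Qed.

End topology.

(** * The path space of a map *)

Section path_space.
Context (R : realType) (Y W : ptopologicalType) (f : pointed_map Y W).

Definition clamp (t : R) : R := Num.max 0 (Num.min t 1).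

Lemma clamp_in t : 0 <= clamp t <= 1.
Proof. by rewrite /clamp maxEle minEle; case: ifP; case: ifP; lra. Qed.

Lemma clamp_id t : 0 <= t <= 1 -> clamp t = t.
Proof. by rewrite /clamp maxEle minEle; case: ifP; case: ifP; lra. Qed.

Lemma clamp_continuous : continuous clamp.
Proof.
by apply: max_cont; [|apply: min_cont]; (exact: cst_continuous || exact: id_cont).
Qed.

(** The compact-open function type contains all functions, so continuity is imposed here. Paths are
    defined on the whole line and constant outside the unit interval, which makes equality of points
    depend on that interval only. *)
Definition path_space_set : set (Y * {compact-open, R -> W}) :=
  [set e | [/\ continuous (e.2 : R -> W), e.2 0 = f e.1 &
               forall t, e.2 t = e.2 (clamp t)]].

Definition path_space := set_type path_space_set.
HB.instance Definition _ := Topological.on path_space.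

Implicit Types e : path_space.

Definition ps_start e : Y := (val e).1.
Definition ps_path e : R -> W := (val e).2.
Definition ps_end e : W := ps_path e 1.

Lemma ps_path_continuous e : continuous (ps_path e).
Proof. by have /set_mem[] := valP e. Qed.

Lemma ps_path0 e : ps_path e 0 = f (ps_start e).
Proof. by have /set_mem[] := valP e. Qed.

Lemma ps_eq e e' : ps_start e = ps_start e' ->
  (forall t, 0 <= t <= 1 -> ps_path e t = ps_path e' t) -> e = e'.
Proof.
move=> e1 e2; apply: val_inj; rewrite (surjective_pairing (val e)).
rewrite (surjective_pairing (val e')); congr (_, _) => //.
apply/funext => t.
have /set_mem[_ _ ->] := valP e; have /set_mem[_ _ ->] := valP e'.
exact/e2/clamp_in.
Qed.

Lemma ps_start_continuous : continuous ps_start.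
Proof.
exact: (continuous_fun_comp (@initial_continuous path_space _ val)
  (@continuous_fst _ _)).
Qed.

(** Joint continuity of evaluation comes from local compactness of the line. *)
Lemma ps_eval_continuous : continuous (fun z : R * path_space => ps_path z.2 z.1).
Proof.
have c : continuous (uncurry ps_path).
  apply: continuous_uncurry.
  - exact: locally_compactR.
  - exact: Rhausdorff.
  - exact: (continuous_fun_comp (@initial_continuous path_space _ val)
      (@continuous_snd _ _)).
  - exact: ps_path_continuous.
apply: (continuous_fun_comp (f := fun z => (z.2, z.1)) _ c).
by apply: continuous_pair; [exact: continuous_snd|exact: continuous_fst].
Qed.

Lemma ps_end_continuous : continuous ps_end.
Proof.
apply: (continuous_fun_comp (f := fun e => (1 : R, e)) _ ps_eval_continuous).
by apply: continuous_pair; [exact: cst_continuous|exact: continuous_idfun].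
Qed.

Lemma ps_point_subproof : path_space_set (point, fun=> point).
Proof. by split => //=; [exact: cst_continuous|rewrite pmap_point]. Qed.

Definition ps_point : path_space := SigSub (mem_set ps_point_subproof).

(** The universal property of [E]: every map into it in the sequel is built from a map to [Y] and a
    homotopy starting at its image under [f]. Clamping extends the homotopy to all times. *)
Lemma ps_lift (T : topologicalType) (S : set T) (g : T -> Y) (H : R * T -> W) :
  {within S, continuous g} -> {within `[0, 1] `*` S, continuous H} ->
  (forall x, S x -> H (0, x) = f (g x)) ->
  exists e : T -> path_space,
    [/\ {within S, continuous e},
        forall x, S x -> ps_start (e x) = g x &
        forall x t, S x -> 0 <= t <= 1 -> ps_path (e x) t = H (t, x)].
Proof.
move=> cg cH H0.
have cH' : {within [set z : R * T | S z.2],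
    continuous (fun z : R * T => H (clamp z.1, z.2))}.
  apply: (within_comp (f := fun z => (clamp z.1, z.2)) _ cH) => [|z /= Sz].
    apply/continuous_subspaceT/continuous_pair; last exact: continuous_snd.
    exact: (continuous_fun_comp (@continuous_fst _ _) clamp_continuous).
  by split=> //=; rewrite in_itv /=; exact: clamp_in.
pose k x : Y * {compact-open, R -> W} := (g x, fun t => H (clamp t, x)).
have ck : {within S, continuous k}.
  exact: (within_pair cg (@within_uncurried_compact_open _ _ _ S
    (fun t x => H (clamp t, x)) cH')).
have kP x : S x -> path_space_set (k x).
  move=> Sx; split => /=.
  - apply: within_continuousT.
    apply: (within_comp (f := fun t : R => (t, x)) _ cH') => //.
    apply/continuous_subspaceT/continuous_pair; last exact: cst_continuous.
    exact: continuous_idfun.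
  - by rewrite clamp_id ?H0 // lexx ler01.
  - by move=> t; rewrite (clamp_id (clamp_in t)).
have [e [ce eE]] := within_lift_set ps_point ck kP.
exists e; split=> // [x Sx|x t Sx It]; first by rewrite /ps_start eE.
by rewrite /ps_path eE //= clamp_id.
Qed.

End path_space.

(** * Lifting against boxes *)

Section gauge.
Context (R : realType).

(* [rad a] is the dilation of ratio [a] about a center and the body is
   [rho <= 1]. No linear structure is required, so that a prism [R * T] over a
   body is again a body without any instance on the product. *)
Record gauge (T : topologicalType) := Gauge {
  rad : R -> T -> T;
  rho : T -> R;
  rad_continuous : continuous (fun z : R * T => rad z.1 z.2);
  rho_continuous : continuous rho;
  rho_ge0 : forall x, 0 <= rho x;
  rho_rad : forall a x, 0 <= a -> rho (rad a x) = a * rho x;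
  rad1 : forall x, rad 1 x = x;
  rad0 : forall x y, rad 0 x = rad 0 y }.

Arguments rad_continuous {T} g.
Arguments rho_continuous {T} g.
Arguments rho_ge0 {T} g x.
Arguments rho_rad {T} g a x.
Arguments rad1 {T} g x.
Arguments rad0 {T} g x y.

Definition body T (G : gauge T) : set T := [set x | rho G x <= 1].
Definition bdry T (G : gauge T) : set T := [set x | rho G x = 1].

Lemma bdry_body T (G : gauge T) : bdry G `<=` body G.
Proof. by move=> x; rewrite /bdry /body /= => ->. Qed.

Lemma closed_body T (G : gauge T) : closed (body G).
Proof.
apply: (@closed_continuous_preimage _ _ _ [set x : R | x <= 1]).
  exact: rho_continuous.
exact: closed_le.
Qed.

Lemma closed_bdry T (G : gauge T) : closed (bdry G).
Proof.
apply: (@closed_continuous_preimage _ _ _ [set x : R | x = 1]).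
  exact: rho_continuous.
exact: closed_eq.
Qed.

Section prism.
Context (T : topologicalType) (G : gauge T).

(** Dilation about height 1/2 over the center. In the gauge below the factor 2 normalizes the
    half-length of the interval, and the maximum makes the body a product. *)
Let prad (a : R) (z : R * T) : R * T := (2^-1 + a * (z.1 - 2^-1), rad G a z.2).
Let prho (z : R * T) : R := Num.max (2 * `|z.1 - 2^-1|) (rho G z.2).

Lemma continuous_maxr (U : topologicalType) (f g : U -> R) :
  continuous f -> continuous g -> continuous (fun x => Num.max (f x) (g x)).
Proof.
by move=> cf cg x; exact: (@continuous_max R U f g x (cf x) (cg x)).
Qed.

Program Definition prism : gauge (R * T)%type :=
  @Gauge (R * T)%type prad prho _ _ _ _ _ _.
Next Obligation.
apply: continuous_pair.
  move=> z; apply: cvgD; first exact: cvg_cst.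
  apply: cvgM; first exact: cvg_fst.
  apply: cvgB; last exact: cvg_cst.
  exact: (continuous_fun_comp (@continuous_snd _ _) (@continuous_fst _ _)).
have c : continuous (fun z : R * (R * T) => (z.1, z.2.2)).
  apply: continuous_pair; first exact: continuous_fst.
  exact: (continuous_fun_comp (@continuous_snd _ _) (@continuous_snd _ _)).
exact: (continuous_fun_comp c (rad_continuous G)).
Qed.
Next Obligation.
apply: continuous_maxr.
  move=> z; apply: cvgM; first exact: cvg_cst.
  apply: cvg_norm; apply: cvgB; last exact: cvg_cst.
  exact: cvg_fst.
exact: (continuous_fun_comp (@continuous_snd _ _) (rho_continuous G)).
Qed.
Next Obligation. by move=> z; rewrite /prho le_max rho_ge0 orbT. Qed.
Next Obligation.
move=> a z a0; rewrite /prho /prad /= rho_rad //.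
rewrite addrAC subrr add0r normrM ger0_norm // mulrCA.
by rewrite maxr_pMr.
Qed.
Next Obligation.
by move=> [t x]; rewrite /prad /= rad1 mul1r addrCA subrr addr0.
Qed.
Next Obligation.
by move=> z w; rewrite /prad !mul0r (rad0 G z.2 w.2).
Qed.

Lemma body_prism z : body prism z <-> (0 <= z.1 <= 1) /\ body G z.2.
Proof.
rewrite /body /= /prho ge_max; split => [/andP[h ->]|[h ->]].
  by split => //; move: h; case: (ger0P (z.1 - 2^-1)); lra.
by rewrite andbT; case: (ger0P (z.1 - 2^-1)); lra.
Qed.

Lemma bdry_prism z : body prism z ->
  bdry prism z <-> [\/ z.1 = 0, z.1 = 1 | bdry G z.2].
Proof.
move=> /body_prism[]; rewrite /body /bdry /= /prho => zI zG; split.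
  rewrite maxEle; case: ifP => _ h; first by constructor 3.
  by move: h; case: (ger0P (z.1 - 2^-1)) => ? ?;
    [constructor 2|constructor 1]; lra.
have n0 : `|0 - 2^-1 : R| = 2^-1 by rewrite sub0r normrN ger0_norm.
have n1 : `|1 - 2^-1 : R| = 2^-1 by rewrite ger0_norm; lra.
case=> [->|->|h].
- by rewrite n0 divff // max_l.
- by rewrite n1 divff // max_l.
- rewrite h max_r //; case: (ger0P (z.1 - 2^-1)); lra.
Qed.

End prism.

(** * Retraction of a cylinder onto its base and wall, and lifting along it *)

Section jar.
Context (T : topologicalType) (G : gauge T).

Local Notation I := (`[0, 1] : set R).
Implicit Types z : R * T.

Definition jar : set (R * T) :=
  [set z | [/\ 0 <= z.1 <= 1, body G z.2 & z.1 = 0 \/ bdry G z.2]].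

(** The ray from height 2 over the center meets the base when [a * (2 - z.1) = 2] and the wall when
    [a * rho G z.2 = 1]. The first of these to occur has parameter the inverse of the maximum of
    [(2 - z.1) / 2] and [rho G z.2]. The extra 1/2 changes nothing on the cylinder and keeps the
    inverse continuous everywhere. *)
Definition jar_mu z := Num.max 2^-1 (Num.max ((2 - z.1) / 2) (rho G z.2)).
Definition jar_la z := (jar_mu z)^-1.

(* The point at parameter [a] of the ray from [(2, center)] through [z]: it is
   [z] for [a = 1] and lies in the jar for [a = jar_la z]. *)
Definition jar_ray (a : R) z : R * T := (2 + a * (z.1 - 2), rad G a z.2).
Definition jar_retract z := jar_ray (jar_la z) z.

Lemma jar_mu_gt0 z : 0 < jar_mu z.
Proof. by rewrite /jar_mu lt_max invr_gt0 ltr0n. Qed.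

Lemma jar_la_continuous : continuous jar_la.
Proof.
move=> z; apply: cvgV; first by rewrite gt_eqF // jar_mu_gt0.
move: z; apply: continuous_maxr; first exact: cst_continuous.
apply: continuous_maxr.
  move=> z; apply: cvgM; last exact: cvg_cst.
  by apply: cvgB; [exact: cvg_cst|exact: cvg_fst].
exact: (continuous_fun_comp (@continuous_snd _ _) (rho_continuous G)).
Qed.

Lemma jar_ray_continuous : continuous (fun z : R * (R * T) => jar_ray z.1 z.2).
Proof.
apply: continuous_pair.
  move=> z; apply: cvgD; first exact: cvg_cst.
  apply: cvgM; first exact: cvg_fst.
  apply: cvgB; last exact: cvg_cst.
  exact: (continuous_fun_comp (@continuous_snd _ _) (@continuous_fst _ _)).
have c : continuous (fun z : R * (R * T) => (z.1, z.2.2)).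
  apply: continuous_pair; first exact: continuous_fst.
  exact: (continuous_fun_comp (@continuous_snd _ _) (@continuous_snd _ _)).
exact: (continuous_fun_comp c (rad_continuous G)).
Qed.

Lemma jar_retract_continuous : continuous jar_retract.
Proof.
apply: (continuous_fun_comp (f := fun z => (jar_la z, z)) _ jar_ray_continuous).
apply: continuous_pair; first exact: jar_la_continuous.
exact: continuous_idfun.
Qed.

Lemma jar_laP z : 0 <= z.1 <= 1 -> body G z.2 ->
  [/\ 1 <= jar_la z, jar_la z * (2 - z.1) <= 2, jar_la z * rho G z.2 <= 1 &
      jar_la z * (2 - z.1) = 2 \/ jar_la z * rho G z.2 = 1].
Proof.
move=> /andP[z0 z1]; rewrite /body /= => zG.
have m0 := jar_mu_gt0 z.
have m1 : jar_mu z <= 1 by rewrite /jar_mu !ge_max zG; lra.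
have m2 : (2 - z.1) / 2 <= jar_mu z by rewrite /jar_mu !le_max lexx orbT.
have m3 : rho G z.2 <= jar_mu z by rewrite /jar_mu !le_max lexx !orbT.
have m4 : jar_mu z = (2 - z.1) / 2 \/ jar_mu z = rho G z.2.
  rewrite /jar_mu (max_r (x := 2^-1)); last by rewrite le_max; apply/orP; left; lra.
  by rewrite maxEle; case: ifP; [right|left].
rewrite /jar_la; split.
- by rewrite invf_ge1.
- by rewrite ler_pdivrMl //; lra.
- by rewrite ler_pdivrMl //; lra.
- have m5 : jar_mu z != 0 by rewrite gt_eqF.
  case: m4 => E; [left|right]; apply: (mulfI m5).
    by rewrite mulrA mulfV // mul1r; lra.
  by rewrite mulrA mulfV // mul1r; lra.
Qed.

(** Between a point and its retraction the ray does not leave the cylinder, so a map defined on the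
    cylinder alone can be run along it. *)
Lemma jar_rayP z a : 0 <= z.1 <= 1 -> body G z.2 -> 1 <= a <= jar_la z ->
  0 <= (jar_ray a z).1 <= 1 /\ body G (jar_ray a z).2.
Proof.
move=> zI zG /andP[a1 al]; have [l1 l2 l3 _] := jar_laP zI zG.
have r0 := rho_ge0 G z.2.
move: zI => /andP[z0 z1]; split => /=; first by apply/andP; split; nra.
by rewrite /body /= rho_rad; nra.
Qed.

Lemma jar_retractP z : 0 <= z.1 <= 1 -> body G z.2 -> jar (jar_retract z).
Proof.
move=> zI zG; have [l1 l2 l3 l4] := jar_laP zI zG.
have [] := @jar_rayP z (jar_la z) zI zG; first by rewrite l1 lexx.
move=> h1 h2; split => //=; case: l4 => l4; [left|right]; first lra.
by rewrite /bdry /= rho_rad //; lra.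
Qed.

Lemma jar_la_id z : jar z -> jar_la z = 1.
Proof.
move=> [zI zG zJ]; have [l1 l2 l3 _] := jar_laP zI zG.
by case: zJ => [z0|]; rewrite /bdry /=; first rewrite z0 in l2; nra.
Qed.

Lemma jar_ray1 z : jar_ray 1 z = z.
Proof. by case: z => s x; rewrite /jar_ray /= rad1; congr (_, _); lra. Qed.

Lemma jar_retract_id z : jar z -> jar_retract z = z.
Proof. by move=> zJ; rewrite /jar_retract jar_la_id // jar_ray1. Qed.

Lemma jar_glue (U : topologicalType) (a : T -> U) (b : R * T -> U) :
  {within body G, continuous a} -> {within `[0, 1] `*` bdry G, continuous b} ->
  (forall x, bdry G x -> b (0, x) = a x) ->
  exists e : R * T -> U,
    [/\ {within jar, continuous e}, forall x, body G x -> e (0, x) = a x &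
        forall t x, 0 <= t <= 1 -> bdry G x -> e (t, x) = b (t, x)].
Proof.
move=> ca cb ab; pose P := [set z : R * T | z.1 = 0].
exists (fun z => if `[< P z >] then a z.2 else b z); split.
- apply: (@within_glue _ _ _ P [set z | bdry G z.2]).
  + apply: (@closed_continuous_preimage _ _ _ [set x : R | x = 0]).
      exact: continuous_fst.
    exact: closed_eq.
  + apply: (@closed_continuous_preimage _ _ _ (bdry G)).
      exact: continuous_snd.
    exact: closed_bdry.
  + by move=> z [_ _].
  + apply: (within_comp (f := snd) _ ca) => [|z [[]]] //.
    exact/continuous_subspaceT/continuous_snd.
  + by apply: within_sub cb => z [[zI _ _] zG]; split => //=; rewrite in_itv.
  + by move=> [s x] _; rewrite /P /= => -> zG; rewrite ab.
- by move=> x xG; rewrite asboolT.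
- by move=> t x tI xG; case: asboolP; rewrite /P //= => ->; rewrite ab.
Qed.

Lemma jar_fill (U : topologicalType) (a : T -> U) (b : R * T -> U) :
  {within body G, continuous a} -> {within `[0, 1] `*` bdry G, continuous b} ->
  (forall x, bdry G x -> b (0, x) = a x) ->
  exists e : R * T -> U,
    [/\ {within `[0, 1] `*` body G, continuous e},
        forall x, body G x -> e (0, x) = a x &
        forall t x, 0 <= t <= 1 -> bdry G x -> e (t, x) = b (t, x)].
Proof.
move=> ca cb ab; have [e [ce ea eb]] := jar_glue ca cb ab.
exists (fun z => e (jar_retract z)); split.
- apply: (within_comp _ ce) => [|[t x] [/= tI xG]].
    exact/continuous_subspaceT/jar_retract_continuous.
  exact: jar_retractP.
- move=> x xG; rewrite jar_retract_id ?ea //.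
  by split => //=; [rewrite lexx ler01|left].
- move=> t x tI xG; rewrite jar_retract_id ?eb //.
  by split => //=; [exact: bdry_body|right].
Qed.

Context (Y W : ptopologicalType) (f : pointed_map Y W).

(* A path of [E] ending at [K (jar_retract z)] is prolonged by [K] along the ray
   back to [z], the whole being reparametrized at speed [jar_la z]; as this
   speed is 1 on the jar, nothing changes there. *)
Lemma jar_lift (K : R * T -> W) (a : T -> path_space R f)
    (b : R * T -> path_space R f) :
  {within `[0, 1] `*` body G, continuous K} ->
  {within body G, continuous a} -> {within `[0, 1] `*` bdry G, continuous b} ->
  (forall x, bdry G x -> b (0, x) = a x) ->
  (forall x, body G x -> ps_end (a x) = K (0, x)) ->
  (forall t x, 0 <= t <= 1 -> bdry G x -> ps_end (b (t, x)) = K (t, x)) ->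
  exists e : R * T -> path_space R f,
    [/\ {within `[0, 1] `*` body G, continuous e},
        forall x, body G x -> e (0, x) = a x,
        forall t x, 0 <= t <= 1 -> bdry G x -> e (t, x) = b (t, x) &
        forall t x, 0 <= t <= 1 -> body G x -> ps_end (e (t, x)) = K (t, x)].
Proof.
move=> cK ca cb ab aK bK; have [e [ce ea eb]] := jar_glue ca cb ab.
have eK z : jar z -> ps_end (e z) = K z.
  case: z => t x [/= tI xG []].
    by move=> ->; rewrite ea // aK.
  by move=> xb; rewrite eb // bK.
pose H (z : R * (R * T)) := if z.1 * jar_la z.2 <= 1
  then ps_path (e (jar_retract z.2)) (z.1 * jar_la z.2)
  else K (jar_ray (jar_la z.2 - (z.1 * jar_la z.2 - 1)) z.2).
have cm : continuous (fun z : R * (R * T) => z.1 * jar_la z.2).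
  move=> z; apply: cvgM; first exact: cvg_fst.
  exact: (continuous_fun_comp (@continuous_snd _ _) jar_la_continuous).
have cH : {within `[0, 1] `*` (`[0, 1] `*` body G), continuous H}.
  apply: within_paste => //.
  - have c1 : {within `[0, 1] `*` (`[0, 1] `*` body G) `&`
          [set z | z.1 * jar_la z.2 <= 1],
        continuous (fun z : R * (R * T) => e (jar_retract z.2))}.
      apply: (within_comp (f := fun z : R * (R * T) => jar_retract z.2) _ ce).
        apply/continuous_subspaceT.
        exact: (continuous_fun_comp (@continuous_snd _ _) jar_retract_continuous).
      move=> [s [t x]] [[_ [/= tI xG]] _]; exact: jar_retractP.
    exact: (within_comp (within_pair (continuous_subspaceT cm) c1)
      (continuous_subspaceT (A := setT) (@ps_eval_continuous _ _ _ f))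
      (fun _ _ => Logic.I)).
  - have c2 : continuous (fun z : R * (R * T) =>
        jar_ray (jar_la z.2 - (z.1 * jar_la z.2 - 1)) z.2).
      have c3 : continuous (fun z : R * (R * T) =>
          (jar_la z.2 - (z.1 * jar_la z.2 - 1), z.2)).
        apply: continuous_pair; last exact: continuous_snd.
        move=> z; apply: cvgB; last by apply: cvgB; [exact: cm|exact: cvg_cst].
        exact: (continuous_fun_comp (@continuous_snd _ _) jar_la_continuous).
      exact: (continuous_fun_comp c3 jar_ray_continuous).
    apply: (within_comp (continuous_subspaceT c2) cK).
    move=> [s [t x]] [[/= sI [/= tI xG]] h].
    rewrite !in_itv /= in sI tI; have [l1 _ _ _] := @jar_laP (t, x) tI xG.
    have [] := @jar_rayP (t, x)
      (jar_la (t, x) - (s * jar_la (t, x) - 1)) tI xG; first by nra.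
    by move=> h1 h2; split => //=; rewrite in_itv.
  - move=> [s [t x]] [/= sI [/= tI xG]] ->.
    rewrite subrr subr0 [LHS]eK //; exact: jar_retractP.
have cr : {within `[0, 1] `*` body G, continuous (fun z => e (jar_retract z))}.
  apply: (within_comp _ ce) => [|[t x] [/= tI xG]].
    exact/continuous_subspaceT/jar_retract_continuous.
  exact: jar_retractP.
have cs : {within `[0, 1] `*` body G,
    continuous (fun z => ps_start (e (jar_retract z)))}.
  apply: (within_comp cr (S' := setT)) => //.
  exact/continuous_subspaceT/ps_start_continuous.
have H0 z : (`[0, 1] `*` body G) z -> H (0, z) = f (ps_start (e (jar_retract z))).
  by move=> zG; rewrite /H /= mul0r ler01 ps_path0.
have [e' [ce' e's e'p]] := ps_lift cs cH H0.
have e'e z : jar z -> e' z = e z.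
  move=> zJ; have zG : (`[0, 1] `*` body G) z.
    by case: zJ => h1 h2 _; split => //=; rewrite in_itv.
  apply: ps_eq; first by rewrite e's // jar_retract_id.
  move=> t /andP[t0 t1].
  rewrite e'p ?t0 // /H jar_la_id // mulr1 t1 jar_retract_id //.
exists e'; split => //.
- move=> x xG; rewrite e'e ?ea //.
  by split => //=; [rewrite lexx ler01|left].
- move=> t x tI xG; rewrite e'e ?eb //.
  by split => //=; [exact: bdry_body|right].
- move=> t x tI xG; have zG : (`[0, 1] `*` body G) (t, x).
    by split => //=; rewrite in_itv.
  have [l1 _ _ _] := @jar_laP (t, x) tI xG.
  rewrite /ps_end e'p ?ler01 ?lexx // /H mul1r; case: ifP => h.
    have E : jar_la (t, x) = 1 by apply/le_anti; rewrite l1 h.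
    by rewrite E -/(ps_end _) eK /jar_retract ?E ?jar_ray1 //;
      rewrite -[X in jar X]jar_ray1 -E; exact: jar_retractP.
  by rewrite opprB addrCA subrr addr0 jar_ray1.
Qed.

End jar.

End gauge.

(** * Sections up to vertical homotopy *)

Lemma increasing_ge (phi : nat -> nat) :
  {homo phi : i j / (i < j)%N} -> forall n, (n <= phi n)%N.
Proof. by move=> h; elim=> // n IH; apply: leq_ltn_trans IH _; exact: h. Qed.

Lemma increasing_enum (J : nat -> Prop) :
  (forall n, exists m, (n <= m)%N /\ J m) ->
  exists phi : nat -> nat, {homo phi : i j / (i < j)%N} /\ forall i, J (phi i).
Proof.
move=> /choice[g gP].
exists (fun i => iter i (fun m => g m.+1) (g 0%N)); split.
  apply: (@homo_ltn _ _ (fun i j => (i < j)%N) ltn_trans) => i /=.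
  by have [] := gP (iter i (fun m => g m.+1) (g 0%N)).+1.
case=> [|i] /=; first by have [] := gP 0%N.
by have [] := gP (iter i (fun m => g m.+1) (g 0%N)).+1.
Qed.

(* If every sequence has two related terms then, as the relation is an
   equivalence, every sequence has a subsequence inside one class. *)
Lemma pigeonhole (T : Type) (P : T -> Prop) (r : T -> T -> Prop) :
  (forall x y, r x y -> r y x) -> (forall x y z, r x y -> r y z -> r x z) ->
  (forall s : nat -> T, (forall i, P (s i)) ->
     exists i j, (i < j)%N /\ r (s i) (s j)) ->
  forall a : nat -> T, (forall i, P (a i)) ->
  exists phi : nat -> nat, {homo phi : i j / (i < j)%N} /\
    forall i j, r (a (phi i)) (a (phi j)).
Proof.
move=> rs rt fin a Pa.
(* Otherwise each term has a bound [b i] past which nothing is related to it, and the sequence [c],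
   jumping past the bounds of all earlier indices, has no two related terms. *)
have [i0 hi0] : exists i, forall n, exists m, (n <= m)%N /\ r (a i) (a m).
  apply: contrapT => /forallNP h.
  have {}h i : exists n, forall m, (n <= m)%N -> ~ r (a i) (a m).
    have /existsNP[n hn] := h i; exists n => m nm rim; apply: hn.
    by exists m.
  move/choice: h => [b hb].
  pose c n := iter n (fun m => maxn m.+1 (\max_(i < m.+1) b i)) 0%N.
  have ch : {homo c : i j / (i < j)%N}.
    apply: (@homo_ltn _ _ (fun i j => (i < j)%N) ltn_trans) => i /=.
    by rewrite leq_max leqnn.
  have [i [j [ij]]] := fin (a \o c) (fun i => Pa _); apply: hb.
  apply: (@leq_trans (c i.+1)); last by case: (ltnP i.+1 j) => h;
    [exact/ltnW/ch|rewrite (_ : i.+1 = j) //; apply/eqP; rewrite eqn_leq ij].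
  rewrite /c iterS -/(c i) leq_max; apply/orP; right.
  exact: (@leq_bigmax _ (fun m : 'I_(c i).+1 => b m) (Ordinal (ltnSn _))).
have [phi [hphi rphi]] := increasing_enum hi0.
exists phi; split=> // i j; apply: rt (rphi j); exact: rs.
Qed.

Section sections.
Context (R : realType) (X U : topologicalType).
Implicit Types (A : set X) (Q : X -> set U) (s : X -> U).

(* A family of sets [Q] encodes all constraints (lying over a given map,
   being prescribed on a boundary, being pointed) in one go. *)
Definition sect A Q s :=
  {within A, continuous s} /\ forall x, A x -> Q x (s x).

Definition sect_homotopic A Q s s' :=
  exists H : R * X -> U,
    [/\ {within `[0, 1] `*` A, continuous H},
        forall x, A x -> H (0, x) = s x,
        forall x, A x -> H (1, x) = s' x &
        forall t x, 0 <= t <= 1 -> A x -> Q x (H (t, x))].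

Definition finitely_many_sections A Q :=
  forall s : nat -> X -> U, (forall i, sect A Q (s i)) ->
  exists i j, (i < j)%N /\ sect_homotopic A Q (s i) (s j).

Lemma sect_homotopic_eq A Q s s' :
  sect A Q s -> (forall x, A x -> s x = s' x) -> sect_homotopic A Q s s'.
Proof.
move=> [cs sQ] ss'; exists (s \o snd); split=> //= [|t x _]; last exact: sQ.
apply: (within_comp _ cs) => [|z []//].
exact/continuous_subspaceT/continuous_snd.
Qed.

Lemma sect_homotopic_sym A Q s s' :
  sect_homotopic A Q s s' -> sect_homotopic A Q s' s.
Proof.
move=> [H [cH H0 H1 HQ]].
exists (H \o (fun z => (1 - z.1, z.2))); split => [|x Ax|x Ax|t x It Ax] /=.
- apply: (within_comp _ cH) => [|[t x] [/= It Ax]].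
    apply: within_pair; apply: continuous_subspaceT; last exact: continuous_snd.
    by apply: continuous_onem; exact: continuous_fst.
  by split => //=; move: It; rewrite !in_itv /= => /andP[? ?]; lra.
- by rewrite subr0 H1.
- by rewrite subrr H0.
- by apply: HQ => //; lra.
Qed.

Lemma sect_homotopic_trans A Q s s' s'' :
  sect_homotopic A Q s s' -> sect_homotopic A Q s' s'' ->
  sect_homotopic A Q s s''.
Proof.
move=> [H [cH H0 H1 HQ]] [K [cK K0 K1 KQ]].
exists (fun z => if z.1 <= 2^-1 then H (2 * z.1, z.2)
                 else K (2 * z.1 - 1, z.2)); split => [|x Ax|x Ax|t x It Ax] /=.
- apply: within_paste.
  + exact: continuous_fst.
  + apply: (within_comp _ cH) => [|[t x] [[/= It Ax] ht]].
      apply: within_pair; apply: continuous_subspaceT; last exact: continuous_snd.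
      by apply: continuous_double; exact: continuous_fst.
    by split => //=; move: It; rewrite !in_itv /= => /andP[? ?]; lra.
  + apply: (within_comp _ cK) => [|[t x] [[/= It Ax] ht]].
      apply: within_pair; apply: continuous_subspaceT; last exact: continuous_snd.
      by apply: continuous_affine; exact: continuous_fst.
    by split => //=; move: It; rewrite !in_itv /= => /andP[? ?]; lra.
  + move=> [t x] [/= It Ax] ->.
    by rewrite divff // subrr K0 // H1.
- by rewrite ifT ?mulr0 ?H0 //; lra.
- rewrite ifF; last by apply/negbTE; rewrite -ltNge; lra.
  by rewrite mulr1 -K1 //; congr (K (_, _)); lra.
- by case: ifPn => ht; [apply: HQ|apply: KQ] => //;
    move: ht; rewrite -?ltNge => ht; lra.
Qed.

Lemma sect_sub A A' Q s : A `<=` A' -> sect A' Q s -> sect A Q s.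
Proof.
by move=> AA' [cs sQ]; split; [exact: within_sub cs|move=> x /AA'; exact: sQ].
Qed.

End sections.

Section transport.
Context (R : realType) (T : topologicalType) (G : gauge R T).
Context (Y W : ptopologicalType) (f : pointed_map Y W).
Local Notation E := (path_space R f).

Definition lift_rel (k : T -> W) (b : T -> E) (x : T) : set E :=
  [set v | ps_end v = k x /\ (bdry G x -> v = b x)].

(* Lifts are carried from one end of the homotopy to the other by [jar_lift];
   that this reflects vertical homotopy is [jar_lift] again, on the prism. *)
Lemma finitely_many_lifts_transport (K : R * T -> W) (B : R * T -> E) :
  {within `[0, 1] `*` body G, continuous K} ->
  {within `[0, 1] `*` bdry G, continuous B} ->
  (forall t x, 0 <= t <= 1 -> bdry G x -> ps_end (B (t, x)) = K (t, x)) ->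
  finitely_many_sections R (body G)
    (lift_rel (fun x => K (1, x)) (fun x => B (1, x))) ->
  finitely_many_sections R (body G)
    (lift_rel (fun x => K (0, x)) (fun x => B (0, x))).
Proof.
move=> cK cB BK fin s sP.
have I0 : 0 <= (0 : R) <= 1 by rewrite lexx ler01.
have I1 : 0 <= (1 : R) <= 1 by rewrite lexx ler01.
have /choice[e eP] i : exists e : R * T -> E,
    [/\ {within `[0, 1] `*` body G, continuous e},
        forall x, body G x -> e (0, x) = s i x,
        forall t x, 0 <= t <= 1 -> bdry G x -> e (t, x) = B (t, x) &
        forall t x, 0 <= t <= 1 -> body G x -> ps_end (e (t, x)) = K (t, x)].
  have [cs sK] := sP i; apply: jar_lift => // x xG.
    by case: (sK x) => [|_ ->] //; exact: bdry_body.
  by case: (sK x).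
have [i|i [j [ij [H [cH H0 H1 HQ]]]]] := fin (fun i x => e i (1, x)).
  have [ce e0 eB eK] := eP i; split.
    apply: (within_comp (f := fun x => (1 : R, x)) _ ce) => [|x xG].
      apply/continuous_subspaceT/continuous_pair; last exact: continuous_idfun.
      exact: cst_continuous.
    by split => //=; rewrite in_itv.
  by move=> x xG; split=> [|xb]; [exact: eK|exact: eB].
exists i, j; split=> //.
have [cei ei0 eiB eiK] := eP i; have [cej ej0 ejB ejK] := eP j.
(* In [(u, (t, x))], [u] is the new lifting direction and [t] the time of [H]. As [H] lives over the
   end 1 of [K] and is wanted over the end 0, [K] is traversed backwards. *)
pose m (z : R * (R * T)) : R * T := (1 - z.1, z.2.2).
have cm : continuous m.
  apply: continuous_pair; first by apply: continuous_onem; exact: continuous_fst.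
  exact: (continuous_fun_comp (@continuous_snd _ _) (@continuous_snd _ _)).
have mI z : 0 <= z.1 <= 1 -> 0 <= (m z).1 <= 1 by rewrite /m /=; lra.
pose P0 := [set z : R * (R * T) | z.2.1 = 0].
pose P1 := [set z : R * (R * T) | z.2.1 = 1].
pose Pb := [set z : R * (R * T) | bdry G z.2.2].
have c21 : continuous (fun z : R * (R * T) => z.2.1).
  exact: (continuous_fun_comp (@continuous_snd _ _) (@continuous_fst _ _)).
have c22 : continuous (fun z : R * (R * T) => z.2.2).
  exact: (continuous_fun_comp (@continuous_snd _ _) (@continuous_snd _ _)).
have clP0 : closed P0.
  by apply: (@closed_continuous_preimage _ _ _ [set x : R | x = 0]) => //;
    exact: closed_eq.
have clP1 : closed P1.
  by apply: (@closed_continuous_preimage _ _ _ [set x : R | x = 1]) => //;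
    exact: closed_eq.
have clPb : closed Pb.
  by apply: (@closed_continuous_preimage _ _ _ (bdry G)) => //;
    exact: closed_bdry.
(* Prescribed lift over the boundary of the prism: the carried lifts [e i] and [e j] over the two
   ends, [B] over the wall. They agree on overlaps because both lifts restrict to [B]. *)
pose b z := if `[< P0 z >] then e i (m z) else
            if `[< P1 z >] then e j (m z) else B (m z).
have bP z : 0 <= z.1 <= 1 -> Pb z -> b z = B (m z).
  move=> zI zb; rewrite /b /m; case: asboolP => _; first by rewrite eiB //; lra.
  by case: asboolP => _ //; rewrite ejB //; lra.
have bdryP z : bdry (prism G) z -> [/\ 0 <= z.1 <= 1, body G z.2 &
    [\/ z.1 = 0, z.1 = 1 | bdry G z.2]].
  move=> zb; have zG := bdry_body zb; have [h1 h2] := (body_prism G z).1 zG.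
  by split=> //; apply/bdry_prism.
have cb : {within `[0, 1] `*` bdry (prism G), continuous b}.
  apply: (@within_glue _ _ _ P0 (P1 `|` Pb)) => //.
  - exact: closedU.
  - by move=> [u z] [uI /bdryP[_ _ []]]; [left|right; left|right; right].
  - apply: (within_comp (continuous_subspaceT cm) cei) => -[u z].
    by move=> [[uI /bdryP[_ zG _]] _]; split => //; exact: mI.
  - apply: (@within_glue _ _ _ P1 Pb) => //.
    + apply: (within_comp (continuous_subspaceT cm) cej) => -[u z].
      by move=> [[[uI /bdryP[_ zG _]] _] _]; split => //; exact: mI.
    + apply: (within_comp (continuous_subspaceT cm) cB) => -[u z].
      by move=> [[[uI _] _] zb]; split => //; exact: mI.
    + move=> z [[zI _] _] _ zb; rewrite /m ejB //; exact: (mI z).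
  - move=> [u z] [uI zG]; rewrite /P0 /P1 /= => z0 []/=.
      by rewrite /P1 /= z0 => /eqP; rewrite eq_sym oner_eq0.
    move=> zb; rewrite asboolF /m /= ?eiB //; first exact: (mI (u, z)).
    by rewrite /P1 /= z0 => /eqP; rewrite eq_sym oner_eq0.
have cKm : {within `[0, 1] `*` body (prism G), continuous (K \o m)}.
  apply: (within_comp (continuous_subspaceT cm) cK) => -[u z].
  by move=> [uI /body_prism[_ zG]]; split => //; exact: (mI (u, z)).
have cH' : {within body (prism G), continuous H}.
  apply: within_sub cH => z /body_prism[zI zG].
  by split; rewrite //= in_itv.
have [||t z zI|g [cg g0 gb gK]] := @jar_lift R _ (prism G) Y W f (K \o m) H b
  cKm cH' cb.
- move=> z /bdryP[zI zG]; rewrite /b /m /= subr0 => h.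
  case: asboolP => z0; first by rewrite (surjective_pairing z) z0 H0.
  case: asboolP => z1; first by rewrite (surjective_pairing z) z1 H1.
  case: h => // zb; rewrite (surjective_pairing z).
  by have [_ ->] := HQ _ _ zI zG.
- move=> z /body_prism[zI zG]; rewrite /m /= subr0.
  by rewrite (surjective_pairing z); have [] := HQ _ _ zI zG.
- move=> /bdryP[zI' zG h]; rewrite /b /m /=.
  case: asboolP => z0; first by rewrite eiK //; lra.
  case: asboolP => z1; first by rewrite ejK //; lra.
  by case: h => // zb; rewrite BK //; lra.
exists (fun z => g (1, z)); split.
- apply: (within_comp (f := fun z => (1 : R, z)) _ cg) => [|[t x] [tI xG]].
    apply/continuous_subspaceT/continuous_pair; last exact: continuous_idfun.
    exact: cst_continuous.
  by split; [rewrite /= in_itv|apply/body_prism].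
- move=> x xG; rewrite gb //.
    by rewrite /b asboolT // /m /= subrr ei0.
  apply/bdry_prism; first by apply/body_prism.
  by constructor 1.
- move=> x xG; rewrite gb //.
    rewrite /b asboolF; last by rewrite /P0 /=; lra.
    by rewrite asboolT // /m /= subrr ej0.
  apply/bdry_prism; first by apply/body_prism.
  by constructor 2.
- move=> t x tI xG; split.
    rewrite gK //; first by rewrite /m /= subrr.
    exact/body_prism.
  move=> xb; rewrite gb ?lexx ?ler01 //.
    by rewrite bP ?lexx ?ler01 // /m /= subrr.
  apply/bdry_prism; first by apply/body_prism.
  by constructor 3.
Qed.

End transport.

(** * Discs and cubes *)

Section gauges.
Context (R : realType) (n : nat).

Definition sqnorm (x : 'rV[R]_n) : R := \sum_j x ord0 j ^+ 2.

Lemma sqnorm_continuous : continuous sqnorm.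
Proof.
apply: (@continuous_big R 'I_n +%R); first exact: (@add_continuous R).
move=> j _; have c := @coord_cont R n j => x; exact: (cvgM (c x) (c x)).
Qed.

Lemma sqnorm_ge0 x : 0 <= sqnorm x.
Proof. by apply: sumr_ge0 => j _; exact: sqr_ge0. Qed.

(** The norm of row vectors is the max norm, hence the explicit Euclidean length. *)
Program Definition disc_gauge : gauge R 'rV[R]_n :=
  @Gauge R 'rV[R]_n (fun a x => a *: x) (fun x => Num.sqrt (sqnorm x)) _ _ _ _ _ _.
Next Obligation. by move=> z; apply: cvgZ; [exact: cvg_fst|exact: cvg_snd]. Qed.
Next Obligation.
exact: (continuous_fun_comp sqnorm_continuous (@sqrt_continuous R)).
Qed.
Next Obligation. by move=> x; exact: sqrtr_ge0. Qed.
Next Obligation.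
move=> a x a0; have -> : sqnorm (a *: x) = a ^+ 2 * sqnorm x.
  by rewrite /sqnorm mulr_sumr; apply: eq_bigr => j _; rewrite mxE exprMn.
by rewrite sqrtrM ?sqr_ge0 // sqrtr_sqr ger0_norm.
Qed.
Next Obligation. by move=> x /=; rewrite scale1r. Qed.
Next Obligation. by move=> x y /=; rewrite !scale0r. Qed.

Lemma body_disc : body disc_gauge = @disc R n.
Proof.
have E x : (Num.sqrt (sqnorm x) <= 1) = (sqnorm x <= 1).
  by rewrite -{1}(@sqrtr1 R) ler_sqrt.
by apply/seteqP; split=> x; rewrite /body /disc /= E.
Qed.

Lemma bdry_disc : bdry disc_gauge = @sphere R n.
Proof.
apply/seteqP; split=> x; rewrite /bdry /sphere /= -/(sqnorm x).
  by move=> h; rewrite -[LHS](sqr_sqrtr (sqnorm_ge0 x)) h expr1n.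
by move=> ->; rewrite sqrtr1.
Qed.

Lemma rV_norm_le (x : 'rV[R]_n) e : 0 <= e ->
  (`|x| <= e) <-> forall j, `|x ord0 j| <= e.
Proof.
move=> e0.
have -> : `|x| = \big[Num.max/0]_ij `|x ij.1 ij.2| := mx_normrE x.
split.
  move=> h j; apply: le_trans h.
  exact: (le_bigmax 0 (fun ij : 'I_1 * 'I_n => `|x ij.1 ij.2|) (ord0, j)).
by move=> h; apply: bigmax_le => // -[i j] _ /=; rewrite (ord1 i).
Qed.

Lemma rV_norm_attained (x : 'rV[R]_n) : `|x| != 0 ->
  exists j, `|x| = `|x ord0 j|.
Proof.
move=> /(@mx_norm_neq0 _ _ _ x)[[i j]] /=; rewrite (ord1 i) => h.
by exists j.
Qed.

Let ctr : 'rV[R]_n := \row_j 2^-1.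

(** In the max norm the unit cube is the ball of radius 1/2 about its center [ctr]. *)
Program Definition cube_gauge : gauge R 'rV[R]_n :=
  @Gauge R 'rV[R]_n (fun a x => ctr + a *: (x - ctr)) (fun x => 2 * `|x - ctr|)
    _ _ _ _ _ _.
Next Obligation.
move=> z; apply: cvgD; first exact: cvg_cst.
apply: cvgZ; first exact: cvg_fst.
by apply: cvgB; [exact: cvg_snd|exact: cvg_cst].
Qed.
Next Obligation.
have c : continuous (fun x : 'rV[R]_n => x - ctr).
  move=> x; exact: (cvgB (@continuous_idfun 'rV[R]_n x) (@cst_continuous 'rV[R]_n _ ctr x)).
exact: (continuous_double (continuous_fun_comp c (@norm_continuous _ _))).
Qed.
Next Obligation. by move=> x /=; rewrite mulr_ge0. Qed.
Next Obligation.
by move=> a x a0 /=; rewrite addrAC subrr add0r normrZ ger0_norm // mulrCA.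
Qed.
Next Obligation. by move=> x /=; rewrite scale1r addrC subrK. Qed.
Next Obligation. by move=> x y /=; rewrite !scale0r. Qed.

Lemma body_cube : body cube_gauge = @cube R n.
Proof.
have E x : body cube_gauge x <-> forall j, `|(x - ctr) ord0 j| <= 2^-1.
  rewrite -rV_norm_le ?invr_ge0 // /body /= -ler_pdivlMl // mulr1.
  by split.
apply/seteqP; split=> x.
  move=> /E h j; move: (h j); rewrite !mxE ler_norml; lra.
by move=> h; apply/E => j; move: (h j); rewrite !mxE ler_norml; lra.
Qed.

Lemma bdry_cube : bdry cube_gauge = @cube_boundary R n.
Proof.
have xj (a : R) : 0 <= a <= 1 -> `|a - 2^-1| = 2^-1 <-> a = 0 \/ a = 1.
  move=> h; case: (ger0P (a - 2^-1)) => ?; split.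
  - by move=> ?; right; lra.
  - by case; lra.
  - by move=> ?; left; lra.
  - by case; lra.
apply/seteqP; split=> x.
  move=> xb; have xc : cube x by rewrite -body_cube; exact: bdry_body.
  split=> //; move: xb; rewrite /bdry /= => xb.
  have [|j hj] := @rV_norm_attained (x - ctr).
    by apply/eqP => h; move: xb; rewrite h mulr0 => /eqP; rewrite eq_sym oner_eq0.
  exists j; apply/xj => //; move: hj; rewrite !mxE => <-; lra.
move=> [xc [j /(xj _ (xc j)) hj]].
have : body cube_gauge x by rewrite body_cube.
rewrite /body /bdry /= => h; apply/le_anti; rewrite h /=.
have : `|(x - ctr) ord0 j| <= `|x - ctr|.
  by apply: (iffLR (@rV_norm_le _ _ _)).
by rewrite !mxE hj; lra.
Qed.

End gauges.

(** * The fiber *)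

Section fiber.
Context (R : realType) (Y W : ptopologicalType) (f : pointed_map Y W).
Local Notation E := (path_space R f).
Local Notation ps0 := (ps_point R f).

Definition fiber_set : set E := [set e | ps_end e = point].
Definition fiber := set_type fiber_set.
HB.instance Definition _ := Topological.on fiber.

Lemma fiber_point_subproof : fiber_set ps0.
Proof. by []. Qed.

HB.instance Definition _ :=
  isPointed.Build fiber (SigSub (mem_set fiber_point_subproof)).

Lemma fiber_end (v : fiber) : ps_end (val v) = point.
Proof. by have /set_mem := valP v. Qed.

Lemma fiber_val_continuous : continuous (val : fiber -> E).
Proof. exact: initial_continuous. Qed.

Definition ps_joined (e e' : E) := exists d : R -> E,
  [/\ {within `[0, 1], continuous d}, d 0 = e & d 1 = e'].

(** Shortening the path to its start is a path in [E]. Once the path is constant, a path of [Y]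
    leads to the basepoint, so [E] inherits path-connectedness from [Y]. *)
Lemma ps_joined_shrink e : exists e', ps_joined e e' /\
  forall t, 0 <= t <= 1 -> ps_path e' t = f (ps_start e').
Proof.
pose H (z : R * R) := ps_path e (z.1 * (1 - z.2)).
have cH : continuous H.
  apply: (@continuous_fun_comp _ _ _ (fun z : R * R => z.1 * (1 - z.2))
    (ps_path e)); last exact: ps_path_continuous.
  move=> z; apply: cvgM; first exact: cvg_fst.
  by apply: cvgB; [exact: cvg_cst|exact: cvg_snd].
have H0 x : [set` `[(0 : R), 1]] x -> H (0, x) = f (ps_start e).
  by rewrite /H mul0r ps_path0.
have [d [cd ds dp]] := ps_lift (T := R) (S := [set` `[(0 : R), 1]])
  (continuous_subspaceT (@cst_continuous _ _ (ps_start e)))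
  (continuous_subspaceT cH) H0.
have I0 : [set` `[(0 : R), 1]] 0 by rewrite /= in_itv /= lexx ler01.
have I1 : [set` `[(0 : R), 1]] 1 by rewrite /= in_itv /= lexx ler01.
exists (d 1); split.
  exists d; split=> //; apply: ps_eq; first by rewrite ds.
  by move=> t tI; rewrite dp // /H /= subr0 mulr1.
by move=> t tI; rewrite dp // /H /= subrr mulr0 ps_path0 ds.
Qed.

Lemma ps_joined_point e : path_connected R Y ->
  (forall t, 0 <= t <= 1 -> ps_path e t = f (ps_start e)) ->
  ps_joined e ps0.
Proof.
move=> pcY eE; have [p [cp p0 p1]] := pcY (ps_start e) point.
pose H (z : R * R) := f (p z.2).
have cH : {within `[0, 1] `*` `[0, 1], continuous H}.
  apply: (within_comp (f := fun z : R * R => p z.2) (g := f) (S' := setT)) => //.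
    apply: (within_comp (f := snd) _ cp) => [|z []//].
    exact/continuous_subspaceT/continuous_snd.
  exact/continuous_subspaceT/pmap_continuous.
have [d [cd ds dp]] := ps_lift cp cH (fun _ _ => erefl).
have I0 : [set` `[(0 : R), 1]] 0 by rewrite /= in_itv /= lexx ler01.
have I1 : [set` `[(0 : R), 1]] 1 by rewrite /= in_itv /= lexx ler01.
exists d; split=> //; apply: ps_eq.
- by rewrite ds // p0.
- by move=> t tI; rewrite dp // /H /= p0 eE.
- by rewrite ds // p1.
- by move=> t tI; rewrite dp // /H /= p1 pmap_point.
Qed.

Section reduction.
Context (T : topologicalType) (G : gauge R T).

Lemma finitely_many_sections_eq (X U : topologicalType) (A : set X)
    (Q Q' : X -> set U) : (forall x, A x -> Q x = Q' x) ->
  finitely_many_sections R A Q -> finitely_many_sections R A Q'.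
Proof.
move=> QQ' fin s sP; have [i|i [j [ij [H [cH H0 H1 HQ]]]]] := fin s.
  by have [cs sQ] := sP i; split=> // x Ax; rewrite QQ' //; exact: sQ.
exists i, j; split=> //; exists H; split=> // t x It Ax.
by rewrite -QQ' //; exact: HQ.
Qed.

(** A path in [E] is a homotopy of constant lifting problems, with matching boundary values, to
    which transport applies. *)
Lemma finitely_many_lifts_joined e e' : ps_joined e e' ->
  finitely_many_sections R (body G) (lift_rel G (fun=> ps_end e') (fun=> e')) ->
  finitely_many_sections R (body G) (lift_rel G (fun=> ps_end e) (fun=> e)).
Proof.
move=> [d [cd d0 d1]] fin.
have cdT A : {within `[0, 1] `*` A, continuous (fun z : R * T => d z.1)}.
  apply: (within_comp (f := fst) _ cd) => [|z []//].
  exact/continuous_subspaceT/continuous_fst.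
have := @finitely_many_lifts_transport R T G Y W f
  (fun z => ps_end (d z.1)) (fun z => d z.1) _ (cdT _) (fun _ _ _ _ => erefl).
rewrite /= d0 d1; apply => //.
apply: (within_comp (g := @ps_end _ _ _ f) (cdT _) (S' := setT)) => //.
exact/continuous_subspaceT/ps_end_continuous.
Qed.

(* The body is contracted to its center along the first section, which makes
   the problem constant; the constant value is then joined to the basepoint. *)
Lemma finitely_many_lifts_const (k : T -> W) (b : T -> E) :
  path_connected R Y ->
  {within body G, continuous k} ->
  finitely_many_sections R (body G) (lift_rel G (fun=> point) (fun=> ps0)) ->
  finitely_many_sections R (body G) (lift_rel G k b).
Proof.
move=> pcY ck fin s sP.
have [cs sQ] := sP 0%N.
have c x y : rad G 0 x = rad G 0 y := rad0 G x y.
pose m (z : R * T) := rad G (1 - z.1) z.2.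
have cm : continuous m.
  have c1 : continuous (fun z : R * T => (1 - z.1, z.2)).
    apply: continuous_pair; last exact: continuous_snd.
    by apply: continuous_onem; exact: continuous_fst.
  rewrite /m; exact: (continuous_fun_comp c1 (@rad_continuous R T G)).
have mP z : (`[0, 1] `*` body G) z -> body G (m z).
  move=> [/= zI zG]; rewrite /body /= rho_rad; last by move: zI; rewrite in_itv /=; lra.
  by move: zI zG; rewrite /body in_itv /= => zI zG; have := rho_ge0 G z.2; nra.
have ckm : {within `[0, 1] `*` body G, continuous (k \o m)}.
  exact: (within_comp (continuous_subspaceT cm) ck mP).
have csm : {within `[0, 1] `*` bdry G, continuous (s 0%N \o m)}.
  apply: (within_comp (continuous_subspaceT cm) cs) => z [z1 z2].
  by apply: mP; split => //; exact: bdry_body.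
have h := finitely_many_lifts_transport ckm csm.
(* The section [s 0%N] extends the boundary values [b] over the whole body, so they can be dragged
   along the contraction. *)
apply: (finitely_many_sections_eq _ (h _ _)) sP => {h}.
- move=> x xG; rewrite /lift_rel /m /= subr0 rad1; apply/seteqP; split => v [/= vk vb];
    by split=> //= xb; have [_ E0] := sQ x xG; rewrite vb // E0.
- move=> t x tI xb; have /sQ[] // : body G (m (t, x)).
  by apply: mP; split; [rewrite /= in_itv|exact: bdry_body].
(* A gauge names no center: it is reached as [rad G 0 x1] from some point. An empty body makes every
   condition vacuous. *)
have [x0|T0] := pselect (exists x0 : T, body G x0); last first.
  move=> s' _; exists 0%N, 1%N; split=> //; exists (fun=> ps0); split.
  - by apply: continuous_subspaceT; exact: cst_continuous.
  - by move=> x xG; case: T0; exists x.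
  - by move=> x xG; case: T0; exists x.
  - by move=> t x _ xG; case: T0; exists x.
have [x1 x1G] := x0; pose e := s 0%N (rad G 0 x1).
have eE : ps_end e = k (rad G 0 x1).
  have : body G (m (1, x1)) by apply: mP; split; rewrite //= in_itv /= lexx ler01.
  by rewrite /m /= subrr => /sQ[].
have [e' [ee' e'E]] := ps_joined_shrink e.
have e'0 := ps_joined_point pcY e'E.
apply: finitely_many_sections_eq
  (finitely_many_lifts_joined ee' (finitely_many_lifts_joined e'0 fin)).
by move=> x xG; rewrite /lift_rel /m /= subrr (c x x1) eE.
Qed.

End reduction.
End fiber.

(** * Lifts over a disc as elements of a homotopy group of the fiber *)

Section disc_to_cube.
Context (R : realType) (n : nat).
Local Notation rV := ('rV[R]_n).

Lemma continuous_row (T : topologicalType) (f : T -> rV) :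
  (forall j, continuous (fun z => f z ord0 j)) -> continuous f.
Proof.
move=> cf; apply/within_continuousT/within_row => j.
exact/continuous_subspaceT/cf.
Qed.

(** A crude substitute for the radial homeomorphism. A unit vector has a coordinate of absolute
    value at least [1/n], so magnifying by [n] and clamping puts it on a face. *)
Definition disc_cube (x : rV) : rV :=
  \row_j clamp (n%:R / 2 * x ord0 j + 2^-1).

Lemma disc_cube_continuous : continuous disc_cube.
Proof.
apply: continuous_row => j; under eq_fun do rewrite mxE.
have c := continuous_affine (a := n%:R / 2) (b := 2^-1) (@coord_cont R n j).
exact: (continuous_fun_comp c (@clamp_continuous R)).
Qed.

Lemma disc_cubeP x : cube (disc_cube x).
Proof. by move=> j; rewrite mxE; exact: clamp_in. Qed.

Lemma disc_cube_sphere x : sqnorm x = 1 -> cube_boundary (disc_cube x).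
Proof.
move=> x1; split; first exact: disc_cubeP.
(* Otherwise [n ^ 2] times the squared length is a sum of [n] terms below 1, giving [n ^ 2 < n]. In
   dimension 0 the sphere is empty. *)
have [j hj] : exists j, 1 <= `|n%:R * x ord0 j|.
  apply: contrapT => /forallNP h.
  have n0 : (0 < n)%N.
    rewrite lt0n; apply/negP => /eqP n0.
    have : sqnorm x = 0.
      rewrite /sqnorm big1 // => j _.
      by have := ltn_ord j; rewrite [X in (_ < X)%N]n0 ltn0.
    by rewrite x1 => /eqP; rewrite oner_eq0.
  have nR : 1 <= n%:R :> R by rewrite ler1n.
  have : n%:R ^+ 2 * sqnorm x < n%:R.
    have nE : n%:R = \sum_(j < n) 1 :> R by rewrite sumr_const card_ord.
    rewrite /sqnorm mulr_sumr [X in _ < X]nE.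
    apply: ltr_sum; first by apply/hasP; exists (Ordinal n0); rewrite ?mem_index_enum.
    move=> j _; rewrite -exprMn -[X in X < _]ger0_norm ?sqr_ge0 // normrX.
    have /negP := h j; rewrite -ltNge => hj.
    by rewrite expr_lt1.
  by rewrite x1 mulr1; nra.
exists j; rewrite mxE /clamp maxEle minEle.
move: hj; case: (ger0P (n%:R * x ord0 j)) => h hj.
  by right; case: ifP; case: ifP; lra.
by left; case: ifP; case: ifP; lra.
Qed.

(** Straight-line homotopy from the identity to [disc_cube] followed by the rescaling of the cube to
    side 2 about the origin. *)
Definition disc_mix (t : R) (x : rV) : rV :=
  \row_j ((1 - t) * x ord0 j + t * (2 * disc_cube x ord0 j - 1)).

Lemma disc_mix_continuous : continuous (fun z : R * rV => disc_mix z.1 z.2).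
Proof.
apply: continuous_row => j; under eq_fun do rewrite mxE.
have cj := continuous_fun_comp (@continuous_snd R rV) (@coord_cont R n j).
have cp := continuous_fun_comp (continuous_fun_comp (@continuous_snd R rV)
  disc_cube_continuous) (@coord_cont R n j).
have ct := @continuous_fst R rV.
move=> z; apply: cvgD; apply: cvgM.
- by apply: cvgB; [exact: cvg_cst|exact: ct].
- exact: cj.
- exact: ct.
- apply: cvgB; last exact: cvg_cst.
  by apply: cvgM; [exact: cvg_cst|exact: cp].
Qed.

(* On the disc the clamped coordinates of [disc_cube] dominate those of [x] in
   absolute value, so the segment from [x] on the sphere stays outside the open
   disc. *)
Lemma disc_mix_sphere t x : 0 <= t <= 1 -> sqnorm x = 1 ->
  1 <= sqnorm (disc_mix t x).
Proof.
move=> tI x1; rewrite -[X in X <= _]x1; apply: ler_sum => j _.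
have xj : x ord0 j ^+ 2 <= 1.
  rewrite -x1 /sqnorm (bigD1 j) //= lerDl.
  by apply: sumr_ge0 => k _; exact: sqr_ge0.
have nR : 1 <= n%:R :> R.
  by rewrite ler1n; case: j xj => m mn _; exact: leq_ltn_trans mn.
rewrite !mxE /clamp maxEle minEle; move: (x ord0 j) xj => y xj.
have y1 : -1 <= y <= 1 by apply/andP; split; nra.
set c := (X in 2 * X - 1).
have : (0 <= y /\ y <= 2 * c - 1) \/ (y <= 0 /\ 2 * c - 1 <= y).
  rewrite /c; have [y0|y0] := lerP 0 y; [left|right]; split; try lra.
    have : y <= n%:R * y by nra.
    by case: ifP; case: ifP; lra.
  have : n%:R * y <= y by nra.
  by case: ifP; case: ifP; lra.
move: (2 * c - 1) => d [] [h1 h2].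
  have : y <= (1 - t) * y + t * d by nra.
  nra.
have : (1 - t) * y + t * d <= y by nra.
nra.
Qed.

Context (Y W : ptopologicalType) (f : pointed_map Y W).
Local Notation E := (path_space R f).
Local Notation ps0 := (ps_point R f).

(** Extending by the basepoint outside the disc allows evaluation on the larger cube of side 2 and
    along [disc_mix], both of which leave the disc. *)
Lemma disc_lift_loop (s : rV -> E) :
  sect (body (disc_gauge R n)) (lift_rel (disc_gauge R n) (fun=> point) (fun=> ps0)) s ->
  exists h : rV -> fiber R f, [/\ continuous h,
    forall x, sqnorm x <= 1 -> val (h x) = s x &
    forall x, 1 <= sqnorm x -> h x = point].
Proof.
rewrite /sect /lift_rel body_disc bdry_disc => -[cs sQ].
have [g [cg gE]] : exists g : rV -> fiber R f, {within @disc R n, continuous g}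
    /\ forall x, disc x -> val (g x) = s x := within_lift_set (A := @fiber_set R Y W f)
  (point : fiber R f) cs (fun x xd => proj1 (sQ x xd)).
have gb x : sqnorm x = 1 -> g x = point.
  move=> x1; apply: val_inj; rewrite gE; last by rewrite /disc /= -/(sqnorm x) x1.
  by have [|_ ->] := sQ x; rewrite // /disc /= -/(sqnorm x) x1.
pose P := [set x : rV | sqnorm x <= 1]; pose Q := [set x : rV | 1 <= sqnorm x].
exists (fun x => if `[< P x >] then g x else point); split.
- apply/within_continuousT/(@within_glue _ _ _ P Q).
  + apply: (@closed_continuous_preimage _ _ _ [set x : R | x <= 1]).
      exact: sqnorm_continuous.
    exact: closed_le.
  + apply: (@closed_continuous_preimage _ _ _ [set x : R | 1 <= x]).
      exact: sqnorm_continuous.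
    exact: closed_ge.
  + by move=> x _; rewrite /P /Q /=; case: (lerP (sqnorm x) 1) => h;
      [left|right; exact: ltW].
  + by rewrite setTI.
  + by apply: continuous_subspaceT; exact: cst_continuous.
  + by move=> x _ h1 h2; apply: gb; apply/le_anti; rewrite h1 h2.
- by move=> x xd; rewrite asboolT // gE.
- move=> x x1; case: asboolP => // xd; apply: gb.
  by apply/le_anti; rewrite xd x1.
Qed.

Definition double_row (x : rV) : rV := \row_j (2 * x ord0 j + - 1).

Lemma double_row_continuous : continuous double_row.
Proof.
apply: continuous_row => j; under eq_fun do rewrite mxE.
exact: (continuous_affine (a := 2) (b := - 1) (@coord_cont R n j)).
Qed.

Lemma double_row_boundary x : cube_boundary x -> 1 <= sqnorm (double_row x).
Proof.
move=> [_ [j hj]]; rewrite /sqnorm (bigD1 j) //=.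
have -> : double_row x ord0 j ^+ 2 = 1.
  by rewrite mxE; case: hj => ->; rewrite expr2; lra.
by rewrite lerDl; apply: sumr_ge0 => k _; exact: sqr_ge0.
Qed.

(** Reading a lift on the rescaled cube gives a loop [u k] in the fiber. Pulled back by [disc_cube],
    this loop is vertically homotopic to the lift through [disc_mix], so homotopic loops come from
    homotopic lifts. *)
Lemma finitely_many_disc_lifts :
  (forall s : nat -> homotopy_group R n (fiber R f),
     exists i j, (i < j)%N /\ s i = s j) ->
  finitely_many_sections R (body (disc_gauge R n))
    (lift_rel (disc_gauge R n) (fun=> point) (fun=> ps0)).
Proof.
move=> fin s sP; have /choice[h hP] i := disc_lift_loop (sP i).
have hb i x : cube_boundary x -> h i (double_row x) = point.
  by move=> xb; have [_ _ ->] := hP i; last exact: double_row_boundary.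
have hc i : {within @cube R n, continuous (fun x => h i (double_row x))}.
  have [ch _ _] := hP i.
  exact/continuous_subspaceT/(continuous_fun_comp double_row_continuous).
pose u i := NLoop (hc i) (hb i).
have [i [j [ij]]] := fin (fun i => \pi_(homotopy_group R n (fiber R f)) (u i)).
move=> /homotopy_group_eqP[U [cU U0 U1 UC]].
exists i, j; split=> //.
have step k : sect_homotopic R (body (disc_gauge R n))
    (lift_rel (disc_gauge R n) (fun=> point) (fun=> ps0))
    (s k) (fun x => val (u k (disc_cube x))).
  have [ch hs h0] := hP k.
  exists (fun z => val (h k (disc_mix z.1 z.2))).
  rewrite body_disc; split.
  - apply: continuous_subspaceT.
    exact: (continuous_fun_comp (continuous_fun_comp disc_mix_continuous ch)
      (@fiber_val_continuous _ _ _ f)).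
  - move=> x xd /=; rewrite -hs //; congr (val (h k _)).
    by apply/rowP => l; rewrite mxE subr0 mul1r mul0r addr0.
  - move=> x xd /=; congr (val (h k _)).
    by apply/rowP => l; rewrite !mxE subrr mul0r mul1r add0r.
  - move=> t x tI xd; split; first exact: fiber_end.
    rewrite bdry_disc => xb; rewrite h0 //=.
    exact: disc_mix_sphere.
apply: sect_homotopic_trans (step i) _.
apply: sect_homotopic_trans _ (sect_homotopic_sym (step j)).
exists (fun z => val (U (z.1, disc_cube z.2))); rewrite body_disc; split.
- have cm : continuous (fun z : R * rV => (z.1, disc_cube z.2)).
    apply: continuous_pair; first exact: continuous_fst.
    exact: (continuous_fun_comp (@continuous_snd _ _) disc_cube_continuous).
  have cU' : {within `[0, 1] `*` @disc R n,
      continuous (fun z : R * rV => U (z.1, disc_cube z.2))}.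
    apply: (within_comp (continuous_subspaceT cm) cU) => z [zI _].
    by split=> //; exact: disc_cubeP.
  apply: (within_comp (S' := setT) cU') => //.
  exact/continuous_subspaceT/fiber_val_continuous.
- by move=> x xd; rewrite U0 //; exact: disc_cubeP.
- by move=> x xd; rewrite U1 //; exact: disc_cubeP.
- move=> t x tI xd; split; first exact: fiber_end.
  rewrite bdry_disc => xb.
  have b := disc_cube_sphere xb.
  by rewrite UC // nloop_boundary.
Qed.

End disc_to_cube.

(** * The exact sequence of the fiber *)

Section cons_row.
Context (R : realType) (n : nat).
Local Notation rV := ('rV[R]_n).

Definition cons_row (t : R) (x : rV) : 'rV[R]_n.+1 :=
  \row_j (if unlift ord0 j is Some k then x ord0 k else t).
Definition tail_row (y : 'rV[R]_n.+1) : rV := \row_k y ord0 (lift ord0 k).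

Lemma cons_row0 t x : cons_row t x ord0 ord0 = t.
Proof. by rewrite mxE unlift_none. Qed.

Lemma cons_rowS t x k : cons_row t x ord0 (lift ord0 k) = x ord0 k.
Proof. by rewrite mxE liftK. Qed.

Lemma tail_cons_row t x : tail_row (cons_row t x) = x.
Proof. by apply/rowP => k; rewrite mxE cons_rowS. Qed.

Lemma upd_cons_row t x s : upd (cons_row t x) ord0 s = cons_row s x.
Proof.
apply/rowP => j; rewrite !mxE; case: (unliftP ord0 j) => [k|] ->.
  by rewrite eq_sym (negbTE (neq_lift _ _)).
by rewrite eqxx.
Qed.

Lemma cons_row_cube t x : 0 <= t <= 1 -> cube x -> cube (cons_row t x).
Proof. by move=> tI xc j; rewrite mxE; case: unliftP => [k|] _. Qed.

Lemma tail_row_cube y : cube y -> cube (tail_row y).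
Proof. by move=> yc j; rewrite mxE. Qed.

Lemma cons_row_boundary t x : 0 <= t <= 1 -> cube_boundary x ->
  cube_boundary (cons_row t x).
Proof.
move=> tI [xc [k hk]]; split; first exact: cons_row_cube.
by exists (lift ord0 k); rewrite cons_rowS.
Qed.

Lemma cons_row_end t x : cube x -> t = 0 \/ t = 1 ->
  cube_boundary (cons_row t x).
Proof.
move=> xc t01; split; last by exists ord0; rewrite cons_row0.
by apply: cons_row_cube => //; case: t01 => ->; rewrite lexx ler01.
Qed.

Lemma cube_boundaryS y : cube_boundary y ->
  [\/ y ord0 ord0 = 0, y ord0 ord0 = 1 | cube_boundary (tail_row y)].
Proof.
move=> [yc [j]]; case: (unliftP ord0 j) => [k|] -> h.
  constructor 3; split; first exact: tail_row_cube.
  by exists k; rewrite mxE.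
by case: h; [constructor 1|constructor 2].
Qed.

Lemma cons_row_continuous : continuous (fun z : R * rV => cons_row z.1 z.2).
Proof.
apply: continuous_row => j; under eq_fun do rewrite mxE.
case: (unlift ord0 j) => [k|]; last exact: continuous_fst.
exact: (continuous_fun_comp (@continuous_snd R rV) (@coord_cont R n k)).
Qed.

Lemma uncons_row_continuous :
  continuous (fun y : 'rV[R]_n.+1 => (y ord0 ord0, tail_row y)).
Proof.
apply: continuous_pair; first exact: coord_cont.
apply: continuous_row => k; under eq_fun do rewrite mxE.
exact: coord_cont.
Qed.

End cons_row.

Section exactness.
Context (R : realType) (Y W : ptopologicalType) (f : pointed_map Y W).
Local Notation E := (path_space R f).
Local Notation F := (fiber R f).

Definition fiber_start (v : F) : Y := ps_start (val v).
Definition fiber_path (v : F) : R -> W := ps_path (val v).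

Lemma fiber_start_continuous : continuous fiber_start.
Proof.
exact: (continuous_fun_comp (@fiber_val_continuous _ _ _ f)
  (@ps_start_continuous _ _ _ f)).
Qed.

Lemma fiber_eq v w : fiber_start v = fiber_start w ->
  (forall t, 0 <= t <= 1 -> fiber_path v t = fiber_path w t) -> v = w.
Proof. by move=> h1 h2; apply/val_inj/ps_eq. Qed.

Lemma fiber_path0 v : fiber_path v 0 = f (fiber_start v).
Proof. exact: ps_path0. Qed.

Definition fiber_proj : pointed_map F Y :=
  @PointedMap F Y fiber_start fiber_start_continuous erefl.

Lemma fiber_lift (T : topologicalType) (S : set T) (g : T -> Y) (H : R * T -> W) :
  {within S, continuous g} -> {within `[0, 1] `*` S, continuous H} ->
  (forall x, S x -> H (0, x) = f (g x)) ->
  (forall x, S x -> H (1, x) = point) ->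
  exists e : T -> F,
    [/\ {within S, continuous e},
        forall x, S x -> fiber_start (e x) = g x &
        forall x t, S x -> 0 <= t <= 1 -> fiber_path (e x) t = H (t, x)].
Proof.
move=> cg cH H0 H1; have [e [ce es ep]] := ps_lift cg cH H0.
have eF x : S x -> fiber_set (e x).
  by move=> Sx; rewrite /fiber_set /ps_end /= ep // ?H1 // lexx ler01.
have [g' [cg' gE]] := within_lift_set (A := @fiber_set R Y W f)
  (point : F) ce eF.
exists g'; split=> //.
  by move=> x Sx; rewrite /fiber_start gE // es.
by move=> x t Sx tI; rewrite /fiber_path gE // ep.
Qed.

Variable n : nat.

(** A point of the fiber carries a path from the image of its start to the basepoint. Moving along
    these paths is the null-homotopy. *)
Lemma fiber_proj_kernel (a : homotopy_group R n F) :
  homotopy_group_map R n f (homotopy_group_map R n fiber_proj a) = hg_one R n W.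
Proof.
elim/hg_ind: a => u; rewrite !homotopy_group_map_pi; apply/homotopy_group_eqP.
exists (fun z => fiber_path (u z.2) z.1); split => //=.
- have cu : {within `[0, 1] `*` @cube R n,
      continuous (fun z : R * 'rV[R]_n => u z.2)}.
    apply: (within_comp (f := snd) _ (nloop_continuous u)) => [|z []//].
    exact/continuous_subspaceT/continuous_snd.
  have cv := within_comp (S' := setT) cu
    (continuous_subspaceT (@fiber_val_continuous _ _ _ f)) (fun _ _ => Logic.I).
  exact: (within_comp (S' := setT)
    (within_pair (continuous_subspaceT (@continuous_fst _ _)) cv)
    (continuous_subspaceT (@ps_eval_continuous _ _ _ f)) (fun _ _ => Logic.I)).
- by move=> x xc; rewrite fiber_path0.
- by move=> x xc; exact: fiber_end.
- by move=> t x tI xb; rewrite nloop_boundary // pmap_point.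
Qed.

(* [alpha] represents the image of [v] under the connecting map
   pi_(n+1)(W) -> pi_n(F). *)
Definition connects (v : 'rV[R]_n.+1 -> W) (alpha : 'rV[R]_n -> F) :=
  forall x, cube x -> fiber_start (alpha x) = point /\
    forall t, 0 <= t <= 1 -> fiber_path (alpha x) t = v (cons_row t x).

(** A homotopy in the fiber is a homotopy [g] of starts with a compatible family [H] of paths. In
    [H (t, (s, x))], [t] is the time along the path and [s] the stage of the homotopy. *)
Lemma fiber_homotopic (u u' : nloop R n F) (g : R * 'rV[R]_n -> Y)
    (H : R * (R * 'rV[R]_n) -> W) :
  {within `[0, 1] `*` @cube R n, continuous g} ->
  {within `[0, 1] `*` (`[0, 1] `*` @cube R n), continuous H} ->
  (forall s x, 0 <= s <= 1 -> cube x -> H (0, (s, x)) = f (g (s, x))) ->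
  (forall s x, 0 <= s <= 1 -> cube x -> H (1, (s, x)) = point) ->
  (forall x, cube x -> fiber_start (u x) = g (0, x)) ->
  (forall x t, cube x -> 0 <= t <= 1 -> fiber_path (u x) t = H (t, (0, x))) ->
  (forall x, cube x -> fiber_start (u' x) = g (1, x)) ->
  (forall x t, cube x -> 0 <= t <= 1 -> fiber_path (u' x) t = H (t, (1, x))) ->
  (forall s x, 0 <= s <= 1 -> cube_boundary x -> g (s, x) = point) ->
  (forall t s x, 0 <= t <= 1 -> 0 <= s <= 1 -> cube_boundary x ->
     H (t, (s, x)) = point) ->
  homotopic_rel R (@cube R n) (@cube_boundary R n) u u'.
Proof.
move=> cg cH H0 H1 ug uH u'g u'H gb Hb.
have H0' z : (`[0, 1] `*` @cube R n) z -> H (0, z) = f (g z).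
  by case: z => s x [sI xc]; exact: H0.
have H1' z : (`[0, 1] `*` @cube R n) z -> H (1, z) = point.
  by case: z => s x [sI xc]; exact: H1.
have [e [ce es ep]] := fiber_lift cg cH H0' H1'.
have zI s (x : 'rV[R]_n) : 0 <= s <= 1 -> cube x -> (`[0, 1] `*` @cube R n) (s, x).
  by move=> sI xc; split; rewrite //= in_itv.
have I0 : 0 <= (0 : R) <= 1 by rewrite lexx ler01.
have I1 : 0 <= (1 : R) <= 1 by rewrite lexx ler01.
exists e; split=> //.
- move=> x xc; apply: fiber_eq; first by rewrite es ?ug //; exact: zI.
  by move=> t tI; rewrite ep ?uH //; exact: zI.
- move=> x xc; apply: fiber_eq; first by rewrite es ?u'g //; exact: zI.
  by move=> t tI; rewrite ep ?u'H //; exact: zI.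
- move=> s x sI xb; rewrite [RHS]nloop_boundary //.
  have xc := cube_boundary_sub xb.
  apply: fiber_eq; first by rewrite es ?gb //; exact: zI.
  by move=> t tI; rewrite ep ?Hb //; exact: zI.
Qed.

(** The connecting map is well defined: a homotopy of [v] is a homotopy of paths with start fixed at
    the basepoint. *)
Lemma connects_homotopic (v v' : nloop R n.+1 W) (u u' : nloop R n F) :
  connects v u -> connects v' u' ->
  homotopic_rel R (@cube R n.+1) (@cube_boundary R n.+1) v v' ->
  homotopic_rel R (@cube R n) (@cube_boundary R n) u u'.
Proof.
move=> vu v'u' [V [cV V0 V1 VC]].
pose m (z : R * (R * 'rV[R]_n)) := (z.2.1, cons_row z.1 z.2.2).
have cm : continuous m.
  have c21 := continuous_fun_comp (@continuous_snd R (R * 'rV[R]_n)%type)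
    (@continuous_fst _ _).
  have c22 := continuous_fun_comp (@continuous_snd R (R * 'rV[R]_n)%type)
    (@continuous_snd _ _).
  apply: continuous_pair; first exact: c21.
  exact: (continuous_fun_comp (continuous_pair (@continuous_fst _ _) c22)
    (@cons_row_continuous R n)).
have cH : {within `[0, 1] `*` (`[0, 1] `*` @cube R n), continuous (V \o m)}.
  apply: (within_comp (continuous_subspaceT cm) cV) => -[t [s x]].
  by move=> [/= tI [/= sI xc]]; split=> //; exact: cons_row_cube.
have bp t x : 0 <= t <= 1 -> cube_boundary (cons_row t x) ->
    forall s, 0 <= s <= 1 -> V (s, cons_row t x) = point.
  by move=> tI b s sI; rewrite VC // nloop_boundary.
apply: (@fiber_homotopic u u' (fun=> point) (V \o m)) => //.
- by apply: continuous_subspaceT; exact: cst_continuous.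
- move=> s x sI xc; rewrite /m /= pmap_point bp ?lexx ?ler01 //.
  by apply: cons_row_end => //; left.
- move=> s x sI xc; rewrite /m /= bp ?lexx ?ler01 //.
  by apply: cons_row_end => //; right.
- by move=> x xc; have [] := vu x xc.
- by move=> x t xc tI; have [_ ->] := vu x xc; rewrite // /m /= V0 //;
    exact: cons_row_cube.
- by move=> x xc; have [] := v'u' x xc.
- by move=> x t xc tI; have [_ ->] := v'u' x xc; rewrite // /m /= V1 //;
    exact: cons_row_cube.
- move=> t s x tI sI xb; rewrite /m /= bp //; exact: cons_row_boundary.
Qed.

(* The homotopy shortens [w] from its initial part, letting the start point run
   through [c]. *)
Lemma connects_image (c : nloop R n.+1 Y) (v : nloop R n.+1 W)
    (u u' : nloop R n F) :
  connects (nloop_cat ord0 (nloop_post f c) v) u -> connects v u' ->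
  homotopic_rel R (@cube R n) (@cube_boundary R n) u u'.
Proof.
set w := nloop_cat _ _ _ => wu vu'.
have wE t x : w (cons_row t x) = if t <= 2^-1 then f (c (cons_row (2 * t) x))
    else v (cons_row (2 * t - 1) x).
  by rewrite /w /= /cat_fun cons_row0 !upd_cons_row.
(* At stage [s] only the part of [w] after time [s / 2] is run. Since [f c] occupies the first half
   of [w] at double speed, this part starts over [c] at time [s], and at [s = 1] it is [v]. *)
pose m (z : R * (R * 'rV[R]_n)) :=
  cons_row (2^-1 * z.2.1 + (1 - 2^-1 * z.2.1) * z.1) z.2.2.
have cm : continuous m.
  have c21 := continuous_fun_comp (@continuous_snd R (R * 'rV[R]_n)%type)
    (@continuous_fst _ _).
  have c22 := continuous_fun_comp (@continuous_snd R (R * 'rV[R]_n)%type)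
    (@continuous_snd _ _).
  have c1 := @continuous_fst R (R * 'rV[R]_n)%type.
  have ch : continuous (fun z : R * (R * 'rV[R]_n) => 2^-1 * z.2.1).
    by move=> z; apply: cvgM; [exact: cvg_cst|exact: c21].
  have ct : continuous (fun z : R * (R * 'rV[R]_n) =>
      2^-1 * z.2.1 + (1 - 2^-1 * z.2.1) * z.1).
    move=> z; apply: cvgD; first exact: ch.
    apply: cvgM; last exact: c1.
    by apply: cvgB; [exact: cvg_cst|exact: ch].
  exact: (continuous_fun_comp (continuous_pair ct c22)
    (@cons_row_continuous R n)).
have mI (t s : R) : 0 <= t <= 1 -> 0 <= s <= 1 ->
    0 <= 2^-1 * s + (1 - 2^-1 * s) * t <= 1.
  by move=> /andP[? ?] /andP[? ?]; apply/andP; split; nra.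
apply: (@fiber_homotopic u u' (fun z => c (cons_row z.1 z.2)) (fun z => w (m z))) => //.
- apply: (within_comp (continuous_subspaceT (@cons_row_continuous R n))
    (nloop_continuous c)) => z [zI zc].
  by apply: cons_row_cube => //; move: zI; rewrite /= in_itv.
- apply: (within_comp (continuous_subspaceT cm) (nloop_continuous w)).
  move=> [t [s x]] [tI [sI xc]].
  by apply: cons_row_cube => //; exact: mI.
- move=> s x sI xc; rewrite /m wE /= mulr0 addr0 ifT; last by lra.
  by rewrite mulrA divff // mul1r.
- move=> s x sI xc; have -> : m (1, (s, x)) = cons_row 1 x.
    by rewrite /m /=; congr cons_row; lra.
  rewrite [LHS]nloop_boundary //.
  by apply: cons_row_end => //; right.
- move=> x xc /=; have [-> _] := wu x xc; rewrite nloop_boundary //.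
  by apply: cons_row_end => //; left.
- move=> x t xc tI; have [_ ->] := wu x xc; rewrite // /m /=.
  by rewrite mulr0 add0r subr0 mul1r.
- move=> x xc /=; have [-> _] := vu' x xc; rewrite nloop_boundary //.
  by apply: cons_row_end => //; right.
- move=> x t xc tI; have [_ ->] := vu' x xc; rewrite // [RHS]wE /= mulr1.
  case: ifPn => h.
    have -> : t = 0 by lra.
    rewrite !nloop_boundary ?pmap_point //; apply: cons_row_end => //.
      by right; lra.
    by left.
  by congr (v (cons_row _ x)); lra.
- move=> s x sI xb; rewrite nloop_boundary //; exact: cons_row_boundary.
- move=> t s x tI sI xb; rewrite [LHS]nloop_boundary //.
  by apply: cons_row_boundary => //; exact: mI.
Qed.

Lemma connects_exists (v : nloop R n.+1 W) : exists u : nloop R n F, connects v u.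
Proof.
have I0 : 0 <= (0 : R) <= 1 by rewrite lexx ler01.
have cH : {within `[0, 1] `*` @cube R n,
    continuous (fun z : R * 'rV[R]_n => v (cons_row z.1 z.2))}.
  apply: (within_comp (continuous_subspaceT (@cons_row_continuous R n))
    (nloop_continuous v)) => z [zI zc].
  by apply: cons_row_cube => //; move: zI; rewrite /= in_itv.
have [||e [ce es ep]] := @fiber_lift _ (@cube R n) (fun=> point) _
    (continuous_subspaceT (@cst_continuous _ Y point)) cH.
- move=> x xc /=; rewrite pmap_point nloop_boundary //.
  by apply: cons_row_end => //; left.
- move=> x xc /=; rewrite nloop_boundary //.
  by apply: cons_row_end => //; right.
have eb x : cube_boundary x -> e x = point.
  move=> xb; have xc := cube_boundary_sub xb.
  apply: fiber_eq; first by rewrite es.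
  by move=> t tI; rewrite ep //= nloop_boundary //; exact: cons_row_boundary.
by exists (NLoop ce eb) => x xc; split=> [|t tI] /=; [rewrite es|rewrite ep].
Qed.

(** While the starts of [u] are contracted by [g], homotopy extension lets the attached paths follow
    with their other end fixed. In the end they start at the basepoint and together form the loop
    [v] in [W]. *)
Lemma fiber_proj_exact (u : nloop R n F) :
  homotopy_group_map R n fiber_proj (\pi_(homotopy_group R n F) u) = hg_one R n Y ->
  exists (v : nloop R n.+1 W) (u' : nloop R n F), connects v u' /\
    homotopic_rel R (@cube R n) (@cube_boundary R n) u u'.
Proof.
rewrite homotopy_group_map_pi => /homotopy_group_eqP[g [cg g0 g1 gC]].
have I0 : 0 <= (0 : R) <= 1 by rewrite lexx ler01.
have I1 : 0 <= (1 : R) <= 1 by rewrite lexx ler01.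
pose G := prism (cube_gauge R n).
have bodyG z : body G z <-> 0 <= z.1 <= 1 /\ cube z.2.
  by rewrite /G -body_cube; exact: body_prism.
have bdryG z : bdry G z <-> [/\ 0 <= z.1 <= 1, cube z.2 &
    [\/ z.1 = 0, z.1 = 1 | cube_boundary z.2]].
  rewrite /G -body_cube -bdry_cube; split.
    move=> zb; have zG := bdry_body zb.
    by have [h1 h2] := (body_prism _ _).1 zG; split=> //; apply/bdry_prism.
  by move=> [h1 h2 h3]; apply/bdry_prism => //; apply/body_prism.
have gb s x : 0 <= s <= 1 -> cube_boundary x -> g (s, x) = point.
  by move=> sI xb; rewrite gC //= nloop_boundary.
pose a (z : R * 'rV[R]_n) := fiber_path (u z.2) z.1.
pose P0 := [set z : R * (R * 'rV[R]_n) | z.2.1 = 0].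
(* In [(s, (t, x))], [s] is the stage and [(t, x)] runs over the prism. Paths begin at [f g] on the
   face [t = 0]; the rest of the wall stays at the basepoint. *)
pose b (z : R * (R * 'rV[R]_n)) :=
  if `[< P0 z >] then f (g (z.1, z.2.2)) else point.
have ca : {within body G, continuous a}.
  have cu : {within body G, continuous (fun z : R * 'rV[R]_n => u z.2)}.
    apply: (within_comp (f := snd) _ (nloop_continuous u)) => [|z /bodyG[]//].
    exact/continuous_subspaceT/continuous_snd.
  have cv := within_comp (S' := setT) cu
    (continuous_subspaceT (@fiber_val_continuous _ _ _ f)) (fun _ _ => Logic.I).
  exact: (within_comp (S' := setT)
    (within_pair (continuous_subspaceT (@continuous_fst _ _)) cv)
    (continuous_subspaceT (@ps_eval_continuous _ _ _ f)) (fun _ _ => Logic.I)).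
have c21 := continuous_fun_comp (@continuous_snd R (R * 'rV[R]_n)%type)
  (@continuous_fst _ _).
have c22 := continuous_fun_comp (@continuous_snd R (R * 'rV[R]_n)%type)
  (@continuous_snd _ _).
have clE (e : R) : closed [set z : R * (R * 'rV[R]_n) | z.2.1 = e].
  by apply: (@closed_continuous_preimage _ _ _ [set x : R | x = e]) => //;
    exact: closed_eq.
have cb : {within `[0, 1] `*` bdry G, continuous b}.
  apply: (@within_glue _ _ _ P0 ([set z : R * (R * 'rV[R]_n) | z.2.1 = 1] `|`
    [set z | cube_boundary z.2.2])).
  - exact: clE.
  - apply: closedU; first exact: clE.
    rewrite -bdry_cube; apply: (@closed_continuous_preimage _ _ _
      (bdry (cube_gauge R n))); last exact: closed_bdry.
    exact: c22.
  - by move=> [s z] [sI /bdryG[_ _ []]]; [left|right; left|right; right].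
  - have c1 : continuous (fun z : R * (R * 'rV[R]_n) => (z.1, z.2.2)).
      by apply: continuous_pair; [exact: continuous_fst|exact: c22].
    have c2 : {within `[0, 1] `*` bdry G `&` P0,
        continuous (fun z : R * (R * 'rV[R]_n) => g (z.1, z.2.2))}.
      apply: (within_comp (continuous_subspaceT c1) cg) => -[s z].
      by move=> [[sI /bdryG[_ zc _]] _].
    apply: (within_comp (S' := setT) c2) => //.
    exact/continuous_subspaceT/pmap_continuous.
  - by apply: continuous_subspaceT; exact: cst_continuous.
  - move=> [s [t x]] [/= sI _]; rewrite /P0 /= => -> [/=|].
      by move=> /eqP; rewrite eq_sym oner_eq0.
    by move=> xb; rewrite gb ?pmap_point.
have ab z : bdry G z -> b (0, z) = a z.
  case: z => t x /bdryG[tI xc h]; rewrite /b /a /=; case: asboolP => /= t0.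
    by rewrite /P0 /= in t0; rewrite t0 fiber_path0 g0.
  case: h => //= [t1|xb]; last by rewrite nloop_boundary.
  by rewrite t1; symmetry; exact: fiber_end.
have [w [cw w0 wb]] := jar_fill ca cb ab.
(* [w] takes the stage first, [fiber_homotopic] takes the path time first. *)
pose m (z : R * (R * 'rV[R]_n)) := (z.2.1, (z.1, z.2.2)).
have cm : continuous m.
  apply: continuous_pair; first exact: c21.
  by apply: continuous_pair; [exact: continuous_fst|exact: c22].
have cH : {within `[0, 1] `*` (`[0, 1] `*` @cube R n), continuous (w \o m)}.
  apply: (within_comp (continuous_subspaceT cm) cw) => -[t [s x]].
  by move=> [tI [sI xc]]; split=> //; apply/bodyG.
have wE0 s x : 0 <= s <= 1 -> cube x -> w (s, (0, x)) = f (g (s, x)).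
  move=> sI xc; rewrite wb //; first by rewrite /b asboolT.
  by apply/bdryG; split=> //; constructor 1.
have wE1 s x : 0 <= s <= 1 -> cube x -> w (s, (1, x)) = point.
  move=> sI xc; rewrite wb //.
    by rewrite /b asboolF // /P0 /= => /eqP; rewrite oner_eq0.
  by apply/bdryG; split=> //; constructor 2.
have wEb t s x : 0 <= t <= 1 -> 0 <= s <= 1 -> cube_boundary x ->
    w (s, (t, x)) = point.
  move=> tI sI xb; rewrite wb //.
    by rewrite /b; case: asboolP => //= _; rewrite gb ?pmap_point.
  by apply/bdryG; split=> //; [exact: cube_boundary_sub|constructor 3].
pose v0 (y : 'rV[R]_n.+1) := w (1, (y ord0 ord0, tail_row y)).
have cv0 : {within @cube R n.+1, continuous v0}.
  have c1 : continuous (fun y : 'rV[R]_n.+1 =>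
      ((1 : R), (y ord0 ord0, tail_row y))).
    apply: continuous_pair; first exact: cst_continuous.
    exact: uncons_row_continuous.
  apply: (within_comp (continuous_subspaceT c1) cw) => y yc.
  split; first by rewrite /= in_itv.
  by apply/bodyG; split; [exact: yc|exact: tail_row_cube].
have v0b y : cube_boundary y -> v0 y = point.
  move=> yb; have yc := cube_boundary_sub yb; have tc := tail_row_cube yc.
  case: (cube_boundaryS yb) => [y0|y1|tb]; rewrite /v0.
  - by rewrite y0 wE0 // g1 // pmap_point.
  - by rewrite y1 wE1.
  - by rewrite wEb.
pose v := NLoop cv0 v0b.
have [u' vu'] := connects_exists v.
exists v, u'; split=> //.
apply: (@fiber_homotopic u u' g (w \o m)) => //=.
- by move=> x xc; rewrite g0.
- by move=> x t xc tI; rewrite w0 //; apply/bodyG.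
- by move=> x xc; have [-> _] := vu' x xc; rewrite g1.
- move=> x t xc tI; have [_ ->] := vu' x xc; rewrite //= /v0.
  by rewrite cons_row0 tail_cons_row.
Qed.

End exactness.

(** * Rational equivalences and torsion *)

Section tensor_rational.

(* The integer [M * q], which is only meaningful if the denominator of [q]
   divides [M]. Multiplying coefficients by a large [M] maps A (x) Q back to
   A. *)
Definition clear_denom (M : nat) (q : rat) : int := numq (M%:R * q).

Lemma clear_denomP M q : (`|denq q|%N %| M)%N ->
  (clear_denom M q)%:~R = M%:R * q :> rat.
Proof.
move=> /dvdnP[k ->]; rewrite /clear_denom.
have -> : (k * `|denq q|)%N%:R * q = (k%:Z * numq q)%:~R.
  have dE : (`|denq q|%N)%:R = (denq q)%:~R :> rat by rewrite [LHS]pmulrn absz_denq.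
  by rewrite natrM dE -mulrA (mulrC _ q) -numqE rmorphM.
by rewrite numq_int.
Qed.

Definition clear_denoms (A : zmodType) (M : nat) (s : seq (A * rat)) : A :=
  \sum_(ab <- s) ab.1 *~ clear_denom M ab.2.

(** A derivation uses finitely many relations, and only additivity in the rational factor asks
    anything of [M]: to be divisible by the two denominators. A product of the moduli met on the way
    is enough. *)
Lemma tensor_rel_clear_denoms (A : zmodType) (s t : seq (A * rat)) :
  tensor_rel s t ->
  exists N, (0 < N)%N /\
    forall M, (N %| M)%N -> clear_denoms M s = clear_denoms M t.
Proof.
rewrite /clear_denoms; elim=> {s t}.
- by move=> s; exists 1%N.
- by move=> s t _ [N [N0 h]]; exists N; split=> // M /h.
- move=> s t u _ [N [N0 h]] _ [N' [N'0 h']]; exists (N * N')%N.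
  rewrite muln_gt0 N0; split=> // M NM.
  have d1 : (N %| M)%N := dvdn_trans (dvdn_mulr N' (dvdnn N)) NM.
  have d2 : (N' %| M)%N := dvdn_trans (dvdn_mull N (dvdnn N')) NM.
  by rewrite h ?h'.
- move=> s s' t t' _ [N [N0 h]] _ [N' [N'0 h']]; exists (N * N')%N.
  rewrite muln_gt0 N0; split=> // M NM.
  have d1 : (N %| M)%N := dvdn_trans (dvdn_mulr N' (dvdnn N)) NM.
  have d2 : (N' %| M)%N := dvdn_trans (dvdn_mull N (dvdnn N')) NM.
  by rewrite !big_cat /= h ?h'.
- by move=> s t; exists 1%N; split=> // M _; rewrite !big_cat /= addrC.
- move=> a a' b; exists 1%N; split=> // M _.
  by rewrite !big_cons !big_nil /= !addr0 mulrzDl.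
- move=> a b b'; exists (`|denq b| * `|denq b'|)%N.
  rewrite muln_gt0 !absz_gt0 !denq_eq0; split=> // M NM.
  rewrite !big_cons !big_nil /= !addr0 -mulrzDr; congr (_ *~ _).
  have d1 : (`|denq b|%N %| M)%N := dvdn_trans (dvdn_mulr _ (dvdnn _)) NM.
  have d2 : (`|denq b'|%N %| M)%N := dvdn_trans (dvdn_mull _ (dvdnn _)) NM.
  by rewrite /clear_denom mulrDr -!clear_denomP // -rmorphD /= !numq_int.
- move=> b; exists 1%N; split=> // M _.
  by rewrite !big_cons !big_nil /= addr0 mul0rz.
- move=> a; exists 1%N; split=> // M _.
  by rewrite !big_cons !big_nil /= addr0 /clear_denom mulr0 (numq_int 0) mulr0z.
Qed.

Lemma clear_denom1 M : clear_denom M 1 = M.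
Proof. by rewrite /clear_denom mulr1 -[M%:R]/((M%:Z)%:~R) numq_int. Qed.

Context (A B : zmodType) (f : {additive A -> B}).

(** The symbol [(a, 1)] is sent to zero, hence is zero, and clearing denominators turns this into
    [a *+ N = 0]. *)
Lemma tensor_injective_kernel a : injective (tensor_map rat f) -> f a = 0 ->
  exists N, (0 < N)%N /\ a *+ N = 0.
Proof.
move=> inj fa0.
have /tensor_eqP/tensor_rel_clear_denoms[N [N0 h]] :
    \pi_(tensor A rat) [:: (a, 1)] = \pi_(tensor A rat) [::].
  apply: inj; rewrite !tensor_map_pi /= fa0.
  exact/tensor_eqP/tensor_0l.
exists N; split=> //; have := h N (dvdnn N).
by rewrite /clear_denoms big_seq1 big_nil clear_denom1.
Qed.

(** Clearing the denominators of a preimage of the symbol [(b, 1)] yields an honest element of [A]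
    mapping to a multiple of [b]. *)
Lemma tensor_surjective_image b : (forall y, exists x, tensor_map rat f x = y) ->
  exists N, (0 < N)%N /\ exists a, f a = b *+ N.
Proof.
move=> /(_ (\pi_(tensor B rat) [:: (b, 1)]))[x].
elim/tensor_ind: x => s; rewrite tensor_map_pi.
move=> /tensor_eqP/tensor_rel_clear_denoms[N [N0 h]].
exists N; split=> //; exists (clear_denoms N s); have := h N (dvdnn N).
rewrite /clear_denoms big_seq1 clear_denom1 /= => h1.
rewrite -[RHS]/(b *~ N%:Z) -h1 raddf_sum /tensor_map_seq big_map; apply: eq_bigr => ab _ /=.
exact: raddfMz.
Qed.

End tensor_rational.

Section torsion.
Context (A : zmodType).

Definition subgroup (H : A -> Prop) :=
  [/\ H 0, forall x y, H x -> H y -> H (x + y) & forall x, H x -> H (- x)].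

Lemma subgroupB H x y : subgroup H -> H x -> H y -> H (x - y).
Proof. by move=> [_ HD HN] Hx Hy; apply: HD => //; exact: HN. Qed.

Lemma subgroupMn H x n : subgroup H -> H x -> H (x *+ n).
Proof.
by move=> [H0 HD HN] Hx; elim: n => [|n IH]; rewrite ?mulr0n // mulrS; exact: HD.
Qed.

Lemma subgroupMz H x m : subgroup H -> H x -> H (x *~ m).
Proof.
move=> sH Hx; case: m => m; first exact: subgroupMn.
by case: (sH) => _ _ HN; rewrite NegzE mulrNz; apply: HN; exact: subgroupMn.
Qed.

Lemma bounded_sequence_repeats N (g : nat -> nat) : (forall i, (g i < N)%N) ->
  exists i j, (i < j)%N /\ g i = g j.
Proof.
move=> gN; apply: contrapT => /forallNP h.
have ginj : {in iota 0 N.+1 &, injective g}.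
  move=> i j _ _ gij; apply: contrapT => /eqP; rewrite neq_ltn => /orP[] ij.
    by have /forallNP/(_ j) := h i; apply.
  by have /forallNP/(_ i) := h j; apply; split.
have u : uniq [seq g i | i <- iota 0 N.+1].
  by rewrite map_inj_in_uniq // iota_uniq.
have sub : {subset [seq g i | i <- iota 0 N.+1] <= iota 0 N}.
  by move=> _ /mapP[i _ ->]; rewrite mem_iota /=.
by have := uniq_leq_size u sub; rewrite size_map !size_iota ltnn.
Qed.

(* The torsion of a finitely generated abelian group is finite, in a form
   relative to a subgroup [H] that makes induction on generators possible. *)
Lemma torsion_repeats (s : seq A) (H : A -> Prop) : subgroup H ->
  (forall K, subgroup K -> (forall x, H x -> K x) ->
     (forall x, x \in s -> K x) -> forall x, K x) ->
  forall a : nat -> A,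
    (forall i, exists N, (0 < N)%N /\ H (a i *+ N)) ->
    exists i j, (i < j)%N /\ H (a i - a j).
Proof.
elim: s H => [|x s IH] H sH gH a aH.
  by exists 0%N, 1%N; split=> //; exact: (gH H).
have [H0 HD HN] := sH.
(* Relative to the subgroup generated by [H] and [x] the shorter list still generates, so induction
   yields a subsequence with all differences in it. *)
pose H' y := exists m : int, H (y - x *~ m).
have HH' y : H y -> H' y by exists 0; rewrite mulr0z subr0.
have sH' : subgroup H'.
  split; first exact: HH'.
  - move=> y z [m Hm] [k Hk]; exists (m + k).
    by rewrite mulrzDr opprD addrACA; exact: HD.
  - by move=> y [m Hm]; exists (- m); rewrite mulrNz -opprB opprK addrC opprB
      -opprB; apply: HN; rewrite addrC in Hm *.
have gH' K : subgroup K -> (forall y, H' y -> K y) ->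
    (forall y, y \in s -> K y) -> forall y, K y.
  move=> sK HK sKs; apply: gH => // [y /HH'/HK//|y].
  rewrite inE => /orP[/eqP ->|/sKs//].
  by apply: HK; exists 1; rewrite mulr1z subrr.
have [phi [phiI phiH]] : exists phi : nat -> nat, {homo phi : i j / (i < j)%N} /\
    forall i j, H' (a (phi i) - a (phi j)).
  apply: (@pigeonhole A (fun y => exists N, (0 < N)%N /\ H (y *+ N))
    (fun y z => H' (y - z))) => //.
  - by move=> y z hyz; rewrite -opprB; case: sH' => _ _; exact.
  - move=> y z t h1 h2; rewrite -(subrK z y) -addrA.
    by case: sH' => _ hD _; exact: hD.
  - move=> c cH; apply: (IH H' sH' gH') => i.
    by have [N [N0 hN]] := cH i; exists N; split=> //; exact: HH'.
have /choice[m hm] i : exists m : int, H (a (phi i) - a (phi 0%N) - x *~ m).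
  exact: phiH.
have hmB i j : H (a (phi i) - a (phi j) - x *~ (m i - m j)).
  have := subgroupB sH (hm i) (hm j).
  by rewrite mulrzBr opprD addrACA -opprD opprB addrA subrK.
(* If [x] has finite order [N] modulo [H], two of the coefficients [m i] agree modulo [N]. If it has
   infinite order, a difference congruent to [x *~ k] can only be torsion for [k = 0]. *)
have [[N [N0 xN]]|xN] := pselect (exists N, (0 < N)%N /\ H (x *+ N)).
  have gN i : (`|(m i %% N)%Z|%N < N)%N.
    rewrite -ltz_nat gez0_abs ?modz_ge0 ?ltz_pmod //.
    by rewrite -lt0n.
  have [i [j [ij gij]]] := bounded_sequence_repeats gN.
  exists (phi i), (phi j); split; first exact: phiI.
  have NZ : (N%:Z != 0) by rewrite -lt0n.
  have E : (m i %% N)%Z = (m j %% N)%Z.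
    by rewrite -[LHS]gez0_abs ?modz_ge0 // gij gez0_abs ?modz_ge0.
  have HN' : H (x *~ (m i - m j)).
    rewrite (divz_eq (m i) N) (divz_eq (m j) N) E opprD addrACA subrr addr0.
    rewrite -mulrBl mulrC mulrzA -pmulrn; exact: subgroupMz.
  by have := HD _ _ (hmB i j) HN'; rewrite subrK.
exists (phi 0%N), (phi 1%N); split; first exact: phiI.
have [N [N0 hN]] : exists N, (0 < N)%N /\ H ((a (phi 0%N) - a (phi 1%N)) *+ N).
  have [N1 [N10 h1]] := aH (phi 0%N); have [N2 [N20 h2]] := aH (phi 1%N).
  exists (N1 * N2)%N; rewrite muln_gt0 N10; split=> //.
  rewrite mulrnBl; apply: subgroupB => //; first by rewrite mulrnA; exact: subgroupMn.
  by rewrite mulnC mulrnA; exact: subgroupMn.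
have h := hmB 0%N 1%N; move: h; move: (m 0%N - m 1%N) => k h.
have [k0|k0] := eqVneq k 0; first by move: h; rewrite k0 mulr0z subr0.
case: xN; exists (`|k| * N)%N; rewrite muln_gt0 absz_gt0 k0; split=> //.
have hk : H ((x *~ k) *+ N).
  have := subgroupB sH hN (subgroupMn N sH h).
  by rewrite -mulrnBl opprB addrC subrK.
rewrite mulrnA; case: (intP k) hk => [|n|n] //=.
by rewrite mulrNz mulNrn => /HN; rewrite opprK.
Qed.

End torsion.

(** * Finiteness of the homotopy groups of the fiber *)

Section finite_fiber.
Context (R : realType) (Y W : ptopologicalType) (f : pointed_map Y W).
Local Notation F := (fiber R f).

(** Bridge from the group structure, in which finite generation is stated, to the additive one: both
    have [hg_mul ord0] as operation. *)
Lemma homotopy_group_generated n (Z : ptopologicalType) (H : homotopy_group R n.+2 Z -> Prop) :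
  finitely_generated (homotopy_group R n.+2 Z) -> subgroup H ->
  forall a : nat -> homotopy_group R n.+2 Z,
    (forall i, exists N, (0 < N)%N /\ H (a i *+ N)) ->
    exists i j, (i < j)%N /\ H (a i - a j).
Proof.
move=> [s hs] sH a aH; apply: (torsion_repeats (s := s) sH _ aH).
move=> K [K0 KD KN] _ Ks x.
suff -> : K = setT by [].
by apply: hs.
Qed.

Lemma homotopy_kernel_repeats n (a : nat -> homotopy_group R n.+2 Y) :
  finitely_generated (homotopy_group R n.+2 Y) -> rational_equivalence R f ->
  (forall i, homotopy_group_map R n.+2 f (a i) = hg_one R n.+2 W) ->
  exists i j, (i < j)%N /\ a i = a j.
Proof.
move=> fg /(_ n) req ha.
have [||i [j [ij /eqP]]] := @homotopy_group_generated n Y (fun x => x = 0) fg _ a.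
- by split=> // [x y -> ->|x ->]; rewrite ?addr0 ?oppr0.
- by move=> i; apply: tensor_injective_kernel (bij_inj req) _; exact: ha.
- by rewrite subr_eq0 => /eqP; exists i, j.
Qed.

(** Rational surjectivity makes every class torsion modulo the image of [f], so the torsion count is
    applied relative to that image. *)
Lemma homotopy_image_repeats n (a : nat -> homotopy_group R n.+2 W) :
  finitely_generated (homotopy_group R n.+2 W) -> rational_equivalence R f ->
  exists i j, (i < j)%N /\
    exists c, a i = hg_mul ord0 (homotopy_group_map R n.+2 f c) (a j).
Proof.
move=> fg /(_ n) req.
have [||i [j [ij [c hc]]]] := @homotopy_group_generated n W
    (fun y => exists x, homotopy_group_map R n.+2 f x = y) fg _ a.
- split=> [|y z [x <-] [x' <-]|y [x <-]].
  + by exists 0; rewrite raddf0.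
  + by exists (x + x'); rewrite raddfD.
  + by exists (- x); rewrite raddfN.
- move=> i; apply: tensor_surjective_image => y.
  by case: req => g _ gK; exists (g y).
- exists i, j; split=> //; exists c; rewrite hc.
  by rewrite -[RHS]/(a i - a j + a j) subrK.
Qed.

(** Path-connectedness of [Y] makes both classes come from the fundamental group of [W], which is
    trivial. *)
Lemma fiber_pi0 (a b : homotopy_group R 0 F) :
  path_connected R Y -> simply_connected R W -> a = b.
Proof.
move=> pcY [_ scW]; elim/hg_ind: a => u; elim/hg_ind: b => u'.
have E (w : nloop R 0 F) : homotopy_group_map R 0 (fiber_proj R f)
    (\pi_(homotopy_group R 0 F) w) = hg_one R 0 Y.
  rewrite homotopy_group_map_pi; apply/homotopy_group_eqP.
  have [p [cp p0 p1]] := pcY (fiber_start (w 0)) point.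
  exists (fun z => p z.1); split => /=.
  - apply: (within_comp (f := fst) _ cp) => [|z []//].
    exact/continuous_subspaceT/continuous_fst.
  - by move=> x _; rewrite p0; congr (fiber_start (w _));
      apply/rowP => -[].
  - by move=> x _; rewrite p1.
  - by move=> t x _ [_ [[]]].
have [v [w [vw uw]]] := fiber_proj_exact (E u).
have [v' [w' [v'w' uw']]] := fiber_proj_exact (E u').
apply/homotopy_group_eqP; apply: homotopic_rel_trans uw _.
  exact: cube_boundary_sub.
apply: homotopic_rel_trans (homotopic_rel_sym _ uw'); try exact: cube_boundary_sub.
apply: connects_homotopic vw v'w' _; apply/homotopy_group_eqP.
by rewrite (scW (\pi_(homotopy_group R 1 W) v)) (scW (\pi_(homotopy_group R 1 W) v')).
Qed.

Lemma fiber_homotopy_repeats n (a : nat -> homotopy_group R n F) :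
  finite_type_target R Y -> simply_connected R Y ->
  finite_type_target R W -> simply_connected R W ->
  rational_equivalence R f ->
  exists i j, (i < j)%N /\ a i = a j.
Proof.
move=> [pcY fgY] [_ scY] [_ fgW] scW req.
case: n a => [|n] a; first by exists 0%N, 1%N; split=> //; exact: fiber_pi0.
pose p := homotopy_group_map R n.+1 (fiber_proj R f).
have [phi [phiI phiE]] : exists phi : nat -> nat, {homo phi : i j / (i < j)%N} /\
    forall i j, p (a (phi i)) = p (a (phi j)).
  apply: (@pigeonhole _ (fun=> True) (fun x y => p x = p y)) => //.
    by move=> x y z -> .
  move=> s _; case: n @p a s => [|n] p a s.
    by exists 0%N, 1%N; split=> //; rewrite (scY (p _)) (scY (p _)).
  apply: (@homotopy_kernel_repeats n (p \o s)) => // i.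
  exact: fiber_proj_kernel.
(* All [a (phi i)] have the same image in [Y], so these quotients die there and come from the
   connecting map. *)
pose d i := hg_mul ord0 (a (phi i)) (hg_inv ord0 (a (phi 0%N))).
have dp i : p (d i) = hg_one R n.+1 Y.
  rewrite /p /d homotopy_group_mapM -/p (phiE i 0%N).
  rewrite /p -homotopy_group_mapM hg_mulV homotopy_group_map_pi.
  apply/homotopy_group_eqP; apply: homotopic_rel_refl.
  exact: (nloop_continuous (nloop_cst R n.+1 Y)).
have /choice[v hv] i : exists v : nloop R n.+2 W,
    exists u : nloop R n.+1 F, connects v u /\ d i = \pi_(homotopy_group R n.+1 F) u.
  have := dp i; elim/hg_ind: (d i) => u /fiber_proj_exact[v [u' [vu' uu']]].
  by exists v, u'; split=> //; apply/homotopy_group_eqP.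
have [i [j [ij [c]]]] := @homotopy_image_repeats n
  (fun i => \pi_(homotopy_group R n.+2 W) (v i)) (fgW n.+1) req.
elim/hg_ind: c => c; rewrite homotopy_group_map_pi hg_mul_pi.
move=> /homotopy_group_eqP vij.
exists (phi i), (phi j); split; first exact: phiI.
suff dij : d i = d j.
  have := congr1 (fun x => hg_mul ord0 x (a (phi 0%N))) dij.
  by rewrite /d -!hg_mulA hg_mulN !hg_mul1.
have [u [vu ->]] := hv i; have [u' [vu' ->]] := hv j.
have [w ww] := connects_exists f (nloop_cat ord0 (nloop_post f c) (v j)).
apply/homotopy_group_eqP; apply: homotopic_rel_trans.
- exact: cube_boundary_sub.
- exact: (connects_homotopic vu ww vij).
- exact: connects_image ww vu'.
Qed.

Lemma finitely_many_cell_lifts n (k : 'rV[R]_n -> W) (b : 'rV[R]_n -> path_space R f) :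
  finite_type_target R Y -> simply_connected R Y ->
  finite_type_target R W -> simply_connected R W ->
  rational_equivalence R f ->
  {within body (disc_gauge R n), continuous k} ->
  finitely_many_sections R (body (disc_gauge R n)) (lift_rel (disc_gauge R n) k b).
Proof.
move=> fY sY fW sW req ck; apply: finitely_many_lifts_const => //.
  by case: fY.
by apply: finitely_many_disc_lifts => s; exact: fiber_homotopy_repeats.
Qed.

End finite_fiber.

(** * Lifts on cell complexes *)

Section compact_image.

Lemma hausdorff_prod (T U : topologicalType) :
  hausdorff_space T -> hausdorff_space U -> hausdorff_space (T * U)%type.
Proof.
move=> hT hU [p1 p2] [q1 q2] h; congr (_, _).
- apply: hT => A B pA qB; have [] := h (A `*` setT) (B `*` setT).
  + by exists (A, setT) => //; split=> //; exact: filterT.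
  + by exists (B, setT) => //; split=> //; exact: filterT.
  + by move=> [x y] [[Ax _] [Bx _]]; exists x.
- apply: hU => A B pA qB; have [] := h (setT `*` A) (setT `*` B).
  + by exists (setT, A) => //; split=> //; exact: filterT.
  + by exists (setT, B) => //; split=> //; exact: filterT.
  + by move=> [x y] [[_ Ay] [_ By]]; exists y.
Qed.

Context (T W U : topologicalType) (C : set T) (q : T -> W) (F : W -> U).
Hypotheses (hW : hausdorff_space W) (cC : compact C).
Hypothesis cq : {within C, continuous q}.

Lemma compact_image_closed : closed (q @` C).
Proof. by apply: compact_closed => //; exact: continuous_compact. Qed.

(** A map from a compact set to a Hausdorff space is closed, so closedness on the image may be
    tested after pulling back to [C]. *)
Lemma closed_compact_image_preimage (V : set U) :
  {within C, continuous (F \o q)} -> closed V ->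
  closed ((F @^-1` V) `&` q @` C).
Proof.
move=> /continuous_closedP cF cV.
have /closed_subspaceP[D cD DC] := cF _ cV.
have -> : F @^-1` V `&` q @` C = q @` (C `&` D).
  apply/seteqP; split=> [y [/= Vy [c Cc cy]]|_ [c [Cc Dc] <-]].
    rewrite -cy in Vy *; exists c => //; split=> //.
    by have : ((F \o q) @^-1` V `&` C) c by []; rewrite -DC => -[].
  split; last by exists c.
  by have : (D `&` C) c by []; rewrite DC => -[].
apply: compact_closed => //; apply: continuous_compact.
  by apply: within_sub cq => c [].
exact: compact_closedI.
Qed.

Lemma within_compact_image :
  {within C, continuous (F \o q)} -> {within q @` C, continuous F}.
Proof.
move=> cF; apply/continuous_closedP => V cV.
apply/closed_subspaceP; exists (F @^-1` V `&` q @` C).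
  exact: closed_compact_image_preimage.
by rewrite -setIA setIid.
Qed.

End compact_image.

Lemma disc_compact (R : realType) n : compact (@disc R n).
Proof.
have -> : @disc R n = [set x : 'rV[R]_n | forall j : 'I_n, `[(-1 : R), 1]%classic (x ord0 j)] `&`
    @disc R n.
  apply/seteqP; split=> [x xd|x []//]; split=> // j.
  rewrite /= in_itv /=; have : x ord0 j ^+ 2 <= 1.
    apply: le_trans xd; rewrite (bigD1 j) //= lerDl.
    by apply: sumr_ge0 => k _; exact: sqr_ge0.
  by move=> h; apply/andP; split; nra.
apply: compact_closedI.
  by apply: (@rV_compact R n (fun=> `[(-1 : R), 1]%classic)) => j; exact: segment_compact.
by rewrite -body_disc; exact: closed_body.
Qed.

(** * Attaching one cell *)

Section attach.
Context (R : realType) (X Y W : ptopologicalType) (f : pointed_map Y W).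
Context (h : X -> W) (ch : continuous h) (hX : hausdorff_space X).
Local Notation E := (path_space R f).
Local Notation ps0 := (ps_point R f).

Definition map_lift (x : X) : set E :=
  [set v | ps_end v = h x /\ (x = point -> v = ps0)].

(** Only the new endpoint [s'] has to restrict to [s0] exactly; the homotopy over [A'] is not asked
    to extend the one over [A]. This is the form used to rectify lifts. *)
Definition homotopy_extending (A A' : set X) :=
  forall s s0 : X -> E, sect A' map_lift s -> sect A map_lift s0 ->
    sect_homotopic R A map_lift s s0 ->
    exists s' : X -> E, [/\ sect A' map_lift s', forall x, A x -> s' x = s0 x &
      sect_homotopic R A' map_lift s s'].

Definition finitely_extending (A A' : set X) :=
  finitely_many_sections R A map_lift -> finitely_many_sections R A' map_lift.

(* The properties of an inclusion that pass from single cell attachments to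
   composites of attachments. *)
Definition good_pair (A A' : set X) := A point -> closed A ->
  [/\ A `<=` A', closed A', homotopy_extending A A' & finitely_extending A A'].

Lemma good_pair_refl A : good_pair A A.
Proof.
move=> Ap cA; split=> // s s0 sA s0A ss0; exists s0; split=> //.
Qed.

Lemma good_pair_trans A1 A2 A3 :
  good_pair A1 A2 -> good_pair A2 A3 -> good_pair A1 A3.
Proof.
move=> g12 g23 A1p cA1; have [s12 cA2 h12 f12] := g12 A1p cA1.
have [s23 cA3 h23 f23] := g23 (s12 _ A1p) cA2; split=> //.
- exact: subset_trans s23.
- move=> s s0 sA3 s0A1 ss0.
  have [s1 [s1A2 s10 ss1]] := h12 _ _ (sect_sub s23 sA3) s0A1 ss0.
  have [s2 [s2A3 s21 ss2]] := h23 _ _ sA3 s1A2 ss1.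
  by exists s2; split=> // x A1x; rewrite s21 ?s10 //; exact: s12.
- by move=> /f12/f23.
Qed.

Context (n : nat) (chi : 'rV[R]_n -> X) (A : set X).
Hypotheses (cA : closed A) (Ap : A point).
Hypothesis cchi : {within @disc R n, continuous chi}.
Hypothesis ichi : set_inj (@open_disc R n) chi.
Hypothesis sA : chi @` @sphere R n `<=` A.
Hypothesis oA : forall x, open_disc x -> ~ A (chi x).

Local Notation A' := (A `|` chi @` @disc R n).

Lemma disc_cases (x : 'rV[R]_n) : disc x -> open_disc x \/ sphere x.
Proof.
by rewrite /disc /open_disc /sphere /= le_eqVlt => /orP[/eqP|]; [right|left].
Qed.

Lemma open_disc_sub (x : 'rV[R]_n) : open_disc x -> disc x.
Proof. by rewrite /disc /open_disc /= => /ltW. Qed.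

Lemma closed_attach : closed A'.
Proof.
apply: closedU => //; apply: compact_image_closed => //; exact: disc_compact.
Qed.

(** The cylinder over [A'] is the union of two closed pieces, and on the cell continuity descends
    from the disc because the cylinder over the disc is compact. *)
Lemma cell_glue (SA : R * X -> E) (T : R * 'rV[R]_n -> E) :
  {within `[0, 1] `*` A, continuous SA} ->
  {within `[0, 1] `*` @disc R n, continuous T} ->
  (forall t x, 0 <= t <= 1 -> sphere x -> T (t, x) = SA (t, chi x)) ->
  exists S : R * X -> E,
    [/\ {within `[0, 1] `*` A', continuous S},
        forall t x, A x -> S (t, x) = SA (t, x) &
        forall t x, 0 <= t <= 1 -> disc x -> S (t, chi x) = T (t, x)].
Proof.
move=> cSA cT TSA.
(* Preimages are taken in the open disc, where [chi] is injective; 0 is a junk default. The image of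
   the sphere lies in [A], where [SA] decides. *)
pose inv y := xget 0 [set x | open_disc x /\ chi x = y].
have invK x : open_disc x -> inv (chi x) = x.
  move=> xo; rewrite /inv; case: xgetP => [z _ [zo zx]|/(_ x)[]//].
  by apply: ichi; rewrite ?inE.
pose S z := if `[< A z.2 >] then SA z else T (z.1, inv z.2).
have SE t x : A x -> S (t, x) = SA (t, x) by move=> Ax; rewrite /S asboolT.
have ST t x : 0 <= t <= 1 -> disc x -> S (t, chi x) = T (t, x).
  move=> tI /disc_cases[xo|xs].
    by rewrite /S asboolF /= ?invK //; exact: oA.
  by rewrite SE ?TSA //; apply: sA; exists x.
exists S; split=> //.
pose q (z : R * 'rV[R]_n) := (z.1, chi z.2).
have cq : {within `[0, 1] `*` @disc R n, continuous q}.
  apply: within_pair; first exact/continuous_subspaceT/continuous_fst.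
  apply: (within_comp (f := snd) _ cchi) => [|z []//].
  exact/continuous_subspaceT/continuous_snd.
have cID : compact ([set` `[(0 : R), 1]] `*` @disc R n).
  by apply: compact_setX; [exact: segment_compact|exact: disc_compact].
have hRX : hausdorff_space (R * X)%type.
  by apply: hausdorff_prod => //; exact: Rhausdorff.
have -> : [set` `[(0 : R), 1]] `*` A' =
    ([set` `[(0 : R), 1]] `*` A) `|` q @` ([set` `[(0 : R), 1]] `*` @disc R n).
  apply/seteqP; split=> [[t y] [/= tI [Ay|[x xd <-]]]|[t y] [[tI Ay]|]].
  - by left.
  - by right; exists (t, x).
  - by split=> //; left.
  - by move=> [[t' x] [tI xd] [<- <-]]; split=> //; right; exists x.
apply: withinU_continuous.
- apply: closedI.
    apply: (@closed_continuous_preimage _ _ _ [set` `[(0 : R), 1]]).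
      exact: continuous_fst.
    exact: itv_closed.
  apply: (@closed_continuous_preimage _ _ _ A) => //.
  exact: continuous_snd.
- exact: compact_image_closed.
- by apply: (within_eq _ cSA) => -[t y] [_ Ay]; rewrite SE.
- apply: within_compact_image => //.
  apply: (within_eq _ cT) => -[t x] [/= tI xd].
  by rewrite ST.
Qed.

Lemma within_slice (U V : topologicalType) (B : set U) (H : R * U -> V) t :
  0 <= t <= 1 -> {within `[0, 1] `*` B, continuous H} ->
  {within B, continuous (fun x => H (t, x))}.
Proof.
move=> tI cH; apply: (within_comp (f := fun x => (t, x)) _ cH).
  apply/continuous_subspaceT/continuous_pair; last exact: continuous_idfun.
  exact: cst_continuous.
by move=> x Bx; split; rewrite //= in_itv.
Qed.

(** Over the disc [s] gives the base and the homotopy on [A] gives the wall. The missing part is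
    lifted over [h] composed with [chi], held constant in time. *)
Lemma homotopy_extending_attach : homotopy_extending A A'.
Proof.
move=> s s0 [cs sQ] [cs0 s0Q] [SA [cSA SA0 SA1 SAQ]].
have cdisc (V : topologicalType) (g : X -> V) : {within A', continuous g} ->
    {within @disc R n, continuous (g \o chi)}.
  by move=> cg; apply: (within_comp cchi cg) => x xd; right; exists x.
have chiA x : sphere x -> A (chi x) by move=> xs; apply: sA; exists x.
have [||||||T [cT T0 Tb TE]] := @jar_lift R _ (disc_gauge R n) Y W f
  (fun z => h (chi z.2)) (s \o chi) (fun z => SA (z.1, chi z.2)).
- apply: (within_comp (f := fun z : R * 'rV[R]_n => chi z.2) _
    (continuous_subspaceT (A := setT) ch)) => //.
  rewrite body_disc; apply: (within_comp (f := snd) _ cchi) => [|z []//].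
  exact/continuous_subspaceT/continuous_snd.
- by rewrite body_disc; exact: cdisc.
- rewrite bdry_disc.
  apply: (within_comp (f := fun z : R * 'rV[R]_n => (z.1, chi z.2)) _ cSA).
    apply: within_pair; first exact/continuous_subspaceT/continuous_fst.
    apply: (within_comp (f := snd) _ cchi) => [|z [_ zs]].
      exact/continuous_subspaceT/continuous_snd.
    by rewrite /disc /= zs.
  by move=> z [zI zs]; split=> //; exact: chiA.
- by rewrite bdry_disc => x xs /=; rewrite SA0 //; exact: chiA.
- rewrite body_disc => x xd /=.
  by have [] := sQ (chi x); first by right; exists x.
- rewrite bdry_disc => t x tI xs /=.
  by have [] := SAQ t (chi x) tI (chiA _ xs).
rewrite body_disc bdry_disc in cT T0 Tb TE.
have [S [cS SSA ST]] := cell_glue cSA cT Tb.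
have SQ t x : 0 <= t <= 1 -> A' x -> map_lift x (S (t, x)).
  move=> tI [Ax|[z zd <-]]; first by rewrite SSA //; exact: SAQ.
  split; first by rewrite ST // TE.
  move=> zp; have Az : A (chi z) by rewrite zp.
  by rewrite SSA //; have [_] := SAQ t _ tI Az; apply.
have I1 : 0 <= (1 : R) <= 1 by rewrite lexx ler01.
exists (fun x => S (1, x)); split.
- by split; [exact: (within_slice I1 cS)|move=> x A'x; exact: SQ].
- by move=> x Ax; rewrite SSA // SA1.
- exists S; split=> // x [Ax|[z zd <-]]; first by rewrite SSA // SA0.
  by rewrite ST ?lexx ?ler01 // T0.
Qed.

(** A subsequence has all its restrictions to [A] homotopic; homotopy extension makes them equal.
    The lifts then differ only on the cell, with common boundary values, and finiteness for one cell
    applies. *)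
Lemma finitely_extending_attach :
  (forall (k : 'rV[R]_n -> W) (b : 'rV[R]_n -> E), {within body (disc_gauge R n), continuous k} ->
    finitely_many_sections R (body (disc_gauge R n)) (lift_rel (disc_gauge R n) k b)) ->
  finitely_extending A A'.
Proof.
move=> fin finA s sP.
have AA' : A `<=` A' by move=> x; left.
have [phi [phiI phiE]] := @pigeonhole _ (sect A map_lift)
  (sect_homotopic R A map_lift) (@sect_homotopic_sym R _ _ _ _)
  (@sect_homotopic_trans R _ _ _ _) finA s (fun i => sect_sub AA' (sP i)).
have /choice[u hu] i : exists s' : X -> E, [/\ sect A' map_lift s',
    forall x, A x -> s' x = s (phi 0%N) x &
    sect_homotopic R A' map_lift (s (phi i)) s'].
  by apply: homotopy_extending_attach => //; exact: (sect_sub AA' (sP _)).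
have cdisc (V : topologicalType) (g : X -> V) : {within A', continuous g} ->
    {within @disc R n, continuous (g \o chi)}.
  by move=> cg; apply: (within_comp cchi cg) => x xd; right; exists x.
have chiA x : sphere x -> A (chi x) by move=> xs; apply: sA; exists x.
have := @fin (h \o chi) (s (phi 0%N) \o chi) _ (fun i => u i \o chi).
rewrite body_disc => -[|i|i [j [ij [T [cT T0 T1 TQ]]]]].
- exact/cdisc/continuous_subspaceT.
- have [[cu uQ] us _] := hu i; split; first exact: cdisc.
  move=> x xd; split; first by have [] := uQ (chi x); first by right; exists x.
  by rewrite bdry_disc => xs /=; rewrite us //; exact: chiA.
have [[cui uiQ] uis hui] := hu i; have [[cuj ujQ] ujs huj] := hu j.
exists (phi i), (phi j); split; first exact: phiI.
apply: sect_homotopic_trans hui _.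
apply: sect_homotopic_trans _ (sect_homotopic_sym huj).
have cSA : {within `[0, 1] `*` A, continuous (fun z : R * X => u i z.2)}.
  apply: (within_comp (f := snd) _ cui) => [|z [_ Az]]; last by left.
  exact/continuous_subspaceT/continuous_snd.
have [|S [cS SSA ST]] := cell_glue cSA cT.
  move=> t x tI xs /=; have xd : disc x by rewrite /disc /= xs.
  have [_] := TQ t x tI xd; rewrite bdry_disc => -> //=.
  by rewrite uis //; exact: chiA.
exists S; split=> //.
- move=> x [Ax|[z zd <-]]; first by rewrite SSA.
  by rewrite ST ?lexx ?ler01 // T0.
- move=> x [Ax|[z zd <-]]; first by rewrite SSA //= uis ?ujs.
  by rewrite ST ?lexx ?ler01 // T1.
- move=> t x tI [Ax|[z zd <-]]; first by rewrite SSA //=; apply: uiQ; left.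
  split; first by rewrite ST //; have [] := TQ t z tI zd.
  move=> zp; have Az : A (chi z) by rewrite zp.
  by rewrite SSA //=; have [_] := uiQ (chi z) (or_introl Az); apply.
Qed.

End attach.

Lemma finite_set_index (T : Type) : finite_set [set: T] ->
  exists (idx : T -> nat) k, injective idx /\ forall c, (idx c < k)%N.
Proof.
move=> [k /card_set_bijP[idx [idxk idxI _]]]; exists idx, k; split.
  by move=> c d cd; apply: idxI; rewrite ?inE.
by move=> c; exact: idxk.
Qed.

(** * Passage from one skeleton to the next *)

Section skeleta.
Context (R : realType) (X Y W : ptopologicalType) (K : cw_complex R X).
Context (f : pointed_map Y W) (h : X -> W) (ch : continuous h).
Local Notation E := (path_space R f).
Local Notation open_cell := (cw_open_cell (c := K)).

(* Cells of dimension less than [m], so that [pskel 0] is the basepoint and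
   [pskel m.+1] the [m]-skeleton. *)
Definition pskel (m : nat) : set X :=
  [set x | x = point \/ exists e, (projT1 e < m)%N /\ open_cell e x].

Lemma open_cell_unique e e' x : open_cell e x -> open_cell e' x -> e = e'.
Proof.
move=> ex e'x; have [e0 [_ h0]] := cw_partition K x.
by rewrite -(h0 _ ex) -(h0 _ e'x).
Qed.

Lemma point_open_cell : exists i : cw_cell K 0, open_cell (existT _ 0%N i) point.
Proof.
have [i hi] := cw_basepoint K; exists i; exists 0 => //.
by rewrite /open_disc /= big_ord0.
Qed.

Lemma pskel_skeleton m : pskel m.+1 = skeleton K m.
Proof.
apply/seteqP; split=> x.
  case=> [->|[e [em ex]]]; last by exists e.
  by have [i hi] := point_open_cell; exists (existT _ 0%N i).
by move=> [e em ex]; right; exists e.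
Qed.

Lemma pskelS m x : pskel m x -> pskel m.+1 x.
Proof. by case=> [->|[e [em ex]]]; [left|right; exists e; split=> //; exact: ltnW]. Qed.

Lemma pskel_point m : pskel m point.
Proof. by left. Qed.

Lemma pskel_cell m (c : cw_cell K m) x : disc x -> pskel m.+1 (cw_char c x).
Proof.
move=> /disc_cases[xo|xs].
  by right; exists (existT _ m c); split=> //; exists x.
have [F [_ Fm sF]] := cw_closure_finite c.
have [e Fe ex] : (\bigcup_(e in F) open_cell e) (cw_char c x).
  by apply: sF; exists x.
by right; exists e; split=> //; apply: ltnW; exact: Fm.
Qed.

Lemma pskel_sphere m (c : cw_cell K m) : cw_char c @` @sphere R m `<=` pskel m.
Proof.
move=> y ys; have [F [_ Fm sF]] := cw_closure_finite c.
have [e Fe ex] := sF y ys.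
by right; exists e; split=> //; exact: Fm.
Qed.

Hypothesis cells_finite : forall m, finite_set [set: cw_cell K m].
Hypothesis cell_lifts : forall n (k : 'rV[R]_n -> W) (b : 'rV[R]_n -> E),
  {within body (disc_gauge R n), continuous k} ->
  finitely_many_sections R (body (disc_gauge R n)) (lift_rel (disc_gauge R n) k b).

Lemma pskel_good m : good_pair R f h (pskel m) (pskel m.+1).
Proof.
have [idx [k [idxI idxk]]] := finite_set_index (cells_finite m).
(* Cells of dimension [m] are attached one at a time in the order of [idx]; an index without a cell
   adds nothing. *)
pose B j := pskel m `|`
  [set x | exists c : cw_cell K m, (idx c < j)%N /\ open_cell (existT _ m c) x].
have B0 : B 0%N = pskel m.
  by apply/seteqP; split=> x; [case=> // -[c []]|left].
have Bk : B k = pskel m.+1.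
  apply/seteqP; split=> x.
    case=> [|[c [_ cx]]]; first exact: pskelS.
    by right; exists (existT _ m c).
  case=> [->|[[d c] [/=]]]; first by left; left.
  rewrite ltnS leq_eqVlt => /orP[/eqP dm cx|dm cx]; last first.
    by left; right; exists (existT _ d c).
  by move: c cx; rewrite dm => c cx; right; exists c; split.
have pB j : B j point by left; left.
suff step j : good_pair R f h (B j) (B j.+1).
  rewrite -B0 -Bk; elim: k {idxk Bk} => [|j IH]; first exact: good_pair_refl.
  exact: good_pair_trans (step j).
have BS (c : cw_cell K m) : idx c = j -> B j.+1 = B j `|` open_cell (existT _ m c).
  move=> cj; apply/seteqP; split=> x.
    case=> [|[d [dj dx]]]; first by left; left.
    move: dj; rewrite ltnS leq_eqVlt => /orP[/eqP dj|dj]; last first.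
      by left; right; exists d.
    by right; rewrite (idxI c d) // cj.
  case=> [[|[d [dj dx]]]|cx]; first by left.
    by right; exists d; split=> //; exact: ltnW.
  by right; exists c; rewrite cj.
have [[c cj]|nc] := pselect (exists c, idx c = j); last first.
  suff -> : B j.+1 = B j by exact: good_pair_refl.
  apply/seteqP; split=> x [|[d [dj dx]]]; try by left.
    move: dj; rewrite ltnS leq_eqVlt => /orP[/eqP dj|dj]; last by right; exists d.
    by case: nc; exists d.
  by right; exists d; split=> //; exact: ltnW.
rewrite (BS c cj).
(* The cell of the basepoint is a vertex already present in [pskel 0]; attaching it again would
   violate disjointness from [B j]. *)
have [cp|cp] := pselect (open_cell (existT _ m c) point).
  suff -> : B j `|` open_cell (existT _ m c) = B j by exact: good_pair_refl.
  apply/setUidPl => x cx; suff -> : x = point by [].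
  have [i hi] := point_open_cell.
  have e0 := open_cell_unique cp hi.
  move: cp cx; rewrite e0 => -[y _ <-] [z _ <-]; congr (cw_char _ _).
  by apply/rowP => -[].
move=> _ cB.
have -> : B j `|` open_cell (existT _ m c) = B j `|` cw_char c @` @disc R m.
  apply/seteqP; split=> x [|[z zd <-]]; try by left.
    by right; exists z => //; exact: open_disc_sub.
  case/disc_cases: zd => [zo|zs]; first by right; exists z.
  by left; left; apply: (@pskel_sphere m c); exists z.
have hX := cw_hausdorff K.
have sB : cw_char c @` @sphere R m `<=` B j by move=> x /pskel_sphere; left.
have oB x : open_disc x -> ~ B j (cw_char c x).
  move=> xo; have cx : open_cell (existT _ m c) (cw_char c x) by exists x.
  case=> [[xp|[e [em ex]]]|[d [dj dx]]].
  - by apply: cp; rewrite -xp.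
  - by move: em; rewrite -(open_cell_unique cx ex) /= ltnn.
  - have E0 := open_cell_unique cx dx.
    have cd : c = d := Eqdep_dec.inj_pair2_eq_dec _ PeanoNat.Nat.eq_dec _ _ _ _ E0.
    by move: dj; rewrite -cd cj ltnn.
have cc := @cw_continuous R X K m c; have ic := @cw_injective R X K m c.
split.
- by move=> x; left.
- exact: (closed_attach hX cB cc).
- exact: (homotopy_extending_attach ch hX cB (pB j) cc ic sB oB).
- exact: (finitely_extending_attach ch hX cB (pB j) cc ic sB oB (@cell_lifts m)).
Qed.

Lemma pskel_closed m : closed (pskel m).
Proof.
elim: m => [|m IH]; last by have [] := pskel_good (pskel_point m) IH.
have -> : pskel 0 = [set point].
  by apply/seteqP; split=> x; [case=> // -[e []]|left].
by apply/accessible_closed_set1/hausdorff_accessible/(cw_hausdorff K).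
Qed.

Lemma pskel_homotopy_extending m : homotopy_extending R f h (pskel m) (pskel m.+1).
Proof. by have [] := pskel_good (pskel_point m) (@pskel_closed m). Qed.

Lemma pskel_finitely_many m : finitely_many_sections R (pskel m) (map_lift (R := R) (f := f) h).
Proof.
elim: m => [|m IH].
  move=> s sP; exists 0%N, 1%N; split=> //.
  apply: sect_homotopic_eq => // x; case=> [xp|[e []]//].
  have [_ sQ0] := sP 0%N; have [_ sQ1] := sP 1%N.
  have xs : pskel 0 x by left.
  by have [_ ->] := sQ0 x xs => //; have [_ ->] := sQ1 x xs.
by have [_ _ _] := pskel_good (pskel_point m) (@pskel_closed m); apply.
Qed.

End skeleta.

(** * Phantom maps *)

(* König's lemma: an inverse limit of nonempty finite sets is nonempty. The
   n-th set is [P n] modulo [r n] and finiteness is again expressed through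
   sequences. *)
Lemma inverse_limit_nonempty (T : Type) (P : nat -> T -> Prop)
    (r : nat -> T -> T -> Prop) :
  (forall n x y, r n x y -> r n y x) ->
  (forall n x y z, r n x y -> r n y z -> r n x z) ->
  (forall n x, P n.+1 x -> P n x) ->
  (forall n, exists x, P n x) ->
  (forall n (s : nat -> T), (forall i, P n (s i)) ->
     exists i j, (i < j)%N /\ r n (s i) (s j)) ->
  exists s : nat -> T, forall n, P n (s n) /\ r n (s n.+1) (s n).
Proof.
move=> rs rt PS /choice[a aP] fin.
have Ple n m x : (n <= m)%N -> P m x -> P n x.
  by move=> /subnK <-; elim: (m - n)%N => // k IH; rewrite addSn => /PS/IH.
(* Infinitely many of the chosen [a m] restrict to the class of [x] at level [n]: such a node of the
   tree has arbitrarily long continuations. *)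
pose fertile n x := P n x /\ forall N, exists m, (N <= m)%N /\ r n (a m) x.
have step n (J : nat -> Prop) :
    (forall N, exists m, (N <= m)%N /\ ((n <= m)%N /\ J m)) ->
    exists m, J m /\ fertile n (a m).
  move=> /increasing_enum[psi [psiI psiJ]].
  have [phi [phiI phiE]] := pigeonhole (@rs n) (@rt n) (@fin n)
    (a := a \o psi) (fun i => Ple _ _ _ (proj1 (psiJ i)) (aP (psi i))).
  exists (psi (phi 0%N)); split; first by have [] := psiJ (phi 0%N).
  split; first exact: Ple (proj1 (psiJ _)) (aP _).
  move=> N; exists (psi (phi N)); split; last exact: phiE.
  exact: leq_trans (increasing_ge phiI N) (increasing_ge psiI _).
have [m0 [_ fert0]] : exists m, True /\ fertile 0%N (a m).
  by apply: step => N; exists N.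
have next (nx : nat * T) : exists y, fertile nx.1 nx.2 ->
    fertile nx.1.+1 y /\ r nx.1 y nx.2.
  case: nx => n x /=; have [[Px fx]|nf] := pselect (fertile n x); last by exists x.
  have [|m [rm fm]] := step n.+1 (fun m => r n (a m) x); last by exists (a m).
  move=> N; have [m [+ rm]] := fx (maxn N n.+1).
  by rewrite geq_max => /andP[Nm nm]; exists m.
have [g gP] := choice next.
pose s := fix s n := if n is k.+1 then g (k, s k) else a m0.
have sF n : fertile n (s n).
  by elim: n => [|n IH] //=; have [] := gP (n, s n) IH.
exists s => n; split; first by have [] := sF n.
by have [] := gP (n, s n) (sF n).
Qed.

Lemma homotopic_rel_sub (R : realType) (X Y : topologicalType) (A A' C : set X)
    (f g : X -> Y) : A `<=` A' ->
  homotopic_rel R A' C f g -> homotopic_rel R A C f g.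
Proof.
move=> AA' [H [cH H0 H1 HC]]; exists H; split=> //.
- by apply: within_sub cH => z [z1 /AA'].
- by move=> x /AA'; exact: H0.
- by move=> x /AA'; exact: H1.
Qed.

(** * Coherent lifts of a phantom map and their gluing *)

Section lifting.
Context (R : realType) (X B Y W : ptopologicalType) (K : cw_complex R X).
Context (phi : pointed_map B Y) (f : pointed_map Y W) (h : pointed_map X W).
Local Notation E := (path_space R f).
Local Notation ml := (map_lift (R := R) (f := f) h).

Lemma sect_homotopic_start (A : set X) (s s' : X -> E) : A point ->
  sect_homotopic R A ml s s' ->
  homotopic_rel R A [set point] (fun x => ps_start (s x)) (fun x => ps_start (s' x)).
Proof.
move=> Ap [H [cH H0 H1 HQ]]; exists (fun z => ps_start (H z)); split.
- apply: (within_comp cH (S' := setT)) => //.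
  exact/continuous_subspaceT/ps_start_continuous.
- by move=> x Ax; rewrite H0.
- by move=> x Ax; rewrite H1.
- move=> t x tI /= xp; rewrite xp -(H0 _ Ap).
  have [_ ->] := HQ t point tI Ap => //.
  by have [|_ ->] := HQ 0 point _ Ap; rewrite // lexx ler01.
Qed.

Definition phantom_lift (n : nat) (s : X -> E) :=
  sect (pskel K n.+1) ml s /\
  exists b : X -> B, [/\ {within skeleton K n, continuous b}, b point = point &
    homotopic_rel R (skeleton K n) [set point] (phi \o b)
      (fun x => ps_start (s x))].

(** The phantom condition on [h] gives a homotopy from [f phi b] to [h]. It is the path coordinate
    of a lift whose component in [Y] is [phi b] itself. *)
Lemma phantom_lift_exists n : relative_phantom K (pointed_comp f phi) h ->
  exists s, phantom_lift n s.
Proof.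
move=> /(_ n)[b [cb bp [H [cH H0 H1 HC]]]].
have cphib : {within skeleton K n, continuous (phi \o b)}.
  apply: (within_comp cb (S' := setT)) => //.
  exact/continuous_subspaceT/pmap_continuous.
have [s [cs ss sp]] := ps_lift (f := f) cphib cH H0.
have I1 : 0 <= (1 : R) <= 1 by rewrite lexx ler01.
have pn : skeleton K n point by rewrite -pskel_skeleton; left.
exists s; split.
  rewrite pskel_skeleton; split=> // x xn; split.
    by rewrite /ps_end sp // H1.
  move=> ->; apply: ps_eq; first by rewrite ss //= bp pmap_point.
  by move=> t tI; rewrite sp // HC //= bp !pmap_point.
exists b; split=> //; exists (fun z => phi (b z.2)); split=> //.
- apply: (within_comp (f := snd) _ cphib) => [|z []//].
  exact/continuous_subspaceT/continuous_snd.
- by move=> x xn; rewrite ss.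
Qed.

Lemma phantom_liftS n s : phantom_lift n.+1 s -> phantom_lift n s.
Proof.
have sn : skeleton K n `<=` skeleton K n.+1.
  by move=> x [e en ex]; exists e => //; exact: leqW.
move=> [sP [b [cb bp hb]]]; split.
  by apply: sect_sub sP => x; exact: pskelS.
exists b; split=> //; first exact: within_sub cb.
exact: homotopic_rel_sub hb.
Qed.

Hypothesis cells_finite : forall m, finite_set [set: cw_cell K m].
Hypothesis cell_lifts : forall n (k : 'rV[R]_n -> W) (b : 'rV[R]_n -> E),
  {within body (disc_gauge R n), continuous k} ->
  finitely_many_sections R (body (disc_gauge R n)) (lift_rel (disc_gauge R n) k b).

Lemma coherent_phantom_lifts : relative_phantom K (pointed_comp f phi) h ->
  exists t : nat -> X -> E, forall n,
    [/\ sect (pskel K n.+1) ml (t n),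
        forall x, pskel K n.+1 x -> t n.+1 x = t n x &
        exists b : X -> B,
          [/\ {within skeleton K n, continuous b}, b point = point &
              homotopic_rel R (skeleton K n) [set point] (phi \o b)
                (fun x => ps_start (t n x))]].
Proof.
move=> hph; have ch := @pmap_continuous _ _ h.
have [s sP] := @inverse_limit_nonempty _ phantom_lift
  (fun n => sect_homotopic R (pskel K n.+1) ml)
  (fun n => @sect_homotopic_sym _ _ _ _ _) (fun n => @sect_homotopic_trans _ _ _ _ _)
  phantom_liftS (fun n => phantom_lift_exists n hph)
  (fun n a aP => pskel_finitely_many ch cells_finite cell_lifts
    (fun i => proj1 (aP i))).
(* The rectified lifts extend each other exactly but are only vertically homotopic to the [s n].
   Factoring through [phi] up to homotopy survives this. *)
pose ok n (t : X -> E) := sect (pskel K n.+1) ml t /\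
  sect_homotopic R (pskel K n.+1) ml (s n) t.
have next (nt : nat * (X -> E)) : exists t', ok nt.1 nt.2 ->
    ok nt.1.+1 t' /\ forall x, pskel K nt.1.+1 x -> t' x = nt.2 x.
  case: nt => n t /=; have [[tP st]|nok] := pselect (ok n t); last by exists t.
  have [_ ss] := sP n; have [[sS _] _] := sP n.+1.
  have [t' [t'P t't st']] := pskel_homotopy_extending ch cells_finite cell_lifts
    sS tP (sect_homotopic_trans ss st).
  by exists t'.
have [g gP] := choice next.
pose t := fix t n := if n is k.+1 then g (k, t k) else s 0%N.
have tok n : ok n (t n).
  elim: n => [|n IH]; last by have [] := gP (n, t n) IH.
  have [[s0 _] _] := sP 0%N; split=> //=.
  exact: sect_homotopic_eq.
exists t => n; have [tn stn] := tok n; split=> //.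
  by have [] := gP (n, t n) (tok n).
have [[_ [b [cb bp hb]]] _] := sP n; exists b; split=> //.
have pn : pskel K n.+1 point by left.
have := sect_homotopic_start pn stn; rewrite pskel_skeleton.
apply: homotopic_rel_trans hb.
by rewrite -pskel_skeleton => _ ->.
Qed.

Lemma phantom_lifts_glue : relative_phantom K (pointed_comp f phi) h ->
  exists g : pointed_map X Y, relative_phantom K phi g /\
    homotopic_rel R setT [set point] (pointed_comp f g) h.
Proof.
move=> /coherent_phantom_lifts[t tP].
have tS n x : pskel K n.+1 x -> t n.+1 x = t n x by have [_ h1 _] := tP n; exact: h1.
have tle n m x : (n <= m)%N -> pskel K n.+1 x -> t m x = t n x.
  move=> /subnK <- xn; elim: (m - n)%N => // k <-.
  rewrite addSn tS //; elim: k => // k IH.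
  by rewrite addSn; exact: pskelS.
(* [lev x] is the dimension of the open cell containing [x]. *)
have /choice[lev levP] x : exists n, pskel K n.+1 x /\
    forall m, pskel K m.+1 x -> (n <= m)%N.
  have [e [ex _]] := cw_partition K x.
  exists (projT1 e); split; first by right; exists e.
  move=> m; rewrite pskel_skeleton => -[e' e'm e'x].
  by rewrite (open_cell_unique ex e'x).
pose T x := t (lev x) x.
have Tt n x : pskel K n.+1 x -> T x = t n x.
  have [xl lm] := levP x => xn.
  by rewrite /T (tle (lev x) n) //; exact: lm.
have cT : continuous T.
  (* The weak topology reduces continuity to closed cells, and on a cell of dimension [n] the glued
     map is the single lift [t n]. *)
  apply/continuous_closedP => V cV; apply: (@cw_weak R X K) => n i.
  have cTi : {within @disc R n, continuous (T \o cw_char i)}.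
    have [[ct _] _ _] := tP n.
    have c1 : {within @disc R n, continuous (t n \o cw_char i)}.
      apply: (within_comp (@cw_continuous _ _ K n i) ct) => x xd.
      exact: pskel_cell.
    by apply: (within_eq _ c1) => x xd /=; rewrite (Tt n) //; exact: pskel_cell.
  apply: closed_compact_image_preimage => //.
  - exact: cw_hausdorff K.
  - exact: disc_compact.
  - exact: cw_continuous.
have TQ x : ml x (T x).
  have [xl _] := levP x; rewrite (Tt _ _ xl).
  by have [[_ tQ] _ _] := tP (lev x); exact: tQ.
have Tp : T point = ps_point R f by have [_ ->] := TQ point.
have cg : continuous (fun x => ps_start (T x)).
  exact: (continuous_fun_comp cT (@ps_start_continuous _ _ _ f)).
have gp : ps_start (T point) = point by rewrite Tp.
exists (PointedMap cg gp); split.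
  move=> n; have [_ _ [b [cb bp hb]]] := tP n; exists b; split=> //.
  have ps : [set point] `<=` skeleton K n.
    by move=> _ ->; rewrite -pskel_skeleton; exact: pskel_point.
  apply: (homotopic_rel_trans ps hb).
  exists (fun z => ps_start (T z.2)); split=> //=.
  - apply: continuous_subspaceT.
    exact: (continuous_fun_comp (@continuous_snd _ _) cg).
  - by move=> x xn; rewrite (Tt n) // pskel_skeleton.
  - move=> s x _ ->; rewrite (Tt n) //; exact: pskel_point.
(* The paths carried by the glued lift form the homotopy to [h] on all of [X]. *)
exists (fun z => ps_path (T z.2) z.1); split=> /=.
- apply: continuous_subspaceT.
  have c1 := continuous_pair (@continuous_fst R X)
    (continuous_fun_comp (@continuous_snd R X) cT).
  exact: (continuous_fun_comp c1 (@ps_eval_continuous _ _ _ f)).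
- by move=> x _; exact: ps_path0.
- by move=> x _; have [] := TQ x.
- by move=> s x _ ->; rewrite Tp pmap_point.
Qed.

End lifting.

(** * Surjectivity on relative phantom classes *)

Theorem theorem1p5 (R : realType) (X B Y Y' : ptopologicalType)
    (K : cw_complex R X) (phi : pointed_map B Y) (f : pointed_map Y Y') :
  finite_type_source K ->
  finite_type_target R B -> simply_connected R B ->
  finite_type_target R Y -> simply_connected R Y ->
  finite_type_target R Y' -> simply_connected R Y' ->
  rational_equivalence R f ->
  set_fun (Ph K phi) (Ph K (pointed_comp f phi)) (hclass_post (R := R) (X := X) f) /\
  set_surj (Ph K phi) (Ph K (pointed_comp f phi)) (hclass_post (R := R) (X := X) f).
Proof.
move=> [_ cells] _ _ fY sY fY' sY' req; split.
  (* Phantoms are preserved with the same lifts [hn], their homotopies being composed with [f]. *)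
  move=> _ [h hph <-]; rewrite hclass_post_pi; exists (pointed_comp f h) => // n.
  have [hn [chn hnp hhn]] := hph n; exists hn; split=> //.
  exact: homotopic_rel_post (@pmap_continuous _ _ f) hhn.
move=> _ [h hph <-].
have cell_lifts n (k : 'rV[R]_n -> Y') (b : 'rV[R]_n -> path_space R f) :=
  @finitely_many_cell_lifts R Y Y' f n k b fY sY fY' sY' req.
have [g [gph fgh]] := phantom_lifts_glue cells cell_lifts hph.
exists (\pi_(hclass R X Y) g); first by exists g.
by rewrite hclass_post_pi; apply/hclass_eqP.
Qed.
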